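(* There exist constants $C>0$ and $D>0$ such that for every $\nu\in[-1,1]$, every $k\in\mathbb{Z}\setminus\{0\}$ and every $\rho\in\mathbb{R}\setminus\{0\}$ (so $C,D$ are independent of $k$, $\nu$ and $\rho$), with $\gamma=\sqrt{k^2-\nu^2}$, $$ j_{0,k}(\rho)+j_{1,k}(\rho)\le C\times \begin{cases} \big(\min\{|\rho|/2,\,1\}\big)^{\gamma-1}e^{-D|k|}, & 0<|\rho|\le \max\{|k|/2,\,2\},\\[2pt] |k|^{-3/4}\big(\big||k|-|\rho|\big|+|k|^{1/3}\big)^{-1/4}, & |k|/2\le|\rho|\le 2|k|,\\[2pt] |\rho|^{-1}, & |\rho|\ge 2|k|, \end{cases} $$ where $$ j_{0,k}(\rho):=|\psi_k(\rho)|,\qquad j_{1,k}(\rho):=\big|\psi_k'(\rho)-(\gamma-1)\rho^{-1}\psi_k(\rho)\big|. $$ (Each bound holds for all $\rho$ in the indicated range, including where ranges overlap.)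
   Context: For $\nu\in[-1,1]$ and $k\in\mathbb{Z}\setminus\{0\}$ put $\gamma=\sqrt{k^2-\nu^2}\ge 0$. The function $\psi_k=\begin{pmatrix}F_k\\ G_k\end{pmatrix}:\mathbb{R}\setminus\{0\}\to\mathbb{R}^2$ (the radial generalized eigenfunction of the massless Dirac-Coulomb operator $-i\alpha\cdot\nabla-\nu/|x|$ with energy $1$ on the partial wave of index $k$) is defined by taking $F_k(\rho)$ and $G_k(\rho)$ real with $$ (G_k+iF_k)(\rho)=\frac{\sqrt2\,|\Gamma(\gamma+1+i\nu)|}{\Gamma(2\gamma+1)}\,e^{\pi\nu/2+i(\rho+\xi)}\,|2\rho|^{\gamma-1}\,{}_1F_1(\gamma-i\nu,\,2\gamma+1,\,-2i\rho), $$ where ${}_1F_1(a,b,z)$ is the confluent hypergeometric function (Kummer's function) and $\xi\in\mathbb{R}$ is a phase shift determined by $e^{-2i\xi}=\frac{\gamma-i\nu}{k}$ (so $\psi_k$ is determined up to a global sign, which is irrelevant here). $\psi_k'$ denotes the derivative with respect to $\rho$, and $|\cdot|$ on vectors is the Euclidean norm. *)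

(* Defs.v *)
From Stdlib Require Import Reals ZArith.
From Coquelicot Require Import Coquelicot.

Local Open Scope R_scope.

Definition Cexp (z : C) : C :=
  (exp (Re z) * cos (Im z), exp (Re z) * sin (Im z)).

(* Euler's integral, int_0^oo t^(z-1) e^(-t) dt with t^(z-1) = e^((z-1) ln t);
   it represents Gamma only for Re z > 0, the only case needed here
   (z = gamma + 1 + i nu and z = 2 gamma + 1, with gamma >= 0). *)
Definition CGamma (z : C) : C :=
  @RInt_gen C_R_CompleteNormedModule
    (fun t : R => (Cexp ((z - 1) * RtoC (ln t)) * RtoC (exp (- t)))%C)
    (at_right 0) (Rbar_locally p_infty).

Fixpoint Cpochhammer (a : C) (n : nat) : C :=
  match n with
  | O => RtoC 1
  | S m => (Cpochhammer a m * (a + RtoC (INR m)))%C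
  end.

Definition hyp1F1_term (a b z : C) (n : nat) : C :=
  (Cpochhammer a n / Cpochhammer b n * (z ^ n / RtoC (INR (fact n))))%C.

Definition hyp1F1 (a b z : C) : C :=
  (Series (fun n => Re (hyp1F1_term a b z n)),
   Series (fun n => Im (hyp1F1_term a b z n))).

Definition gam (nu : R) (k : Z) : R := sqrt (IZR k ^ 2 - nu ^ 2).

(* This determines xi modulo pi only, hence the eigenfunction up to a sign. *)
Definition is_phase_shift (nu : R) (k : Z) (xi : R) : Prop :=
  Cexp (- (2 * Ci * RtoC xi))%C
  = ((RtoC (gam nu k) - Ci * RtoC nu) / RtoC (IZR k))%C.

(* The complex-valued function G_k + i F_k. *)
Definition GiF (nu : R) (k : Z) (xi rho : R) : C :=
  let g := gam nu k in
  (RtoC (sqrt 2 * Cmod (CGamma (RtoC g + 1 + Ci * RtoC nu)))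
   / CGamma (2 * RtoC g + 1)
   * Cexp (RtoC (PI * nu / 2) + Ci * RtoC (rho + xi))
   * RtoC (Rpower (Rabs (2 * rho)) (g - 1))
   * hyp1F1 (RtoC g - Ci * RtoC nu) (2 * RtoC g + 1)
            (- (2 * Ci * RtoC rho)))%C.

Definition Fk (nu : R) (k : Z) (xi rho : R) : R := Im (GiF nu k xi rho).
Definition Gk (nu : R) (k : Z) (xi rho : R) : R := Re (GiF nu k xi rho).

Definition psi (nu : R) (k : Z) (xi rho : R) : R * R :=
  (Fk nu k xi rho, Gk nu k xi rho).

Definition dpsi (nu : R) (k : Z) (xi rho : R) : R * R :=
  (Derive (Fk nu k xi) rho, Derive (Gk nu k xi) rho).

Definition enorm (v : R * R) : R := sqrt (fst v ^ 2 + snd v ^ 2).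

Definition j0 (nu : R) (k : Z) (xi rho : R) : R := enorm (psi nu k xi rho).

Definition j1 (nu : R) (k : Z) (xi rho : R) : R :=
  let c := (gam nu k - 1) * / rho in
  enorm (fst (dpsi nu k xi rho) - c * fst (psi nu k xi rho),
         snd (dpsi nu k xi rho) - c * snd (psi nu k xi rho)).

(* Main.v *)
(* The phase xi does not affect |psi| and |psi' - (g - 1) psi / rho|, and
   rho < 0 amounts to nu -> -nu, so let r = |rho| and M = e^(ir) 1F1 = X + iY.
   Kummer's transformation gives X' = -(1 + 2 nu/r) Y and Y' = X - (2g/r) Y, so
   that Q = r^g Y solves the Coulomb wave equation Q'' + q Q = 0 with
   q = 1 + 2 nu/r - (g^2 + g)/r^2, whose turning point is at distance O(1) from |k|.

   The amplitude |c| of r^g M at infinity comes from the Laplace transform L of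
   r^(2g) e^(-ir) M: the quantity |L|^2 s^(2g+2) (s^2 + 4)^g e^(-2 nu atan(s/2))
   is constant; it tends to 4^g |c|^2 |Gamma(g+1+i nu)|^2 as s -> 0 and to
   Gamma(2g+1)^2 e^(-pi nu) as s -> oo. Hence the prefactor of psi makes its
   amplitude at infinity bounded uniformly in k and nu.

   From infinity the bounds are propagated inwards: by the energy Q'^2 + q Q^2 on
   r >= 2|k|; by the WKB energy sqrt q Q^2 + Q'^2/sqrt q + q'/(2 q^(3/2)) Q Q' down
   to |k| + O(|k|^(1/3)); by Gronwall's inequality at scale |k|^(1/3) across the
   turning point; and below it the energy Q'^2 + q Q^2 is increasing from 0, so that
   Q'^2 >= |q| Q^2, which forces decay. The range r <= 2 and bounded k follow from
   |1F1| <= e^(2r) and Gamma(2g+1) >= Gamma(g+1)^2. *)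
Require Import Defs.
From Stdlib Require Import Reals ZArith Lra Lia Psatz.
From Coquelicot Require Import Coquelicot.

Local Open Scope R_scope.

(** * Integrals over the half-line *)

(** The difficulty is uniformity in k and nu: the normalization is a quotient of Gamma values, tiny
    for large k, and the regular solution grows by a compensating amount across the forbidden
    region. No asymptotics of Gamma enter. The invariant ties the amplitude at infinity exactly to
    the Gamma values of the prefactor, so they cancel, and the limits s -> 0 and s -> oo may be
    taken without any rate. Kummer's transformation is proved through the contiguous function 1F1(a
    + 1, 2g + 1, -2ir), a = g - i nu: it forms a closed system with 1F1(a, 2g + 1, -2ir), and a
    uniqueness result at the singular point r = 0 identifies it, after rotation, with the conjugate
    of M. Near the turning point squares and fourth powers of Q and Q' are estimated; the exponent
    -1/4 appears only in the last step, by taking two square roots. The energy estimates inside r <=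
    2k are run for k >= 216 = 6^3, so that k^(1/3) >= 6 leaves room for crude numerical constants.
    For smaller k, apart from r <= 2 and r >= 432, only a fixed compact range of r remains. *)

Ltac rewrite_derives :=
  repeat match goal with
  | H : is_derive ?f ?x ?l |- context [Derive ?g ?x] =>
      (* [auto_derive] leaves eta-expanded functions under [Derive]; [g] is matched apart from [f]
         and identified with it by conversion. *)
      replace (Derive g x) with l by (symmetry; exact (is_derive_unique f x l H))
  end.

Lemma exp_le_exp (a b : R) : a <= b -> exp a <= exp b.
Proof.
  intros [H| ->]; [left; apply exp_increasing, H|right; reflexivity].
Qed.

Lemma derive_nonneg_le (f f' : R -> R) (a b : R) :
  a <= b -> (forall x, a <= x <= b -> is_derive f x (f' x)) ->
  (forall x, a <= x <= b -> 0 <= f' x) -> f a <= f b.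
Proof.
  intros Hab Hd Hp.
  destruct (MVT_gen f a b f') as [c [Hc E]];
    rewrite ?Rmin_left, ?Rmax_right in * by lra.
  - intros x Hx. apply Hd. lra.
  - intros x Hx. apply derivable_continuous_pt.
    exists (f' x). apply is_derive_Reals, Hd, Hx.
  - specialize (Hp c Hc). nra.
Qed.

(** Both [g + f] and [g - f] are nondecreasing. This stands in for integrating |f'| <= g', and
    yields limits, convergence of integrals and Lipschitz bounds. *)
Lemma derive_dominated_le (f f' g g' : R -> R) (a b : R) :
  a <= b ->
  (forall x, a <= x <= b -> is_derive f x (f' x)) ->
  (forall x, a <= x <= b -> is_derive g x (g' x)) ->
  (forall x, a <= x <= b -> Rabs (f' x) <= g' x) ->
  Rabs (f b - f a) <= g b - g a.
Proof.
  intros Hab Hf Hg H. apply Rabs_le. split.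
  - enough (f a + g a <= f b + g b) by lra.
    apply (derive_nonneg_le (fun x => f x + g x) (fun x => f' x + g' x)); auto.
    + intros x Hx. apply @is_derive_plus; auto.
    + intros x Hx. specialize (H x Hx). apply Rabs_le_between in H. lra.
  - enough (g a - f a <= g b - f b) by lra.
    apply (derive_nonneg_le (fun x => g x - f x) (fun x => g' x - f' x)); auto.
    + intros x Hx. apply @is_derive_minus; auto.
    + intros x Hx. specialize (H x Hx). apply Rabs_le_between in H. lra.
Qed.

Lemma abs_sin_le (t : R) : 0 <= t -> Rabs (sin t) <= t.
Proof.
  intros Ht. replace (sin t) with (sin t - sin 0) by (rewrite sin_0; ring).
  replace t with (t - 0) at 2 by ring.
  apply (derive_dominated_le sin cos (fun x => x) (fun _ => 1)); auto.
  - intros; auto_derive; [auto|ring].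
  - intros; auto_derive; [auto|ring].
  - intros x _. apply Rabs_le, COS_bound.
Qed.

Lemma abs_cos_sub1_le (t : R) : 0 <= t -> Rabs (cos t - 1) <= t.
Proof.
  intros Ht. replace (cos t - 1) with (cos t - cos 0) by (rewrite cos_0; ring).
  replace t with (t - 0) at 2 by ring.
  apply (derive_dominated_le cos (fun x => - sin x) (fun x => x) (fun _ => 1)); auto.
  - intros; auto_derive; [auto|ring].
  - intros; auto_derive; [auto|ring].
  - intros x _. rewrite Rabs_Ropp. apply Rabs_le, SIN_bound.
Qed.

(** * Limits at 0 from the right and at infinity *)

Definition lim0 (f : R -> R) (l : R) : Prop :=
  filterlim f (at_right 0) (locally l).
Definition limoo (f : R -> R) (l : R) : Prop :=
  filterlim f (Rbar_locally p_infty) (locally l).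

Lemma lim0_spec (f : R -> R) (l : R) :
  lim0 f l <-> forall e, 0 < e -> exists d, 0 < d /\
    forall t, 0 < t < d -> Rabs (f t - l) < e.
Proof.
  unfold lim0. split.
  - intros H e He.
    assert (H1 := proj1 (filterlim_locally f l) H (mkposreal e He)).
    destruct H1 as [d Hd]. exists d. split; [apply cond_pos|].
    intros t Ht. apply (Hd t); [|lra].
    change (Rabs (t - 0) < d). rewrite Rabs_pos_eq; lra.
  - intros H. apply filterlim_locally. intros e.
    destruct (H e (cond_pos e)) as [d [Hd Hd']].
    exists (mkposreal d Hd). intros t Ht Ht0.
    change (Rabs (t - 0) < d) in Ht.
    apply Hd'. rewrite Rabs_pos_eq in Ht by lra. lra.
Qed.

Lemma limoo_spec (f : R -> R) (l : R) :
  limoo f l <-> forall e, 0 < e -> exists M, 0 < M /\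
    forall t, M < t -> Rabs (f t - l) < e.
Proof.
  unfold limoo. split.
  - intros H e He.
    destruct (proj1 (filterlim_locally f l) H (mkposreal e He)) as [M HM].
    exists (Rmax M 1). split; [pose proof (Rmax_r M 1); lra|].
    intros t Ht. apply (HM t). pose proof (Rmax_l M 1); lra.
  - intros H. apply filterlim_locally. intros e.
    destruct (H e (cond_pos e)) as [M [HM HM']].
    exists M. intros t Ht. apply HM', Ht.
Qed.

Lemma filterlim_Rplus {T} {F : (T -> Prop) -> Prop} {FF : Filter F}
  (f g : T -> R) (lf lg : R) :
  filterlim f F (locally lf) -> filterlim g F (locally lg) ->
  filterlim (fun x => f x + g x) F (locally (lf + lg)).
Proof.
  intros H1 H2. eapply filterlim_comp_2; [apply H1|apply H2|].
  apply (filterlim_plus lf lg).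
Qed.

Lemma filterlim_Rscal {T} {F : (T -> Prop) -> Prop} {FF : Filter F}
  (f : T -> R) (c lf : R) :
  filterlim f F (locally lf) ->
  filterlim (fun x => c * f x) F (locally (c * lf)).
Proof.
  intros H1. eapply filterlim_comp; [apply H1|].
  apply (filterlim_scal_r c lf).
Qed.

Lemma filterlim_Rmult {T} {F : (T -> Prop) -> Prop} {FF : Filter F}
  (f g : T -> R) (lf lg : R) :
  filterlim f F (locally lf) -> filterlim g F (locally lg) ->
  filterlim (fun x => f x * g x) F (locally (lf * lg)).
Proof.
  intros H1 H2. eapply filterlim_comp_2; [apply H1|apply H2|].
  apply (filterlim_mult lf lg).
Qed.

Lemma filterlim_Rle {T} {F : (T -> Prop) -> Prop} {FF : ProperFilter F}
  (f g : T -> R) (lf lg : R) :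
  F (fun x => f x <= g x) ->
  filterlim f F (locally lf) -> filterlim g F (locally lg) -> lf <= lg.
Proof.
  intros H H1 H2.
  exact (filterlim_le (F:=F) f g (Finite lf) (Finite lg) H H1 H2).
Qed.

Lemma at_right0_pos (P : R -> Prop) (d : R) :
  0 < d -> (forall t, 0 < t < d -> P t) -> at_right 0 P.
Proof.
  intros Hd H. exists (mkposreal d Hd). intros t Ht Ht0.
  change (Rabs (t - 0) < d) in Ht. rewrite Rabs_pos_eq in Ht by lra.
  apply H. lra.
Qed.

Lemma infty_large (P : R -> Prop) (M : R) :
  (forall t, M < t -> P t) -> Rbar_locally p_infty P.
Proof. intros H. exists M. exact H. Qed.

Lemma lim0_dominated (f : R -> R) (B : R) :
  (forall t, 0 < t < 1 -> Rabs (f t) <= B * t) -> lim0 f 0.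
Proof.
  intros H. apply lim0_spec. intros e He.
  exists (Rmin 1 (e / (Rabs B + 1))).
  pose proof (Rabs_pos B).
  assert (0 < e / (Rabs B + 1)) by (apply Rdiv_lt_0_compat; lra).
  split; [apply Rmin_glb_lt; lra|].
  intros t Ht.
  pose proof (Rmin_l 1 (e / (Rabs B + 1))).
  pose proof (Rmin_r 1 (e / (Rabs B + 1))).
  rewrite Rminus_0_r. eapply Rle_lt_trans; [apply H; lra|].
  assert (t * (Rabs B + 1) < e).
  { replace e with (e / (Rabs B + 1) * (Rabs B + 1)) by (field; lra).
    apply Rmult_lt_compat_r; lra. }
  pose proof (Rle_abs B). nra.
Qed.

Lemma limoo_dominated (f : R -> R) (B M : R) :
  (forall t, M < t -> Rabs (f t) <= B / t) -> limoo f 0.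
Proof.
  intros H. apply limoo_spec. intros e He.
  pose proof (Rabs_pos B). pose proof (Rle_abs B).
  pose proof (Rabs_pos M). pose proof (Rle_abs M).
  assert (0 <= Rabs B / e) by (apply Rdiv_le_0_compat; lra).
  exists (1 + Rabs M + Rabs B / e). split; [lra|].
  intros t Ht. rewrite Rminus_0_r.
  eapply Rle_lt_trans; [apply H; lra|].
  assert (Rabs B < e * t).
  { replace (Rabs B) with (e * (Rabs B / e)) by (field; lra).
    apply Rmult_lt_compat_l; lra. }
  apply Rlt_div_l; lra.
Qed.

(** Cauchy criterion: at two points where [g] is within e/2 of its limit, the values of [g], hence
    those of [f], differ by less than e. *)
Lemma ex_filterlim_dominated {F : (R -> Prop) -> Prop} {FF : ProperFilter F}
  (D : R -> Prop) (f g : R -> R) (lg : R) :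
  F D -> (forall u v, D u -> D v -> u <= v -> Rabs (f v - f u) <= g v - g u) ->
  filterlim g F (locally lg) -> exists l : R, filterlim f F (locally l).
Proof.
  intros HD H Hg.
  apply (filterlim_locally_cauchy (U:=R_CompleteSpace)). intros e.
  assert (He : 0 < e / 2) by (pose proof (cond_pos e); lra).
  assert (Hg' := proj1 (filterlim_locally g lg) Hg (mkposreal _ He)).
  exists (fun u => D u /\ Rabs (g u - lg) < e / 2).
  split; [apply filter_and; [exact HD|exact Hg']|].
  assert (key : forall u v, D u /\ Rabs (g u - lg) < e / 2 -> D v /\ Rabs (g v - lg) < e / 2 ->
    u <= v -> Rabs (f v - f u) < e).
  { intros u v [Du Gu] [Dv Gv] Huv. eapply Rle_lt_trans; [apply H; auto|].
    apply Rabs_lt_between in Gu, Gv. lra. }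
  intros u v Hu Hv. change (Rabs (f v - f u) < e).
  destruct (Rle_dec u v); [apply key; auto|].
  rewrite Rabs_minus_sym. apply key; auto; lra.
Qed.

Lemma limoo_dominated_derive (f f' g g' : R -> R) (M lg : R) :
  (forall x, M < x -> is_derive f x (f' x)) ->
  (forall x, M < x -> is_derive g x (g' x)) ->
  (forall x, M < x -> Rabs (f' x) <= g' x) ->
  limoo g lg -> exists l, limoo f l.
Proof.
  intros Hf Hg H. apply (ex_filterlim_dominated (fun x => M < x)); [exists M; auto|].
  intros u v Hu Hv Huv.
  apply (derive_dominated_le f f' g g'); auto; intros; [apply Hf|apply Hg|apply H]; lra.
Qed.

Lemma lim0_dominated_derive (f f' g g' : R -> R) (lg : R) :
  (forall x, 0 < x -> is_derive f x (f' x)) ->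
  (forall x, 0 < x -> is_derive g x (g' x)) ->
  (forall x, 0 < x -> Rabs (f' x) <= g' x) ->
  lim0 g lg -> exists l, lim0 f l.
Proof.
  intros Hf Hg H. apply (ex_filterlim_dominated (fun x => 0 < x)).
  - apply (at_right0_pos _ 1); intros; lra.
  - intros u v Hu Hv Huv.
    apply (derive_dominated_le f f' g g'); auto; intros; [apply Hf|apply Hg|apply H]; lra.
Qed.

(** An improper integral witnessed by a primitive. Nothing is required at t = 0, where ln t is
    singular, and order, linearity and scaling become statements on monotone functions and limits;
    the link with [RInt_gen] is made once, in [halfline_int_RInt_gen]. *)
Definition halfline_int (f : R -> R) (l : R) : Prop :=
  exists F, (forall t, 0 < t -> is_derive F t (f t)) /\ lim0 F 0 /\ limoo F l.

(** The difference of the two primitives is nondecreasing and starts from 0. *)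
Lemma halfline_int_le (f g : R -> R) (lf lg : R) :
  (forall t, 0 < t -> f t <= g t) ->
  halfline_int f lf -> halfline_int g lg -> lf <= lg.
Proof.
  intros H [F [HF [F0 F1]]] [G [HG [G0 G1]]].
  assert (E : forall x y, 0 < x <= y -> G x + (-1) * F x <= G y + (-1) * F y).
  { intros x y Hxy.
    apply (derive_nonneg_le (fun x => G x + (-1) * F x) (fun x => g x + (-1) * f x)); [lra| |].
    - intros t Ht. apply @is_derive_plus; [apply HG; lra|].
      apply is_derive_scal. apply HF. lra.
    - intros t Ht. specialize (H t ltac:(lra)). lra. }
  assert (L0 : lim0 (fun x => G x + (-1) * F x) (0 + (-1) * 0)).
  { apply filterlim_Rplus; [apply G0|]. apply filterlim_Rscal, F0. }
  assert (L1 : limoo (fun x => G x + (-1) * F x) (lg + (-1) * lf)).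
  { apply filterlim_Rplus; [apply G1|]. apply filterlim_Rscal, F1. }
  assert (N : 0 + (-1) * 0 <= G 1 + (-1) * F 1).
  { apply (filterlim_Rle (F:=at_right 0) (fun x => G x + (-1) * F x)
      (fun _ => G 1 + (-1) * F 1)); [|exact L0|apply filterlim_const].
    apply (at_right0_pos _ 1); [lra|]. intros; apply E; lra. }
  assert (N' : G 1 + (-1) * F 1 <= lg + (-1) * lf).
  { apply (filterlim_Rle (F:=Rbar_locally p_infty)
      (fun _ => G 1 + (-1) * F 1) (fun x => G x + (-1) * F x));
      [|apply filterlim_const|exact L1].
    apply (infty_large _ 1). intros; apply E; lra. }
  lra.
Qed.

Lemma halfline_int_unique (f : R -> R) (l l' : R) :
  halfline_int f l -> halfline_int f l' -> l = l'.
Proof.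
  intros H H'. apply Rle_antisym; eapply halfline_int_le; eauto; intros; lra.
Qed.

Lemma halfline_int_ext (f g : R -> R) (l : R) :
  (forall t, 0 < t -> f t = g t) -> halfline_int f l -> halfline_int g l.
Proof.
  intros H [F [HF [F0 F1]]]. exists F. split; [|split]; auto.
  intros t Ht. rewrite <- H; auto.
Qed.

Lemma halfline_int_plus (f g : R -> R) (lf lg : R) :
  halfline_int f lf -> halfline_int g lg ->
  halfline_int (fun t => f t + g t) (lf + lg).
Proof.
  intros [F [HF [F0 F1]]] [G [HG [G0 G1]]].
  exists (fun t => F t + G t). split; [|split].
  - intros t Ht. apply @is_derive_plus; auto.
  - unfold lim0. replace 0 with (0 + 0) at 2 by ring. apply filterlim_Rplus; auto.
  - apply filterlim_Rplus; auto.
Qed.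

Lemma halfline_int_scal (f : R -> R) (c lf : R) :
  halfline_int f lf -> halfline_int (fun t => c * f t) (c * lf).
Proof.
  intros [F [HF [F0 F1]]].
  exists (fun t => c * F t). split; [|split].
  - intros t Ht. apply is_derive_scal; auto.
  - unfold lim0. replace 0 with (c * 0) at 2 by ring. apply filterlim_Rscal; auto.
  - apply filterlim_Rscal; auto.
Qed.

Lemma halfline_int_lin (f g : R -> R) (a b lf lg : R) :
  halfline_int f lf -> halfline_int g lg ->
  halfline_int (fun t => a * f t + b * g t) (a * lf + b * lg).
Proof. intros. apply halfline_int_plus; apply halfline_int_scal; auto. Qed.

Lemma halfline_int_rescale (f : R -> R) (s l : R) :
  0 < s -> halfline_int f l -> halfline_int (fun t => f (s * t)) (l / s).
Proof.
  intros Hs [F [HF [F0 F1]]].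
  exists (fun t => / s * F (s * t)). split; [|split].
  - intros t Ht. assert (0 < s * t) by nra.
    auto_derive.
    + exists (f (s * t)). apply HF; auto.
    + replace (Derive (fun x => F x) (s * t)) with (f (s * t)).
      * field; lra.
      * symmetry. apply is_derive_unique, HF; auto.
  - unfold lim0. replace 0 with (/ s * 0) at 2 by ring. apply filterlim_Rscal.
    apply lim0_spec. intros e He.
    destruct (proj1 (lim0_spec F 0) F0 e He) as [d [Hd Hd']].
    exists (d / s). split; [apply Rdiv_lt_0_compat; lra|].
    intros t Ht. apply Hd'. split; [nra|].
    rewrite Rmult_comm. apply Rlt_div_r; lra.
  - unfold limoo. replace (l / s) with (/ s * l) by (field; lra). apply filterlim_Rscal.
    apply limoo_spec. intros e He.
    destruct (proj1 (limoo_spec F l) F1 e He) as [d [Hd Hd']].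
    exists (d / s). split; [apply Rdiv_lt_0_compat; lra|].
    intros t Ht. apply Hd'.
    rewrite Rmult_comm. apply Rlt_div_l; lra.
Qed.

(** The primitive of [f] based at 1 has increments dominated by those of the primitive of [g], so it
    converges at both ends; subtracting its limit at 0 normalizes it. *)
Lemma halfline_int_dominated (f g : R -> R) (lg : R) :
  (forall t, 0 < t -> continuous f t) ->
  (forall t, 0 < t -> Rabs (f t) <= g t) ->
  halfline_int g lg -> exists l, halfline_int f l /\ Rabs l <= lg.
Proof.
  intros Hc H HG'. pose proof HG' as [G [HG [G0 G1]]].
  set (F := fun y => RInt f 1 y).
  assert (HF : forall t, 0 < t -> is_derive F t (f t)).
  { intros t Ht. apply (is_derive_RInt f F 1 t); [|apply Hc, Ht].
    exists (mkposreal t Ht). intros y Hy. change (Rabs (y - t) < t) in Hy.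
    apply Rabs_lt_between in Hy.
    apply (RInt_correct (V:=R_CompleteNormedModule)).
    apply (ex_RInt_continuous (V:=R_CompleteNormedModule)).
    intros z Hz. apply Hc. unfold Rmin in Hz. destruct (Rle_dec 1 y); lra. }
  destruct (lim0_dominated_derive F f G g 0 HF HG H G0) as [l0 L0].
  destruct (limoo_dominated_derive F f G g 0 lg) as [l1 L1]; auto.
  assert (HI : halfline_int f (l1 - l0)).
  { exists (fun t => F t + (- l0)). split; [|split].
    - intros t Ht. replace (f t) with (f t + 0) by ring.
      apply @is_derive_plus; [auto|]. apply @is_derive_const.
    - unfold lim0. replace 0 with (l0 + - l0) at 2 by ring.
      apply filterlim_Rplus; [exact L0|apply filterlim_const].
    - apply filterlim_Rplus; [exact L1|apply filterlim_const]. }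
  exists (l1 - l0). split; auto.
  assert (Hop := halfline_int_scal _ (-1) _ HG').
  apply Rabs_le. split.
  - enough (-1 * lg <= l1 - l0) by lra.
    eapply halfline_int_le; [|exact Hop|exact HI].
    intros t Ht. simpl. specialize (H t Ht). apply Rabs_le_between in H. lra.
  - eapply halfline_int_le; [|exact HI|exact HG'].
    intros t Ht. specialize (H t Ht). apply Rabs_le_between in H. lra.
Qed.

Lemma halfline_int_exp (C d : R) :
  0 < d -> halfline_int (fun t => C * exp (- (d * t))) (C / d).
Proof.
  intros Hd. exists (fun t => C / d * (1 - exp (- (d * t)))). split; [|split].
  - intros t Ht. auto_derive; [auto|]. field. lra.
  - apply (lim0_dominated _ (Rabs C)).
    intros t Ht.
    pose proof (exp_ineq1_le (- (d * t))).
    assert (exp (- (d * t)) <= 1).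
    { rewrite <- exp_0. apply exp_le_exp. nra. }
    rewrite Rabs_mult. rewrite (Rabs_pos_eq (1 - _)) by lra.
    unfold Rdiv. rewrite Rabs_mult, (Rabs_pos_eq (/ d)) by (left; apply Rinv_0_lt_compat; lra).
    rewrite Rmult_assoc. apply Rmult_le_compat_l; [apply Rabs_pos|].
    rewrite Rmult_comm. apply Rle_div_l; [lra|]. lra.
  - apply limoo_spec. intros e He.
    set (q := e / (Rabs (C / d) + 1)).
    assert (Hq : 0 < q).
    { apply Rdiv_lt_0_compat; [lra|]. pose proof (Rabs_pos (C/d)). lra. }
    exists (1 + Rabs (ln q) / d).
    pose proof (Rabs_pos (ln q)). pose proof (Rle_abs (- ln q)).
    rewrite Rabs_Ropp in *.
    split. { assert (0 <= Rabs (ln q) / d) by (apply Rdiv_le_0_compat; lra). lra. }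
    intros t Ht.
    assert (Rabs (ln q) < d * t).
    { replace (Rabs (ln q)) with (d * (Rabs (ln q) / d)) by (field; lra).
      apply Rmult_lt_compat_l; lra. }
    assert (exp (- (d * t)) < q).
    { rewrite <- (exp_ln q Hq). apply exp_increasing. lra. }
    replace (C / d * (1 - exp (- (d * t))) - C / d) with (- (C / d * exp (- (d * t)))) by ring.
    rewrite Rabs_Ropp, Rabs_mult. pose proof (exp_pos (- (d * t))).
    rewrite (Rabs_pos_eq (exp _)) by lra.
    pose proof (Rabs_pos (C / d)).
    apply Rle_lt_trans with (Rabs (C / d) * q); [apply Rmult_le_compat_l; lra|].
    unfold q.
    replace (Rabs (C / d) * (e / (Rabs (C / d) + 1))) with
      (e * (Rabs (C / d) / (Rabs (C / d) + 1))) by (field; lra).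
    rewrite <- (Rmult_1_r e) at 2. apply Rmult_lt_compat_l; [lra|].
    apply Rlt_div_l; lra.
Qed.

Lemma halfline_int_RInt_gen (f : R -> R) (l : R) :
  (forall t, 0 < t -> continuous f t) -> halfline_int f l ->
  is_RInt_gen f (at_right 0) (Rbar_locally p_infty) l.
Proof.
  intros Hc [F [HF [F0 F1]]].
  assert (FP : forall P : R -> Prop, (forall x, 0 < x -> P x) ->
     filter_prod (at_right 0) (Rbar_locally p_infty)
      (fun ab : R * R => forall x : R,
          Rmin (fst ab) (snd ab) <= x <= Rmax (fst ab) (snd ab) -> P x)).
  { intros P HP.
    apply (Filter_prod _ _ _ (fun x => 0 < x) (fun y => 1 < y)).
    - apply (at_right0_pos _ 1); intros; lra.
    - exists 1; auto.
    - simpl. intros x y Hx Hy z Hz. apply HP. unfold Rmin in Hz.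
      destruct (Rle_dec x y); lra. }
  apply (is_RInt_gen_ext (Derive F)).
  { assert (FP' := FP (fun x => Derive F x = f x)).
    destruct FP' as [P Q HP HQ H].
    - intros x Hx. apply is_derive_unique, HF, Hx.
    - apply (Filter_prod _ _ _ P Q HP HQ).
      intros x y Px Qy z Hz. apply (H x y Px Qy). lra. }
  replace l with (l - 0) by ring.
  apply is_RInt_gen_Derive; auto.
  - apply FP. intros x Hx. exists (f x). apply HF, Hx.
  - apply FP. intros x Hx. apply (continuous_ext_loc (Derive F) f x); [|apply Hc, Hx].
    exists (mkposreal x Hx). intros y Hy. change (Rabs (y - x) < x) in Hy.
    apply Rabs_lt_between in Hy. symmetry. apply is_derive_unique, HF. lra.
Qed.

Lemma halfline_int_ge_RInt (f : R -> R) (l a b c : R) :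
  0 < a <= b -> (forall t, 0 < t -> 0 <= f t) ->
  (forall t, a <= t <= b -> c <= f t) -> halfline_int f l -> c * (b - a) <= l.
Proof.
  intros Hab Hp Hc [F [HF [F0 F1]]].
  assert (E : forall x y, 0 < x <= y -> F x <= F y).
  { intros x y Hxy. apply (derive_nonneg_le F f); [lra| |]; intros; [apply HF|apply Hp]; lra. }
  assert (N : 0 <= F a).
  { apply (filterlim_Rle (F:=at_right 0) F (fun _ => F a)); [|exact F0|apply filterlim_const].
    apply (at_right0_pos _ a); [lra|]. intros; apply E; lra. }
  assert (N' : F b <= l).
  { apply (filterlim_Rle (F:=Rbar_locally p_infty) (fun _ => F b) F);
      [|apply filterlim_const|exact F1].
    apply (infty_large _ b). intros; apply E; lra. }
  enough (F a - c * a <= F b - c * b) by lra.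
  apply (derive_nonneg_le (fun x => F x - c * x) (fun x => f x - c)); [lra| |].
  - intros x Hx. assert (HFx := HF x ltac:(lra)).
    auto_derive; [exists (f x); auto|].
    rewrite_derives.
    ring.
  - intros x Hx. specialize (Hc x Hx). lra.
Qed.

(** * Kummer's function as a real first-order system *)

(** The coefficient of r^n in 1F1(a, 2g + 1, -2ir), built from the ratio of consecutive terms, a
    form that suits induction; (0, -1) is -i. *)
Fixpoint kummer_coeff (a : C) (g : R) (n : nat) : C :=
  match n with
  | O => RtoC 1
  | S m => (kummer_coeff a g m * ((a + RtoC (INR m)) * (0, -1)
             * RtoC (2 / ((2 * g + 1 + INR m) * (INR m + 1)))))%C
  end.

Lemma Ceq (z w : C) : Re z = Re w -> Im z = Im w -> z = w.
Proof. destruct z, w; simpl; intros; subst; reflexivity. Qed.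

Lemma Cpochhammer_real_neq0 (g : R) (n : nat) :
  0 <= g -> Cpochhammer (2 * RtoC g + 1)%C n <> RtoC 0.
Proof.
  intros Hg. induction n as [|n IH]; cbn [Cpochhammer].
  - apply C1_nz.
  - apply Cmult_neq_0; auto. intros E. apply (f_equal Re) in E. simpl in E.
    pose proof (pos_INR n). lra.
Qed.

Lemma hyp1F1_term_coeff (a : C) (g rho : R) (n : nat) :
  0 <= g ->
  hyp1F1_term a (2 * RtoC g + 1)%C (- (2 * Ci * RtoC rho))%C n
  = (kummer_coeff a g n * RtoC (rho ^ n))%C.
Proof.
  intros Hg. unfold hyp1F1_term. induction n as [|n IH].
  - simpl. field.
  - cbn [Cpochhammer kummer_coeff].
    pose proof (pos_INR n) as Hn.
    assert (N1 : (2 * RtoC g + 1 + RtoC (INR n))%C <> RtoC 0).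
    { intros E. apply (f_equal Re) in E. simpl in E. lra. }
    assert (N2 : RtoC (INR (Factorial.fact n)) <> RtoC 0).
    { intros E. apply (f_equal Re) in E. simpl in E. apply (INR_fact_neq_0 n E). }
    assert (N3 : RtoC (INR n + 1) <> RtoC 0).
    { intros E. apply (f_equal Re) in E. simpl in E. lra. }
    rewrite fact_simpl, mult_INR, S_INR, RtoC_mult.
    replace (RtoC (2 / ((2 * g + 1 + INR n) * (INR n + 1)))) with
      (2 / ((2 * RtoC g + 1 + RtoC (INR n)) * RtoC (INR n + 1)))%C.
    2:{ rewrite <- RtoC_mult, <- !RtoC_plus, <- RtoC_mult, <- RtoC_div; [reflexivity|].
        apply Rmult_integral_contrapositive. lra. }
    replace ((0, -1) : C) with (- Ci)%C by (apply Ceq; simpl; ring).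
    replace (RtoC (rho ^ S n)) with (RtoC rho * RtoC (rho ^ n))%C by (rewrite <- RtoC_mult; reflexivity).
    transitivity (Cpochhammer a n / Cpochhammer (2 * g + 1)%C n *
      ((- (2 * Ci * rho)) ^ n / INR (Factorial.fact n)) *
      ((a + INR n) / (2 * RtoC g + 1 + RtoC (INR n)) * (- (2 * Ci * RtoC rho)) / RtoC (INR n + 1)))%C.
    + pose proof (Cpochhammer_real_neq0 g n Hg).
      cbn [Cpow]. field. repeat split; auto.
    + rewrite IH. field. split; auto.
Qed.

(** Consecutive coefficients have a ratio of modulus at most 2B/(n + 1), as in the series of
    e^(2Br). *)
Lemma kummer_coeff_bound (a : C) (g B : R) :
  0 <= g -> (forall n, Cmod (a + RtoC (INR n))%C <= B * (2 * g + 1 + INR n)) ->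
  forall n, Cmod (kummer_coeff a g n) <= (2 * B) ^ n / INR (Factorial.fact n).
Proof.
  intros Hg H. induction n as [|n IH]; cbn [kummer_coeff].
  - rewrite Cmod_1. simpl. lra.
  - pose proof (pos_INR n) as Hn. specialize (H n).
    rewrite !Cmod_mult, Cmod_R.
    replace (Cmod (0, -1)) with 1.
    2:{ unfold Cmod. simpl. replace (_ + _) with 1 by ring. rewrite sqrt_1; reflexivity. }
    rewrite Rabs_pos_eq.
    2:{ apply Rdiv_le_0_compat; [lra|]. apply Rmult_lt_0_compat; lra. }
    rewrite fact_simpl, mult_INR, S_INR.
    pose proof (INR_fact_lt_0 n) as Hf.
    replace ((2 * B) ^ S n / ((INR n + 1) * INR (Factorial.fact n))) with
      ((2 * B) ^ n / INR (Factorial.fact n) *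
       (B * (2 * g + 1 + INR n) * 1 * (2 / ((2 * g + 1 + INR n) * (INR n + 1))))).
    2:{ simpl. field. lra. }
    pose proof (Cmod_ge_0 (kummer_coeff a g n)).
    pose proof (Cmod_ge_0 (a + RtoC (INR n))).
    assert (0 < 2 / ((2 * g + 1 + INR n) * (INR n + 1))).
    { apply Rdiv_lt_0_compat; [lra|]. apply Rmult_lt_0_compat; lra. }
    apply Rmult_le_compat; auto.
    + apply Rmult_le_pos; lra.
    + apply Rmult_le_compat_r; lra.
Qed.

(** The Pochhammer identity a (a + 1)_n = (a)_n (a + n), which links the Kummer functions of
    parameters a and a + 1. *)
Lemma kummer_coeff_contiguous (a : C) (g : R) (n : nat) :
  (a * kummer_coeff (a + 1) g n = (a + RtoC (INR n)) * kummer_coeff a g n)%C.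
Proof.
  induction n as [|n IH]; cbn [kummer_coeff].
  - apply Ceq; simpl; ring.
  - rewrite S_INR, RtoC_plus.
    transitivity (a * kummer_coeff (a + 1) g n * ((a + 1 + RtoC (INR n)) * (0, -1) *
      RtoC (2 / ((2 * g + 1 + INR n) * (INR n + 1)))))%C; [ring|].
    rewrite IH. ring.
Qed.

Section Coefficients.
Variables nu g : R.
Hypothesis Hnu : nu ^ 2 <= 1.
Hypothesis Hg : 0 <= g.
Hypothesis Hgn : 1 <= g ^ 2 + nu ^ 2.

Let c n := kummer_coeff (g, (- nu)%R) g n.
Let d n := kummer_coeff ((g, (- nu)%R) + 1)%C g n.

(** With a = g - i nu this is n c_n = a (d_n - c_n) in real form: the differential equation r f' = a
    (h - f) for the series f of parameter a and h of parameter a + 1. *)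
Lemma kummer_relation1 (n : nat) :
  INR n * Re (c n) = g * (Re (d n) - Re (c n)) + nu * (Im (d n) - Im (c n)) /\
  INR n * Im (c n) = g * (Im (d n) - Im (c n)) - nu * (Re (d n) - Re (c n)).
Proof.
  assert (H := kummer_coeff_contiguous (g, (- nu)%R) g n). fold (c n) (d n) in H.
  assert (H1 := f_equal Re H). assert (H2 := f_equal Im H). simpl in H1, H2.
  unfold Re, Im in *. split; lra.
Qed.

(** Real form of r h' = conj(a) (f - h) - 2i r h, where conj(a) is b - (a + 1) for b = 2g + 1. With
    the first relation it closes the system for f and h. *)
Lemma kummer_relation2 (n : nat) :
  INR (S n) * Re (d (S n)) = g * (Re (c (S n)) - Re (d (S n)))
     - nu * (Im (c (S n)) - Im (d (S n))) + 2 * Im (d n) /\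
  INR (S n) * Im (d (S n)) = g * (Im (c (S n)) - Im (d (S n)))
     + nu * (Re (c (S n)) - Re (d (S n))) - 2 * Re (d n).
Proof.
  assert (H := kummer_coeff_contiguous (g, (- nu)%R) g (S n)).
  assert (E : d (S n) = (d n * (((g, (- nu)%R) + 1 + RtoC (INR n)) * (0, -1)
             * RtoC (2 / ((2 * g + 1 + INR n) * (INR n + 1)))))%C) by reflexivity.
  fold (c (S n)) (d (S n)) in H.
  pose proof (pos_INR n) as Hn.
  set (t := 2 / ((2 * g + 1 + INR n) * (INR n + 1))) in *.
  assert (Ht : t * (2 * g + 1 + INR n) * (INR n + 1) = 2) by (unfold t; field; lra).
  assert (H1 := f_equal Re H). assert (H2 := f_equal Im H).
  assert (E1 := f_equal Re E). assert (E2 := f_equal Im E).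
  clear H E. rewrite S_INR in *.
  destruct (c (S n)) as [p q]. destruct (d (S n)) as [u v]. destruct (d n) as [x y].
  simpl in *. clearbody t. set (N := INR n) in *. clearbody N.
  (* |a + n + 1|^2 is the determinant of the linear system for (p, q) *)
  set (D := (g + N + 1) ^ 2 + nu ^ 2).
  assert (HD : 0 < D) by (unfold D; nra).
  assert (P : p * D = (g * u + nu * v) * (g + N + 1) - (g * v - nu * u) * nu).
  { unfold D. assert (A1 := f_equal (fun z => z * (g + N + 1)) H1).
    assert (A2 := f_equal (fun z => z * nu) H2). simpl in A1, A2. nra. }
  assert (Q : q * D = (g * v - nu * u) * (g + N + 1) + (g * u + nu * v) * nu).
  { unfold D. assert (A1 := f_equal (fun z => z * nu) H1).
    assert (A2 := f_equal (fun z => z * (g + N + 1)) H2). simpl in A1, A2. nra. }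
  assert (U : u = t * (y * (g + N + 1) - x * nu)) by (rewrite E1; ring).
  assert (V : v = t * (- x * (g + N + 1) - y * nu)) by (rewrite E2; ring).
  split; apply (Rmult_eq_reg_r D); try lra.
  - transitivity (g * (p * D - u * D) - nu * (q * D - v * D) + 2 * y * D); [|ring].
    rewrite P, Q, <- Ht, U, V. unfold D. ring.
  - transitivity (g * (q * D - v * D) + nu * (p * D - u * D) - 2 * x * D); [|ring].
    rewrite P, Q, <- Ht, U, V. unfold D. ring.
Qed.

(** |a + m|^2 = (g + m)^2 + nu^2 <= (2g + 1 + m)^2 because nu^2 <= 1, so B = 1 is allowed. *)
Lemma kummer_coeff_bound_c (n : nat) : Cmod (c n) <= 2 ^ n / INR (Factorial.fact n).
Proof.
  replace 2 with (2 * 1) at 1 by ring. apply kummer_coeff_bound; auto.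
  intros m. pose proof (pos_INR m). unfold Cmod. simpl.
  rewrite <- (sqrt_Rsqr (1 * (2 * g + 1 + INR m))) by lra.
  apply sqrt_le_1_alt. unfold Rsqr. nra.
Qed.

Lemma kummer_coeff_bound_d (n : nat) : Cmod (d n) <= 4 ^ n / INR (Factorial.fact n).
Proof.
  replace 4 with (2 * 2) at 1 by ring. apply kummer_coeff_bound; auto.
  intros m. pose proof (pos_INR m). unfold Cmod. simpl.
  rewrite <- (sqrt_Rsqr (2 * (2 * g + 1 + INR m))) by lra.
  apply sqrt_le_1_alt. unfold Rsqr. nra.
Qed.
End Coefficients.

(** * Power series of exponential type *)

Lemma pow_div_fact_le_exp (x : R) (n : nat) :
  0 <= x -> x ^ n / INR (Factorial.fact n) <= exp x.
Proof.
  intros Hx. eapply Rle_trans; [|apply (exp_ge_taylor x n Hx)].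
  destruct n as [|n]; [simpl; lra|]. rewrite tech5.
  enough (0 <= sum_f_R0 (fun k => x ^ k / INR (Factorial.fact k)) n) by lra.
  apply cond_pos_sum. intros k. apply Rdiv_le_0_compat; [apply pow_le, Hx|apply INR_fact_lt_0].
Qed.

(** The terms a_n r^n stay below e^(B|r|) for every r, which excludes a finite radius. *)
Lemma CV_radius_exp_type (a : nat -> R) (B : R) :
  0 <= B -> (forall n, Rabs (a n) <= B ^ n / INR (Factorial.fact n)) ->
  CV_radius a = p_infty.
Proof.
  intros HB H. destruct (CV_radius_bounded a) as [Hub _].
  assert (A : forall r : R, Rbar_le r (CV_radius a)).
  { intros r. apply (Hub r). exists (exp (B * Rabs r)). intros n.
    rewrite Rabs_mult, <- RPow_abs.
    eapply Rle_trans; [|apply (pow_div_fact_le_exp _ n)].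
    - rewrite Rpow_mult_distr.
      replace (B ^ n * Rabs r ^ n / INR (Factorial.fact n))
        with (B ^ n / INR (Factorial.fact n) * Rabs r ^ n)
        by (field; apply INR_fact_neq_0).
      apply Rmult_le_compat_r; [apply pow_le, Rabs_pos|apply H].
    - apply Rmult_le_pos; [auto|apply Rabs_pos]. }
  destruct (CV_radius a) as [r| |]; auto.
  - specialize (A (r + 1)). simpl in A. lra.
  - specialize (A 0). simpl in A. contradiction.
Qed.

Lemma PSeries_exp_bound (a : nat -> R) (A B r : R) :
  0 <= B -> 0 <= r -> (forall n, Rabs (a n) <= A * (B ^ n / INR (Factorial.fact n))) ->
  Rabs (PSeries a r) <= A * exp (B * r).
Proof.
  intros HB Hr H.
  assert (E : is_series (fun n => A * (B ^ n / INR (Factorial.fact n) * r ^ n)) (A * exp (B * r))).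
  { assert (E := is_exp_Reals (B * r)). apply is_pseries_R in E.
    apply (is_series_ext _ (fun n => B ^ n / INR (Factorial.fact n) * r ^ n)) in E.
    - exact (is_series_scal A _ _ E).
    - intros n.
      change (/ INR (Factorial.fact n) * (B * r) ^ n = B ^ n / INR (Factorial.fact n) * r ^ n).
      rewrite Rpow_mult_distr. field. apply INR_fact_neq_0. }
  unfold PSeries. rewrite <- (is_series_unique _ _ E).
  assert (L : forall n, 0 <= Rabs (a n * r ^ n) <=
     A * (B ^ n / INR (Factorial.fact n) * r ^ n)).
  { intros n. split; [apply Rabs_pos|].
    rewrite Rabs_mult, (Rabs_pos_eq (r ^ n)) by (apply pow_le, Hr).
    rewrite <- Rmult_assoc. apply Rmult_le_compat_r; [apply pow_le, Hr|apply H]. }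
  eapply Rle_trans; [apply Series_Rabs|apply Series_le; [exact L|eexists; exact E]].
  apply (ex_series_le (V:=R_CompleteNormedModule) _ (fun n => A * (B ^ n / INR (Factorial.fact n) * r ^ n))).
  - intros n. change (Rabs (Rabs (a n * r ^ n)) <= A * (B ^ n / INR (Factorial.fact n) * r ^ n)).
    rewrite Rabs_Rabsolu. apply L.
  - eexists; exact E.
Qed.

(** The operator r d/dr multiplies the n-th coefficient by n; in this form the recurrences become
    differential equations. *)
Lemma PSeries_euler (a : nat -> R) (r : R) :
  CV_radius a = p_infty ->
  is_pseries (fun n => INR n * a n) r (r * PSeries (PS_derive a) r).
Proof.
  intros H.
  apply (is_pseries_ext (PS_incr_1 (PS_derive a))).
  - intros [|n]; unfold PS_derive; [simpl; rewrite Rmult_0_l; reflexivity|reflexivity].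
  - apply (is_pseries_incr_1 (PS_derive a) r). apply PSeries_correct, CV_radius_inside.
    rewrite CV_radius_derive, H. exact I.
Qed.

Lemma is_pseries_lin (a b : nat -> R) (x y r la lb : R) :
  is_pseries a r la -> is_pseries b r lb ->
  is_pseries (fun n => x * a n + y * b n) r (x * la + y * lb).
Proof.
  intros Ha Hb.
  apply (is_pseries_plus (PS_scal x a) (PS_scal y b) r (x * la) (y * lb)).
  - apply (is_pseries_scal x a r la); [apply Rmult_comm|auto].
  - apply (is_pseries_scal y b r lb); [apply Rmult_comm|auto].
Qed.

Lemma PS_derive_exp_bound (a : nat -> R) (B : R) :
  (forall n, Rabs (a n) <= B ^ n / INR (Factorial.fact n)) ->
  forall n, Rabs (PS_derive a n) <= B * (B ^ n / INR (Factorial.fact n)).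
Proof.
  intros H n. unfold PS_derive. rewrite Rabs_mult, Rabs_pos_eq by apply pos_INR.
  pose proof (pos_INR n). pose proof (INR_fact_lt_0 n).
  eapply Rle_trans; [apply Rmult_le_compat_l; [apply pos_INR|apply H]|].
  rewrite fact_simpl, mult_INR, S_INR. simpl. right. field. lra.
Qed.

Lemma PSeries_exp_lipschitz (a : nat -> R) (B r : R) :
  0 <= B -> 0 <= r -> (forall n, Rabs (a n) <= B ^ n / INR (Factorial.fact n)) ->
  Rabs (PSeries a r - a O) <= B * r * exp (B * r).
Proof.
  intros HB Hr H. rewrite <- (PSeries_0 a) at 1.
  eapply Rle_trans.
  - apply (derive_dominated_le (PSeries a) (PSeries (PS_derive a))
      (fun t => B * exp (B * r) * t) (fun _ => B * exp (B * r))); [lra| | |].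
    + intros x Hx. apply is_derive_PSeries. rewrite (CV_radius_exp_type a B HB H). exact I.
    + intros x Hx. auto_derive; [auto|ring].
    + intros x Hx. eapply Rle_trans; [apply (PSeries_exp_bound _ B B x); [lra|lra|]|].
      * apply PS_derive_exp_bound, H.
      * apply Rmult_le_compat_l; [lra|]. apply exp_le_exp. nra.
  - right. ring.
Qed.

Definition kummer_re (nu g : R) : R -> R :=
  PSeries (fun n => Re (kummer_coeff (g, (- nu)%R) g n)).
Definition kummer_im (nu g : R) : R -> R :=
  PSeries (fun n => Im (kummer_coeff (g, (- nu)%R) g n)).

(* Real and imaginary part of M(r) = e^(ir) 1F1(g - i nu, 2g + 1, -2ir). *)
Definition coulomb_X (nu g r : R) : R :=
  cos r * kummer_re nu g r - sin r * kummer_im nu g r.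
Definition coulomb_Y (nu g r : R) : R :=
  sin r * kummer_re nu g r + cos r * kummer_im nu g r.

(** The interface between the power series and the analysis: the differential system, and the
    behaviour at 0 that selects the regular solution with X(0) = 1, Y(0) = 0. The last two fields
    also serve as the crude size bounds for bounded r. *)
Record coulomb_pair (nu g : R) (X Y : R -> R) : Prop := {
  coulomb_dX : forall r, 0 < r -> is_derive X r (- (1 + 2 * nu / r) * Y r);
  coulomb_dY : forall r, 0 < r -> is_derive Y r (X r - 2 * g / r * Y r);
  coulomb_bX : forall r, 0 < r -> Rabs (X r - 1) <= 5 * r * exp (2 * r);
  coulomb_bY : forall r, 0 < r -> Rabs (Y r) <= 5 * r * exp (2 * r) }.

(* The weight 1/r on d1^2 makes the damping term - d1^2/r^2 absorb the cross
   term with the singular coefficient 2 nu/r. *)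
Lemma singular_system_unique (nu g B : R) (d1 d2 : R -> R) :
  0 <= g -> nu ^ 2 <= 1 ->
  (forall r, 0 < r -> is_derive d1 r (- d2 r - 2 * g / r * d1 r)) ->
  (forall r, 0 < r -> is_derive d2 r ((1 + 2 * nu / r) * d1 r)) ->
  (forall r, 0 < r < 1 -> Rabs (d1 r) <= B * r) ->
  (forall r, 0 < r < 1 -> Rabs (d2 r) <= B * r) ->
  forall r, 0 < r -> d1 r = 0 /\ d2 r = 0.
Proof.
  intros Hg Hnu H1 H2 B1 B2 r Hr.
  set (Phi := fun r => d1 r ^ 2 / r + d2 r ^ 2).
  (* The exponent has derivative -(r + 3)^2. After completing the square in d1/r there remains (r +
     2 nu - 1)^2 d2^2, and |r + 2 nu - 1| <= r + 3 for |nu| <= 1. *)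
  set (Psi := fun r => Phi r * exp (- ((r + 3) ^ 3 / 3))).
  assert (Hmono : forall s t, 0 < s <= t -> Psi t <= Psi s).
  { intros s t Hst. enough (- Psi s <= - Psi t) by lra.
    apply (derive_nonneg_le (fun x => - Psi x)
      (fun x => - ((2 * d1 x * (- d2 x - 2 * g / x * d1 x) / x - d1 x ^ 2 / x ^ 2
        + 2 * d2 x * ((1 + 2 * nu / x) * d1 x) - (x + 3) ^ 2 * Phi x)
        * exp (- ((x + 3) ^ 3 / 3))))); [lra| |].
    - intros x Hx. assert (D1 := H1 x ltac:(lra)). assert (D2 := H2 x ltac:(lra)).
      unfold Psi, Phi. auto_derive.
      + repeat split; try (eexists; eassumption). lra.
      + rewrite_derives.
        unfold pow, Rdiv. rewrite !Rmult_1_r. field. lra.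
    - intros x Hx. rewrite Ropp_mult_distr_l. apply Rmult_le_pos; [|left; apply exp_pos].
      unfold Phi. set (e := d1 x / x).
      assert (E : d1 x = e * x) by (unfold e; field; lra).
      rewrite E.
      replace (- _) with (4 * g * e ^ 2 + (e - (x + 2 * nu - 1) * d2 x) ^ 2
        + (x + 3) ^ 2 * (x * e ^ 2)
        + ((x + 3) ^ 2 - (x + 2 * nu - 1) ^ 2) * d2 x ^ 2) by (field; lra).
      assert (-1 <= nu <= 1) by nra.
      assert (0 <= (x + 3) ^ 2 - (x + 2 * nu - 1) ^ 2).
      { replace (_ - _) with ((4 - 2 * nu) * (2 * x + 2 + 2 * nu)) by ring.
        apply Rmult_le_pos; lra. }
      pose proof (pow2_ge_0 e). pose proof (pow2_ge_0 (d2 x)).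
      pose proof (pow2_ge_0 (x + 3)).
      pose proof (pow2_ge_0 (e - (x + 2 * nu - 1) * d2 x)).
      assert (0 <= g * e ^ 2) by (apply Rmult_le_pos; lra).
      assert (0 <= x * e ^ 2) by (apply Rmult_le_pos; lra).
      assert (0 <= (x + 3) ^ 2 * (x * e ^ 2)) by (apply Rmult_le_pos; lra).
      assert (0 <= ((x + 3) ^ 2 - (x + 2 * nu - 1) ^ 2) * d2 x ^ 2)
        by (apply Rmult_le_pos; lra).
      lra. }
  assert (Hpos : 0 <= Phi r).
  { unfold Phi. apply Rplus_le_le_0_compat; [|apply pow2_ge_0].
    apply Rdiv_le_0_compat; [apply pow2_ge_0|auto]. }
  assert (Hz : Psi r <= 0).
  { apply (filterlim_Rle (F:=at_right 0) (fun _ => Psi r) Psi);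
      [|apply filterlim_const|].
    - apply (at_right0_pos _ r); auto. intros; apply Hmono; lra.
    - apply (lim0_dominated _ (2 * B ^ 2)). intros t Ht.
      assert (S1 : d1 t ^ 2 <= (B * t) ^ 2).
      { rewrite <- (pow2_abs (d1 t)). apply pow_incr. split; [apply Rabs_pos|auto]. }
      assert (S2 : d2 t ^ 2 <= (B * t) ^ 2).
      { rewrite <- (pow2_abs (d2 t)). apply pow_incr. split; [apply Rabs_pos|auto]. }
      assert (Hp : 0 <= Phi t).
      { unfold Phi. apply Rplus_le_le_0_compat; [|apply pow2_ge_0].
        apply Rdiv_le_0_compat; [apply pow2_ge_0|lra]. }
      assert (He : 0 < exp (- ((t + 3) ^ 3 / 3)) <= 1).
      { split; [apply exp_pos|]. rewrite <- exp_0. apply exp_le_exp.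
        assert (0 <= (t + 3) ^ 3) by (apply pow_le; lra). lra. }
      unfold Psi. rewrite Rabs_pos_eq by (apply Rmult_le_pos; lra).
      apply Rle_trans with (Phi t * 1); [apply Rmult_le_compat_l; lra|].
      assert (d1 t ^ 2 / t <= B ^ 2 * t).
      { apply Rle_div_l; [lra|]. replace (B ^ 2 * t * t) with ((B * t) ^ 2) by ring. auto. }
      unfold Phi. nra. }
  assert (Phi r = 0).
  { apply Rle_antisym; auto. pose proof (exp_pos (- ((r + 3) ^ 3 / 3))).
    unfold Psi in Hz. nra. }
  unfold Phi in H.
  assert (0 <= d1 r ^ 2 / r) by (apply Rdiv_le_0_compat; [apply pow2_ge_0|auto]).
  pose proof (pow2_ge_0 (d2 r)).
  assert (E1 : d1 r ^ 2 / r = 0) by lra.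
  assert (E3 : d1 r ^ 2 = 0).
  { replace (d1 r ^ 2) with (d1 r ^ 2 / r * r) by (field; lra). rewrite E1. ring. }
  split; apply Rsqr_0_uniq; unfold Rsqr; lra.
Qed.

Section Kummer.
Variables nu g : R.
Hypothesis Hnu : nu ^ 2 <= 1.
Hypothesis Hg : 0 <= g.
Hypothesis Hgn : 1 <= g ^ 2 + nu ^ 2.

Let p n := Re (kummer_coeff (g, (- nu)%R) g n).
Let q n := Im (kummer_coeff (g, (- nu)%R) g n).
Let u n := Re (kummer_coeff ((g, (- nu)%R) + 1)%C g n).
Let v n := Im (kummer_coeff ((g, (- nu)%R) + 1)%C g n).

Lemma Im_le_Cmod (z : C) : Rabs (Im z) <= Cmod z.
Proof.
  eapply Rle_trans; [|apply Rmax_Cmod]. apply Rmax_r.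
Qed.

Lemma Re_le_Cmod (z : C) : Rabs (Re z) <= Cmod z.
Proof.
  eapply Rle_trans; [|apply Rmax_Cmod]. apply Rmax_l.
Qed.

Let Hp n : Rabs (p n) <= 2 ^ n / INR (Factorial.fact n).
Proof. eapply Rle_trans; [apply Re_le_Cmod|apply kummer_coeff_bound_c; auto]. Qed.
Let Hq n : Rabs (q n) <= 2 ^ n / INR (Factorial.fact n).
Proof. eapply Rle_trans; [apply Im_le_Cmod|apply kummer_coeff_bound_c; auto]. Qed.
Let Hu n : Rabs (u n) <= 4 ^ n / INR (Factorial.fact n).
Proof. eapply Rle_trans; [apply Re_le_Cmod|apply kummer_coeff_bound_d; auto]. Qed.
Let Hv n : Rabs (v n) <= 4 ^ n / INR (Factorial.fact n).
Proof. eapply Rle_trans; [apply Im_le_Cmod|apply kummer_coeff_bound_d; auto]. Qed.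

Let Cp : CV_radius p = p_infty.
Proof. apply (CV_radius_exp_type p 2); [lra|apply Hp]. Qed.
Let Cq : CV_radius q = p_infty.
Proof. apply (CV_radius_exp_type q 2); [lra|apply Hq]. Qed.
Let Cu : CV_radius u = p_infty.
Proof. apply (CV_radius_exp_type u 4); [lra|apply Hu]. Qed.
Let Cv : CV_radius v = p_infty.
Proof. apply (CV_radius_exp_type v 4); [lra|apply Hv]. Qed.

Let pser a r : CV_radius a = p_infty -> is_pseries a r (PSeries a r).
Proof.
  intros H. apply PSeries_correct, CV_radius_inside. rewrite H. exact I.
Qed.

Let eul a b r l : CV_radius a = p_infty ->
  (forall n, INR n * a n = b n) -> is_pseries b r l -> r * PSeries (PS_derive a) r = l.
Proof.
  intros H E Hb. assert (A := PSeries_euler a r H).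
  apply is_pseries_unique in A. apply is_pseries_unique in Hb. rewrite <- A, <- Hb.
  apply PSeries_ext, E.
Qed.

(** Coefficients of r times a power series: the second recurrence ties d_(n+1) to d_n. *)
Let incr (a : nat -> R) (n : nat) : R := match n with O => 0 | S m => a m end.

Let euler_p r : r * PSeries (PS_derive p) r
  = g * (PSeries u r - PSeries p r) + nu * (PSeries v r - PSeries q r).
Proof.
  apply (eul p (fun n => 1 * (g * u n + - g * p n) + 1 * (nu * v n + - nu * q n))); [assumption| |].
  - intros n. destruct (kummer_relation1 nu g n) as [E _]. unfold p, q, u, v. lra.
  - evar_last; [apply is_pseries_lin; apply is_pseries_lin; apply pser; assumption|ring].
Qed.

Let euler_q r : r * PSeries (PS_derive q) r
  = g * (PSeries v r - PSeries q r) - nu * (PSeries u r - PSeries p r).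
Proof.
  apply (eul q (fun n => 1 * (g * v n + - g * q n) + 1 * (- nu * u n + nu * p n))); [assumption| |].
  - intros n. destruct (kummer_relation1 nu g n) as [_ E]. unfold p, q, u, v. lra.
  - evar_last; [apply is_pseries_lin; apply is_pseries_lin; apply pser; assumption|ring].
Qed.

Let euler_u r : r * PSeries (PS_derive u) r
  = g * (PSeries p r - PSeries u r) - nu * (PSeries q r - PSeries v r) + 2 * r * PSeries v r.
Proof.
  apply (eul u (fun n => 1 * (1 * (g * p n + - g * u n) + 1 * (- nu * q n + nu * v n))
     + 2 * incr v n)); [assumption| |].
  - intros [|n].
    + unfold incr, p, q, u, v. simpl. ring.
    + destruct (kummer_relation2 nu g Hg Hgn n) as [E _].
      unfold incr, p, q, u, v. lra.
  - evar_last.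
    + apply is_pseries_lin; [apply is_pseries_lin; apply is_pseries_lin; apply pser; assumption|].
      apply (is_pseries_incr_1 v r (PSeries v r)), pser, Cv.
    + unfold scal; simpl; unfold mult; simpl; ring.
Qed.

Let euler_v r : r * PSeries (PS_derive v) r
  = g * (PSeries q r - PSeries v r) + nu * (PSeries p r - PSeries u r) - 2 * r * PSeries u r.
Proof.
  apply (eul v (fun n => 1 * (1 * (g * q n + - g * v n) + 1 * (nu * p n + - nu * u n))
     + -2 * incr u n)); [assumption| |].
  - intros [|n].
    + unfold incr, p, q, u, v. simpl. ring.
    + destruct (kummer_relation2 nu g Hg Hgn n) as [_ E].
      unfold incr, p, q, u, v. lra.
  - evar_last.
    + apply is_pseries_lin; [apply is_pseries_lin; apply is_pseries_lin; apply pser; assumption|].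
      apply (is_pseries_incr_1 u r (PSeries u r)), pser, Cu.
    + unfold scal; simpl; unfold mult; simpl; ring.
Qed.

Let dser a r : CV_radius a = p_infty -> is_derive (PSeries a) r (PSeries (PS_derive a) r).
Proof. intros H. apply is_derive_PSeries. rewrite H. exact I. Qed.

(** [N1] + i [N2] = e^(ir) 1F1(a + 1, 2g + 1, -2ir). *)
Let N1 r := cos r * PSeries u r - sin r * PSeries v r.
Let N2 r := sin r * PSeries u r + cos r * PSeries v r.

Let rot_derive a b r : CV_radius a = p_infty -> CV_radius b = p_infty ->
  is_derive (fun r => cos r * PSeries a r - sin r * PSeries b r) r
    (- (sin r * PSeries a r + cos r * PSeries b r)
      + (cos r * PSeries (PS_derive a) r - sin r * PSeries (PS_derive b) r)) /\
  is_derive (fun r => sin r * PSeries a r + cos r * PSeries b r) r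
    (cos r * PSeries a r - sin r * PSeries b r
      + (sin r * PSeries (PS_derive a) r + cos r * PSeries (PS_derive b) r)).
Proof.
  intros Ha Hb. assert (Da := dser a r Ha). assert (Db := dser b r Hb).
  split; (auto_derive; [repeat split; eexists; eassumption|]);
    replace (Derive (fun x => PSeries a x) r) with (PSeries (PS_derive a) r)
      by (symmetry; apply is_derive_unique; auto);
    replace (Derive (fun x => PSeries b x) r) with (PSeries (PS_derive b) r)
      by (symmetry; apply is_derive_unique; auto); ring.
Qed.

Let series_derivs r : 0 < r ->
  (PSeries (PS_derive p) r = (g * (PSeries u r - PSeries p r) + nu * (PSeries v r - PSeries q r)) / r /\
   PSeries (PS_derive q) r = (g * (PSeries v r - PSeries q r) - nu * (PSeries u r - PSeries p r)) / r) /\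
  PSeries (PS_derive u) r = (g * (PSeries p r - PSeries u r) - nu * (PSeries q r - PSeries v r)
    + 2 * r * PSeries v r) / r /\
  PSeries (PS_derive v) r = (g * (PSeries q r - PSeries v r) + nu * (PSeries p r - PSeries u r)
    - 2 * r * PSeries u r) / r.
Proof.
  intros Hr. rewrite <- euler_p, <- euler_q, <- euler_u, <- euler_v.
  repeat split; field; lra.
Qed.

(** Each series moves by at most B r e^(Br) from its value at 0, and the rotation by r accounts for
    the remaining r. *)
Let rot_bound a b B r : 0 < B -> 0 < r -> a O = 1 -> b O = 0 ->
  (forall n, Rabs (a n) <= B ^ n / INR (Factorial.fact n)) ->
  (forall n, Rabs (b n) <= B ^ n / INR (Factorial.fact n)) ->
  Rabs (cos r * PSeries a r - sin r * PSeries b r - 1) <= (2 * B + 1) * r * exp (B * r) /\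
  Rabs (sin r * PSeries a r + cos r * PSeries b r) <= (2 * B + 1) * r * exp (B * r).
Proof.
  intros HB Hr Ea Eb Ha Hb.
  assert (La := PSeries_exp_lipschitz a B r ltac:(lra) ltac:(lra) Ha).
  assert (Lb := PSeries_exp_lipschitz b B r ltac:(lra) ltac:(lra) Hb).
  rewrite Ea in La. rewrite Eb in Lb.
  set (x := PSeries a r - 1) in *. replace (PSeries b r - 0) with (PSeries b r) in Lb by ring.
  set (y := PSeries b r) in *.
  replace (PSeries a r) with (1 + x) by (unfold x; ring).
  set (E := B * r * exp (B * r)) in *.
  assert (He : 1 <= exp (B * r)).
  { rewrite <- exp_0. apply exp_le_exp. nra. }
  assert (Hr' : r <= r * exp (B * r)) by nra.
  assert (Cb := COS_bound r). assert (Sb := SIN_bound r).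
  assert (S1 := abs_sin_le r ltac:(lra)).
  assert (C1 := abs_cos_sub1_le r ltac:(lra)).
  assert (T : forall c z, -1 <= c <= 1 -> Rabs z <= E -> Rabs (c * z) <= E).
  { intros c z Hc Hz. rewrite Rabs_mult.
    assert (Rabs c <= 1) by (apply Rabs_le; lra).
    pose proof (Rabs_pos z). nra. }
  replace ((2 * B + 1) * r * exp (B * r)) with (E + E + r * exp (B * r)) by (unfold E; ring).
  assert (T1 := T _ _ Cb La). assert (T2 := T _ _ Sb La).
  assert (T3 := T _ _ Cb Lb). assert (T4 := T _ _ Sb Lb).
  apply Rabs_le_between in T1, T2, T3, T4, S1, C1.
  split; apply Rabs_le; lra.
Qed.

(** Kummer's transformation, as M = conj(N) with N = [N1] + i [N2]. By the two recurrences the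
    defect delta = M - conj(N) satisfies r delta' = i r delta - 2a Re(delta), and it is O(r) at 0,
    so it vanishes by [singular_system_unique]. *)
Lemma kummer_reflection (r : R) : 0 < r ->
  coulomb_X nu g r = N1 r /\ coulomb_Y nu g r = - N2 r.
Proof.
  intros Hr.
  enough (coulomb_X nu g r - N1 r = 0 /\ coulomb_Y nu g r + N2 r = 0) by lra.
  apply (singular_system_unique nu g ((2 * 2 + 1) * exp 2 + (2 * 4 + 1) * exp 4)
    (fun r => coulomb_X nu g r - N1 r) (fun r => coulomb_Y nu g r + N2 r)); auto.
  - intros t Ht. destruct (rot_derive p q t Cp Cq) as [D1 _].
    destruct (rot_derive u v t Cu Cv) as [D2 _].
    assert (D := is_derive_minus _ _ _ _ _ D1 D2).
    eapply is_derive_ext in D; [|intros; reflexivity].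
    evar_last; [exact D|].
    unfold minus, plus, opp, coulomb_X, coulomb_Y, N1, N2, kummer_re, kummer_im; simpl. fold p q.
    destruct (series_derivs t Ht) as [[-> ->] [-> ->]].
    field. lra.
  - intros t Ht. destruct (rot_derive p q t Cp Cq) as [_ D1].
    destruct (rot_derive u v t Cu Cv) as [_ D2].
    assert (D := is_derive_plus _ _ _ _ _ D1 D2).
    evar_last; [exact D|].
    unfold minus, plus, opp, coulomb_X, coulomb_Y, N1, N2, kummer_re, kummer_im; simpl. fold p q.
    destruct (series_derivs t Ht) as [[-> ->] [-> ->]].
    field. lra.
  1, 2: intros t Ht;
    destruct (rot_bound p q 2 t) as [A1 A1']; auto; try lra;
    destruct (rot_bound u v 4 t) as [A2 A2']; auto; try lra;
    assert (exp (2 * t) <= exp 2) by (apply exp_le_exp; lra);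
    assert (exp (4 * t) <= exp 4) by (apply exp_le_exp; lra);
    apply Rabs_le_between in A1, A2, A1', A2'; apply Rabs_le.
  - change (coulomb_X nu g t) with (cos t * PSeries p t - sin t * PSeries q t). unfold N1. nra.
  - change (coulomb_Y nu g t) with (sin t * PSeries p t + cos t * PSeries q t). unfold N2. nra.
Qed.

(** Replacing N by conj(M) in r M' = i r M + a (N - M) gives r M' = i r M - 2i a Im(M). *)
Lemma coulomb_pair_kummer : coulomb_pair nu g (coulomb_X nu g) (coulomb_Y nu g).
Proof.
  split; intros r Hr.
  1, 2: destruct (rot_derive p q r Cp Cq) as [D1 D2];
    destruct (kummer_reflection r Hr) as [R1 R2];
    destruct (series_derivs r Hr) as [[A1 A2] _];
    change (coulomb_X nu g r) with (cos r * PSeries p r - sin r * PSeries q r) in *;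
    change (coulomb_Y nu g r) with (sin r * PSeries p r + cos r * PSeries q r) in *;
    unfold N1, N2 in *.
  - evar_last; [exact D1|].
    transitivity (- (sin r * PSeries p r + cos r * PSeries q r) +
     (g * (cos r * PSeries u r - sin r * PSeries v r
        - (cos r * PSeries p r - sin r * PSeries q r))
      + nu * (- (- (sin r * PSeries u r + cos r * PSeries v r))
        - (sin r * PSeries p r + cos r * PSeries q r))) / r).
    + rewrite A1, A2. field. lra.
    + rewrite <- R1, <- R2. field. lra.
  - evar_last; [exact D2|].
    transitivity (cos r * PSeries p r - sin r * PSeries q r +
     (g * (- (- (sin r * PSeries u r + cos r * PSeries v r))
        - (sin r * PSeries p r + cos r * PSeries q r))
      - nu * (cos r * PSeries u r - sin r * PSeries v r
        - (cos r * PSeries p r - sin r * PSeries q r))) / r).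
    + rewrite A1, A2. field. lra.
    + rewrite <- R1, <- R2. field. lra.
  - destruct (rot_bound p q 2 r) as [A1 _]; auto; try lra.
    replace (5 * r) with ((2 * 2 + 1) * r) by ring. exact A1.
  - destruct (rot_bound p q 2 r) as [_ A1]; auto; try lra.
    replace (5 * r) with ((2 * 2 + 1) * r) by ring. exact A1.
Qed.
End Kummer.

(** * Laplace transforms *)

Lemma ln_le_sub1 (x : R) : 0 < x -> ln x <= x - 1.
Proof.
  intros Hx. pose proof (exp_ineq1_le (ln x)). rewrite exp_ln in H by auto. lra.
Qed.

Lemma Rpower_le_exp (p d : R) : 0 <= p -> 0 < d ->
  exists K, 0 < K /\ forall t, 0 < t -> Rpower t p <= K * exp (d * t).
Proof.
  intros Hp Hd. set (x := d / (p + 1)).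
  assert (Hx : 0 < x) by (apply Rdiv_lt_0_compat; lra).
  exists (exp (- p * ln x)). split; [apply exp_pos|].
  intros t Ht. unfold Rpower. rewrite <- exp_plus. apply exp_le_exp.
  assert (Hxt : 0 < x * t) by (apply Rmult_lt_0_compat; lra).
  assert (L := ln_le_sub1 (x * t) Hxt).
  rewrite ln_mult in L by lra.
  assert (E : d = x * (p + 1)) by (unfold x; field; lra).
  rewrite E. nra.
Qed.

Lemma Rpower_0_exp (t : R) : Rpower t 0 = 1.
Proof. unfold Rpower. rewrite Rmult_0_l. apply exp_0. Qed.

(** Growth below every exponential makes the Laplace transform exist for all s > 0, and it is stable
    under multiplication by t, hence under differentiation in s. *)
Definition subexponential (f : R -> R) : Prop :=
  (forall t, 0 < t -> continuous f t) /\
  forall d, 0 < d -> exists K, forall t, 0 < t -> Rabs (f t) <= K * exp (d * t).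

Lemma subexponential_pow_mul (p B : R) (f : R -> R) : 0 <= p ->
  (forall t, 0 < t -> ex_derive f t) -> (forall t, 0 < t -> Rabs (f t) <= B) ->
  subexponential (fun t => Rpower t p * f t).
Proof.
  intros Hp Hd HB. split.
  - intros t Ht. apply (ex_derive_continuous (fun t => Rpower t p * f t)).
    specialize (Hd t Ht). unfold Rpower. auto_derive. auto.
  - intros d Hd0. destruct (Rpower_le_exp p d Hp Hd0) as [K [HK HK']].
    exists (K * B). intros t Ht. specialize (HB t Ht). specialize (HK' t Ht).
    assert (0 < Rpower t p) by apply exp_pos.
    rewrite Rabs_mult, (Rabs_pos_eq (Rpower t p)) by lra.
    replace (K * B * exp (d * t)) with (K * exp (d * t) * B) by ring.
    apply Rmult_le_compat; auto; [lra|apply Rabs_pos].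
Qed.

Lemma subexponential_Rpower (p : R) : 0 <= p -> subexponential (fun t => Rpower t p).
Proof.
  intros Hp. assert (H : subexponential (fun t => Rpower t p * 1)).
  { apply (subexponential_pow_mul p 1 (fun _ => 1)); auto.
    - intros t _. auto_derive. auto.
    - intros t _. rewrite Rabs_R1. lra. }
  destruct H as [H1 H2]. split.
  - intros t Ht. apply (continuous_ext (fun t => Rpower t p * 1)); [intros; apply Rmult_1_r|auto].
  - intros d Hd. destruct (H2 d Hd) as [K HK]. exists K. intros t Ht.
    rewrite <- (Rmult_1_r (Rpower t p)). auto.
Qed.

Lemma subexponential_lin (a b : R) (f h : R -> R) : subexponential f -> subexponential h ->
  subexponential (fun t => a * f t + b * h t).
Proof.
  intros [Cf Bf] [Ch Bh]. split.
  - intros t Ht. apply (continuous_plus (fun t => a * f t) (fun t => b * h t)).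
    + apply (continuous_scal_r (V:=R_NormedModule) a f t), Cf, Ht.
    + apply (continuous_scal_r (V:=R_NormedModule) b h t), Ch, Ht.
  - intros d Hd. destruct (Bf d Hd) as [K HK]. destruct (Bh d Hd) as [K' HK'].
    exists (Rabs a * K + Rabs b * K'). intros t Ht.
    specialize (HK t Ht). specialize (HK' t Ht).
    eapply Rle_trans; [apply Rabs_triang|]. rewrite !Rabs_mult.
    pose proof (Rabs_pos a). pose proof (Rabs_pos b). nra.
Qed.

Lemma subexponential_scal (c : R) (f : R -> R) :
  subexponential f -> subexponential (fun t => c * f t).
Proof.
  intros Hf. destruct (subexponential_lin c 0 f f Hf Hf) as [_ B]. split.
  - intros t Ht. apply (continuous_scal_r (V:=R_NormedModule) c f t), (proj1 Hf), Ht.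
  - intros d Hd. destruct (B d Hd) as [K HK]. exists K. intros t Ht.
    rewrite <- (Rplus_0_r (c * f t)), <- (Rmult_0_l (f t)). auto.
Qed.

(** Half of the rate d absorbs the factor: t <= (2/d) e^(dt/2). *)
Lemma subexponential_mul_id (f : R -> R) :
  subexponential f -> subexponential (fun t => t * f t).
Proof.
  intros [Hc B]. split.
  - intros t Ht. apply (continuous_mult (fun t => t) f t); [apply continuous_id|apply Hc, Ht].
  - intros d Hd. destruct (B (d / 2) ltac:(lra)) as [K HK]. exists (2 / d * K). intros t Ht.
    specialize (HK t Ht). pose proof (Rabs_pos (f t)).
    assert (L := exp_ineq1_le (d / 2 * t)).
    replace (exp (d * t)) with (exp (d / 2 * t) * exp (d / 2 * t))
      by (rewrite <- exp_plus; f_equal; field).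
    rewrite Rabs_mult, (Rabs_pos_eq t) by lra.
    replace (2 / d * K * (exp (d / 2 * t) * exp (d / 2 * t))) with
      ((2 / d * exp (d / 2 * t)) * (K * exp (d / 2 * t))) by ring.
    apply Rmult_le_compat; [lra|auto| |auto].
    replace t with (2 / d * (d / 2 * t)) at 1 by (field; lra).
    apply Rmult_le_compat_l; [|lra]. apply Rdiv_le_0_compat; lra.
Qed.

Lemma continuous_exp_lin (s t : R) : continuous (fun t => exp (- (s * t))) t.
Proof.
  apply (ex_derive_continuous (fun t => exp (- (s * t)))). auto_derive. auto.
Qed.

Lemma laplace_bound (f : R -> R) (s : R) : 0 < s -> subexponential f ->
  exists K, 0 <= K /\ forall t, 0 < t ->
    Rabs (exp (- (s * t)) * f t) <= K * exp (- (s / 2 * t)).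
Proof.
  intros Hs [Hc B]. destruct (B (s / 2) ltac:(lra)) as [K HK].
  exists K. split.
  - specialize (HK 1 Rlt_0_1). pose proof (Rabs_pos (f 1)). pose proof (exp_pos (s / 2 * 1)). nra.
  - intros t Ht. specialize (HK t Ht).
    rewrite Rabs_mult, Rabs_pos_eq by (left; apply exp_pos).
    replace (exp (- (s / 2 * t))) with (exp (- (s * t)) * exp (s / 2 * t))
      by (rewrite <- exp_plus; f_equal; lra).
    pose proof (exp_pos (- (s * t))). nra.
Qed.

(** A total function of s, so that it can be differentiated; its value is the integral for s > 0 by
    [laplace_correct]. *)
Definition laplace (f : R -> R) (s : R) : R :=
  RInt_gen (fun t => exp (- (s * t)) * f t) (at_right 0) (Rbar_locally p_infty).

Lemma halfline_int_RInt_gen_eq (f : R -> R) (l : R) :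
  (forall t, 0 < t -> continuous f t) -> halfline_int f l ->
  RInt_gen f (at_right 0) (Rbar_locally p_infty) = l.
Proof.
  intros Hc H. apply (is_RInt_gen_unique (V:=R_CompleteNormedModule)).
  apply halfline_int_RInt_gen; auto.
Qed.

Lemma laplace_continuous (f : R -> R) (s t : R) :
  (forall t, 0 < t -> continuous f t) -> 0 < t ->
  continuous (fun t => exp (- (s * t)) * f t) t.
Proof.
  intros Hc Ht. apply (continuous_mult (fun t => exp (- (s * t))) f t).
  - apply continuous_exp_lin.
  - apply Hc, Ht.
Qed.

Lemma laplace_correct (f : R -> R) (s : R) : 0 < s -> subexponential f ->
  halfline_int (fun t => exp (- (s * t)) * f t) (laplace f s).
Proof.
  intros Hs Hf. destruct (laplace_bound f s Hs Hf) as [K [HK HK']].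
  destruct Hf as [Hc _].
  assert (Hc' : forall t, 0 < t -> continuous (fun t => exp (- (s * t)) * f t) t).
  { intros t Ht. apply laplace_continuous; auto. }
  destruct (halfline_int_dominated (fun t => exp (- (s * t)) * f t)
    (fun t => K * exp (- (s / 2 * t))) (K / (s / 2)) Hc' HK'
    (halfline_int_exp K (s / 2) ltac:(lra))) as [l [Hl _]].
  replace (laplace f s) with l; [exact Hl|].
  symmetry. exact (halfline_int_RInt_gen_eq _ l Hc' Hl).
Qed.

Lemma laplace_eq (f : R -> R) (s l : R) : 0 < s -> subexponential f ->
  halfline_int (fun t => exp (- (s * t)) * f t) l -> laplace f s = l.
Proof.
  intros Hs Hf H. eapply halfline_int_unique; [apply laplace_correct|]; eauto.
Qed.

Lemma laplace_lin (f g : R -> R) (a b s : R) :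
  0 < s -> subexponential f -> subexponential g ->
  laplace (fun t => a * f t + b * g t) s = a * laplace f s + b * laplace g s.
Proof.
  intros Hs Hf Hg. apply laplace_eq; [auto|apply subexponential_lin; auto|].
  eapply halfline_int_ext; [|apply halfline_int_lin; apply laplace_correct; eauto].
  intros t Ht. simpl. ring.
Qed.

Lemma laplace_scal (f : R -> R) (c s : R) : 0 < s -> subexponential f ->
  laplace (fun t => c * f t) s = c * laplace f s.
Proof.
  intros Hs Hf. apply laplace_eq; [auto|apply subexponential_scal; auto|].
  eapply halfline_int_ext; [|apply halfline_int_scal, laplace_correct; eauto].
  intros t Ht. simpl. ring.
Qed.

(* g need not be subexponential: it may grow like e^(dt) with d < s. *)
Lemma laplace_dominated_gen (f g : R -> R) (s l : R) : 0 < s -> subexponential f ->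
  (forall t, 0 < t -> Rabs (f t) <= g t) ->
  halfline_int (fun t => exp (- (s * t)) * g t) l -> Rabs (laplace f s) <= l.
Proof.
  intros Hs Hf H Hg.
  destruct (halfline_int_dominated (fun t => exp (- (s * t)) * f t)
    (fun t => exp (- (s * t)) * g t) l) as [l' [Hl Hle]]; auto.
  - intros t Ht. apply laplace_continuous; [apply Hf|auto].
  - intros t Ht. rewrite Rabs_mult, Rabs_pos_eq by (left; apply exp_pos).
    apply Rmult_le_compat_l; [left; apply exp_pos|auto].
  - rewrite (laplace_eq f s l'); auto.
Qed.

Lemma laplace_dominated (f g : R -> R) (s : R) : 0 < s -> subexponential f -> subexponential g ->
  (forall t, 0 < t -> Rabs (f t) <= g t) -> Rabs (laplace f s) <= laplace g s.
Proof.
  intros Hs Hf Hg H. apply (laplace_dominated_gen f g); auto. apply laplace_correct; auto.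
Qed.

Lemma exp_taylor1 (x : R) : Rabs (exp x - 1 - x) <= x ^ 2 * exp (Rabs x).
Proof.
  assert (A := exp_ineq1_le x). assert (B := exp_ineq1_le (- x)).
  assert (E : exp x * exp (- x) = 1) by (rewrite <- exp_plus, Rplus_opp_r; apply exp_0).
  rewrite Rabs_pos_eq by lra.
  assert (C : exp x - 1 <= x * exp x) by nra.
  destruct (Rle_dec 0 x).
  - rewrite Rabs_pos_eq by auto.
    apply Rle_trans with (x * (exp x - 1)); [lra|].
    replace (x ^ 2 * exp x) with (x * (x * exp x)) by ring.
    apply Rmult_le_compat_l; lra.
  - rewrite Rabs_left by lra.
    apply Rle_trans with (x * (exp x - 1)); [lra|].
    apply Rle_trans with (x ^ 2); [nra|]. nra.
Qed.

Lemma is_derive_quadratic (f : R -> R) (x l d K : R) : 0 < d -> 0 <= K ->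
  (forall h, Rabs h < d -> Rabs (f (x + h) - f x - h * l) <= K * h ^ 2) ->
  is_derive f x l.
Proof.
  intros Hd HK H. apply is_derive_Reals. intros e He.
  assert (He' : 0 < e / (K + 1)) by (apply Rdiv_lt_0_compat; lra).
  assert (Hm : 0 < Rmin d (e / (K + 1))) by (apply Rmin_glb_lt; lra).
  exists (mkposreal _ Hm). intros h Hh0 Hh. simpl in Hh.
  pose proof (Rmin_l d (e / (K + 1))). pose proof (Rmin_r d (e / (K + 1))).
  assert (Hah : 0 < Rabs h) by (apply Rabs_pos_lt; auto).
  replace ((f (x + h) - f x) / h - l) with ((f (x + h) - f x - h * l) / h) by (field; auto).
  unfold Rdiv. rewrite Rabs_mult, Rabs_inv.
  apply Rlt_div_l; [auto|].
  eapply Rle_lt_trans; [apply H; lra|].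
  rewrite <- (pow2_abs h).
  assert (Rabs h * (K + 1) < e).
  { replace e with (e / (K + 1) * (K + 1)) by (field; lra).
    apply Rmult_lt_compat_r; lra. }
  nra.
Qed.

(** Differentiation under the integral by a second-order remainder: |e^(-ht) - 1 + ht| <= h^2 t^2
    e^(|h|t), and what multiplies h^2 has an integral bounded independently of h. *)
Lemma laplace_derive (f : R -> R) (s : R) : 0 < s -> subexponential f ->
  is_derive (laplace f) s (- laplace (fun t => t * f t) s).
Proof.
  intros Hs Hf. pose proof Hf as [Hc B].
  assert (Hf1 := subexponential_mul_id f Hf).
  (* The rate s is shared out: s/4 to the growth of [f], s/2 to e^(|h|t) with |h| < s/2, and s/4 to
     make the majorant K t^2 integrable. [Rpower t 0] below is the constant 1, written so that the
     closure lemmas apply. *)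
  destruct (B (s / 4) ltac:(lra)) as [K HK].
  set (g := fun t => t * (t * (K * Rpower t 0))).
  assert (Hg : subexponential g).
  { apply subexponential_mul_id, subexponential_mul_id, subexponential_scal, subexponential_Rpower; lra. }
  assert (HL : 0 <= laplace g (s / 4)).
  { replace 0 with (0 / 1) by field.
    eapply halfline_int_le; [|apply (halfline_int_exp 0 1); lra|
      apply (laplace_correct g (s / 4)); auto; lra].
    intros t Ht. unfold g. rewrite Rmult_0_l, Rpower_0_exp.
    specialize (HK t Ht). pose proof (Rabs_pos (f t)). pose proof (exp_pos (s / 4 * t)).
    assert (0 <= K) by nra.
    repeat apply Rmult_le_pos; try lra. left; apply exp_pos. }
  apply (is_derive_quadratic (laplace f) s _ (s / 2) (laplace g (s / 4))); [lra|auto|].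
  intros h Hh.
  assert (Hsh : 0 < s + h) by (apply Rabs_lt_between in Hh; lra).
  assert (I : halfline_int (fun t => exp (- (s * t)) * (exp (- (h * t)) - 1 - - (h * t)) * f t)
     (laplace f (s + h) - laplace f s - h * - laplace (fun t => t * f t) s)).
  { replace (_ - _) with (1 * (1 * laplace f (s + h) + (-1) * laplace f s)
      + h * laplace (fun t => t * f t) s) by ring.
    eapply halfline_int_ext; [|apply halfline_int_lin; [apply halfline_int_lin|];
      apply laplace_correct; auto].
    intros t Ht. simpl.
    replace (exp (- ((s + h) * t))) with (exp (- (s * t)) * exp (- (h * t)))
      by (rewrite <- exp_plus; f_equal; ring).
    ring. }
  rewrite (Rmult_comm _ (h ^ 2)).
  destruct (halfline_int_dominated
    (fun t => exp (- (s * t)) * (exp (- (h * t)) - 1 - - (h * t)) * f t)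
    (fun t => h ^ 2 * (exp (- (s / 4 * t)) * g t)) (h ^ 2 * laplace g (s / 4))) as [l [Hl Hle]].
  - intros t Ht.
    apply (continuous_mult (fun t => exp (- (s * t)) * (exp (- (h * t)) - 1 - - (h * t))) f t).
    + apply (ex_derive_continuous (fun t => exp (- (s * t)) * (exp (- (h * t)) - 1 - - (h * t)))).
      auto_derive. auto.
    + apply Hc, Ht.
  - intros t Ht. specialize (HK t Ht).
    rewrite !Rabs_mult, (Rabs_pos_eq (exp _)) by (left; apply exp_pos).
    assert (T := exp_taylor1 (- (h * t))).
    rewrite Rabs_Ropp, Rabs_mult, (Rabs_pos_eq t) in T by lra.
    assert (exp (Rabs h * t) <= exp (s / 2 * t)) by (apply exp_le_exp; nra).
    apply Rle_trans with (exp (- (s * t)) * (h ^ 2 * t ^ 2 * exp (s / 2 * t)) * (K * exp (s / 4 * t))).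
    + apply Rmult_le_compat; auto.
      * apply Rmult_le_pos; [left; apply exp_pos|apply Rabs_pos].
      * apply Rabs_pos.
      * apply Rmult_le_compat_l; [left; apply exp_pos|].
        eapply Rle_trans; [exact T|].
        replace ((- (h * t)) ^ 2) with (h ^ 2 * t ^ 2) by ring.
        apply Rmult_le_compat_l; auto. apply Rmult_le_pos; apply pow2_ge_0.
    + unfold g. rewrite Rpower_0_exp.
      replace (exp (- (s / 4 * t))) with (exp (- (s * t)) * exp (s / 2 * t) * exp (s / 4 * t))
        by (rewrite <- !exp_plus; f_equal; lra).
      right. ring.
  - apply halfline_int_scal, laplace_correct; auto; lra.
  - rewrite (halfline_int_unique _ _ _ I Hl). exact Hle.
Qed.

(** Integration by parts, with e^(-st) f(t) itself as the primitive of the difference of the two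
    sides. *)
Lemma laplace_of_derive (f f' : R -> R) (s : R) : 0 < s ->
  subexponential f -> subexponential f' -> (forall t, 0 < t -> is_derive f t (f' t)) ->
  lim0 f 0 -> laplace f' s = s * laplace f s.
Proof.
  intros Hs Hf Hf' Hd H0.
  enough (1 * laplace f' s + - s * laplace f s = 0) by lra.
  rewrite <- laplace_lin by auto. apply laplace_eq; [auto|apply subexponential_lin; auto|].
  exists (fun t => exp (- (s * t)) * f t). split; [|split].
  - intros t Ht. assert (D := Hd t Ht). auto_derive.
    + eexists; eassumption.
    + rewrite_derives.
      ring.
  - unfold lim0. replace 0 with (1 * 0) at 2 by ring. apply filterlim_Rmult; [|exact H0].
    assert (D : filterlim (fun t => exp (- (s * t))) (locally 0) (locally (exp (- (s * 0)))))
      by apply continuous_exp_lin.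
    rewrite Rmult_0_r, Ropp_0, exp_0 in D.
    eapply filterlim_filter_le_1; [|exact D]. intros P HP.
    destruct HP as [e He]. exists e. intros y Hy _. apply He, Hy.
  - destruct (laplace_bound f s Hs Hf) as [K [HK HK']].
    apply (limoo_dominated _ (K * (2 / s)) 0). intros t Ht.
    eapply Rle_trans; [apply HK'; auto|].
    assert (A := exp_ineq1_le (s / 2 * t)).
    assert (E : exp (- (s / 2 * t)) * exp (s / 2 * t) = 1).
    { rewrite <- exp_plus. replace (_ + _) with 0 by ring. apply exp_0. }
    set (z := s / 2 * t) in *.
    assert (Hz : 0 < z) by (unfold z; apply Rmult_lt_0_compat; lra).
    replace (K * (2 / s) / t) with (K * (1 / z)) by (unfold z; field; lra).
    apply Rmult_le_compat_l; auto.
    apply (Rmult_le_reg_r z); auto.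
    replace (1 / z * z) with 1 by (field; lra). nra.
Qed.

(** * The Coulomb wave equation *)

Definition coulomb_potential (nu g r : R) : R := 1 + 2 * nu / r - (g ^ 2 + g) / r ^ 2.

Record coulomb_wave (nu g : R) (Q Q1 : R -> R) : Prop := {
  wave_dQ : forall r, 0 < r -> is_derive Q r (Q1 r);
  wave_dQ1 : forall r, 0 < r -> is_derive Q1 r (- coulomb_potential nu g r * Q r) }.

Definition wave_energy (nu g : R) (Q Q1 : R -> R) (r : R) : R :=
  Q1 r ^ 2 + coulomb_potential nu g r * Q r ^ 2.

Lemma coulomb_potential_derive (nu g r : R) : 0 < r ->
  is_derive (coulomb_potential nu g) r (- (2 * nu / r ^ 2) + 2 * (g ^ 2 + g) / r ^ 3).
Proof.
  intros Hr. unfold coulomb_potential. auto_derive; [split; [lra|split; [|auto]]|field; lra].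
  apply Rmult_integral_contrapositive. lra.
Qed.

(** Q'' = -qQ cancels the terms in Q Q' and leaves q' Q^2. *)
Lemma wave_energy_derive (nu g : R) (Q Q1 : R -> R) (r : R) :
  coulomb_wave nu g Q Q1 -> 0 < r ->
  is_derive (wave_energy nu g Q Q1) r
    ((- (2 * nu / r ^ 2) + 2 * (g ^ 2 + g) / r ^ 3) * Q r ^ 2).
Proof.
  intros [H1 H2] Hr. specialize (H1 r Hr). specialize (H2 r Hr).
  assert (H3 := coulomb_potential_derive nu g r Hr).
  unfold wave_energy. auto_derive.
  - repeat split; eexists; eassumption.
  - rewrite_derives.
    ring.
Qed.

(** * Comparison of energies beyond 2 kap *)

Section Energy.
Variables nu g kap : R.
Hypothesis Hnu : -1 <= nu <= 1.
Hypothesis Hg : 0 <= g.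
Hypothesis Hkap : 27 <= kap.
Hypothesis Hgk : g ^ 2 + g <= kap ^ 2 + kap.

(** The centrifugal term is at most (1 + 1/kap)/4 and the Coulomb term at most 1/kap. Keeping [kap]
    apart from k lets the same estimate serve small k. *)
Lemma coulomb_potential_far (r : R) : 2 * kap <= r ->
  1 / 2 <= coulomb_potential nu g r <= 2.
Proof.
  intros Hr.
  assert (A : 0 <= (g ^ 2 + g) / r ^ 2 <= 3 / 10).
  { split.
    - apply Rdiv_le_0_compat; nra.
    - apply Rle_div_l; nra. }
  assert (B : - (1 / 10) <= 2 * nu / r <= 1 / 10).
  { split; [apply Rle_div_r; lra|apply Rle_div_l; lra]. }
  unfold coulomb_potential. lra.
Qed.

(** A primitive of 4/r^2 + 4 (kap^2 + kap)/r^3, which bounds |E'|/E for the wave energy E: it is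
    twice a bound for |q'|, as Q^2 <= 2E. *)
Let phi r := - (4 / r) - 2 * (kap ^ 2 + kap) / r ^ 2.

Let phi_range r : 2 * kap <= r -> -1 <= phi r <= 0.
Proof.
  intros Hr. unfold phi.
  assert (A : 0 <= 2 * (kap ^ 2 + kap) / r ^ 2 <= 6 / 10).
  { split; [apply Rdiv_le_0_compat; nra|apply Rle_div_l; nra]. }
  assert (B : 0 <= 4 / r <= 1 / 10).
  { split; [apply Rdiv_le_0_compat; lra|apply Rle_div_l; lra]. }
  lra.
Qed.

Let phi_derive r : 0 < r -> is_derive phi r (4 / r ^ 2 + 4 * (kap ^ 2 + kap) / r ^ 3).
Proof.
  intros Hr. unfold phi. auto_derive; [split; [lra|split; [|auto]]|field; lra].
  apply Rmult_integral_contrapositive. lra.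
Qed.

(** Gronwall's inequality in both directions: E e^phi increases and E e^(-phi) decreases, while phi
    varies by at most 1 on the whole of r >= 2 kap. *)
Lemma wave_energy_compare (Q Q1 : R -> R) (s t : R) :
  coulomb_wave nu g Q Q1 -> 2 * kap <= s <= t ->
  wave_energy nu g Q Q1 s <= exp 1 * wave_energy nu g Q Q1 t /\
  wave_energy nu g Q Q1 t <= exp 1 * wave_energy nu g Q Q1 s.
Proof.
  intros HQ Hst.
  assert (Hpos : forall r, 2 * kap <= r -> 0 <= Q r ^ 2 <= 2 * wave_energy nu g Q Q1 r).
  { intros r Hr. assert (A := coulomb_potential_far r Hr). unfold wave_energy.
    nra. }
  assert (Hdom : forall r, 2 * kap <= r ->
    Rabs ((- (2 * nu / r ^ 2) + 2 * (g ^ 2 + g) / r ^ 3) * Q r ^ 2)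
    <= (4 / r ^ 2 + 4 * (kap ^ 2 + kap) / r ^ 3) * wave_energy nu g Q Q1 r).
  { intros r Hr. assert (HP := Hpos r Hr).
    assert (A : Rabs (- (2 * nu / r ^ 2) + 2 * (g ^ 2 + g) / r ^ 3)
      <= 2 / r ^ 2 + 2 * (kap ^ 2 + kap) / r ^ 3).
    { assert (I2 : 0 < / r ^ 2) by (apply Rinv_0_lt_compat, pow_lt; lra).
      assert (I3 : 0 < / r ^ 3) by (apply Rinv_0_lt_compat, pow_lt; lra).
      unfold Rdiv. apply Rabs_le. nra. }
    rewrite Rabs_mult, (Rabs_pos_eq (Q r ^ 2)) by lra.
    replace ((4 / r ^ 2 + 4 * (kap ^ 2 + kap) / r ^ 3) * wave_energy nu g Q Q1 r)
      with ((2 / r ^ 2 + 2 * (kap ^ 2 + kap) / r ^ 3) * (2 * wave_energy nu g Q Q1 r))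
      by (field; lra).
    apply Rmult_le_compat; [apply Rabs_pos|lra|auto|lra]. }
  assert (Hs := phi_range s ltac:(lra)). assert (Ht := phi_range t ltac:(lra)).
  assert (M1 : wave_energy nu g Q Q1 s * exp (phi s) <= wave_energy nu g Q Q1 t * exp (phi t)).
  { apply (derive_nonneg_le (fun r => wave_energy nu g Q Q1 r * exp (phi r))
      (fun r => ((- (2 * nu / r ^ 2) + 2 * (g ^ 2 + g) / r ^ 3) * Q r ^ 2
        + (4 / r ^ 2 + 4 * (kap ^ 2 + kap) / r ^ 3) * wave_energy nu g Q Q1 r) * exp (phi r)));
      [lra| |].
    - intros r Hr. assert (D1 := wave_energy_derive nu g Q Q1 r HQ ltac:(lra)).
      assert (D2 := phi_derive r ltac:(lra)).
      auto_derive; [repeat split; eexists; eassumption|].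
      rewrite_derives.
      ring.
    - intros r Hr. specialize (Hdom r ltac:(lra)). apply Rabs_le_between in Hdom.
      apply Rmult_le_pos; [lra|left; apply exp_pos]. }
  assert (M2 : - (wave_energy nu g Q Q1 s * exp (- phi s)) <= - (wave_energy nu g Q Q1 t * exp (- phi t))).
  { apply (derive_nonneg_le (fun r => - (wave_energy nu g Q Q1 r * exp (- phi r)))
      (fun r => (- ((- (2 * nu / r ^ 2) + 2 * (g ^ 2 + g) / r ^ 3) * Q r ^ 2)
        + (4 / r ^ 2 + 4 * (kap ^ 2 + kap) / r ^ 3) * wave_energy nu g Q Q1 r) * exp (- phi r)));
      [lra| |].
    - intros r Hr. assert (D1 := wave_energy_derive nu g Q Q1 r HQ ltac:(lra)).
      assert (D2 := phi_derive r ltac:(lra)).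
      auto_derive; [repeat split; eexists; eassumption|].
      rewrite_derives.
      ring.
    - intros r Hr. specialize (Hdom r ltac:(lra)). apply Rabs_le_between in Hdom.
      apply Rmult_le_pos; [lra|left; apply exp_pos]. }
  assert (Es := Hpos s ltac:(lra)). assert (Et := Hpos t ltac:(lra)).
  set (a := wave_energy nu g Q Q1 s) in *. set (b := wave_energy nu g Q Q1 t) in *.
  split.
  - assert (X1 : exp (-1) <= exp (phi s)) by (apply exp_le_exp; lra).
    assert (X2 : exp (phi t) <= 1) by (rewrite <- exp_0; apply exp_le_exp; lra).
    assert (X3 : exp 1 * exp (-1) = 1) by (rewrite <- exp_plus; replace (1 + -1) with 0 by ring; apply exp_0).
    pose proof (exp_pos 1).
    assert (a * exp (-1) <= b) by nra.
    replace a with (exp 1 * (a * exp (-1))) by (rewrite (Rmult_comm a), <- Rmult_assoc, X3; ring).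
    apply Rmult_le_compat_l; lra.
  - assert (X1 : 1 <= exp (- phi t)) by (rewrite <- exp_0; apply exp_le_exp; lra).
    assert (X2 : exp (- phi s) <= exp 1) by (apply exp_le_exp; lra).
    nra.
Qed.
End Energy.

(** * The regular solution as a Coulomb wave *)

Definition regular_P (g : R) (X : R -> R) (r : R) : R := Rpower r g * X r.
Definition regular_Q (g : R) (Y : R -> R) (r : R) : R := Rpower r g * Y r.
Definition regular_Q1 (g : R) (X Y : R -> R) (r : R) : R :=
  regular_P g X r - g / r * regular_Q g Y r.

Section Pair.
Variables nu g : R.
Variables X Y : R -> R.
Hypothesis Hpair : coulomb_pair nu g X Y.

Notation P := (regular_P g X).
Notation Q := (regular_Q g Y).
Notation Q1 := (regular_Q1 g X Y).

Lemma regular_P_derive (r : R) : 0 < r ->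
  is_derive P r (g / r * P r - (1 + 2 * nu / r) * Q r).
Proof.
  intros Hr. assert (D := coulomb_dX _ _ _ _ Hpair r Hr).
  unfold regular_P, regular_Q, Rpower. auto_derive.
  - split; auto. split; auto. eexists; eassumption.
  - rewrite_derives.
    field. lra.
Qed.

Lemma regular_Q_derive (r : R) : 0 < r -> is_derive Q r (Q1 r).
Proof.
  intros Hr. assert (D := coulomb_dY _ _ _ _ Hpair r Hr).
  unfold regular_Q1, regular_P, regular_Q, Rpower. auto_derive.
  - split; auto. split; auto. eexists; eassumption.
  - rewrite_derives.
    field. lra.
Qed.

Lemma regular_wave : coulomb_wave nu g Q Q1.
Proof.
  split; [apply regular_Q_derive|].
  intros r Hr. assert (D1 := regular_P_derive r Hr). assert (D2 := regular_Q_derive r Hr).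
  unfold regular_Q1. auto_derive.
  - repeat split; try (eexists; eassumption). lra.
  - rewrite_derives.
    unfold coulomb_potential, regular_Q1. field. lra.
Qed.

Hypothesis Hnu : -1 <= nu <= 1.
Hypothesis Hg : 0 <= g.

Let th r := r + nu * ln r.

(** c1 + i c2 is the limit of r^g M e^(-i theta) for the Coulomb phase theta = r + nu ln r. The last
    clause makes |c|^2 the limit of the energy, through which the amplitude controls finite r. *)
Definition far_amplitude (c1 c2 : R) : Prop :=
  limoo (fun r => P r * cos (r + nu * ln r) + Q r * sin (r + nu * ln r)) c1 /\
  limoo (fun r => Q r * cos (r + nu * ln r) - P r * sin (r + nu * ln r)) c2 /\
  limoo (wave_energy nu g Q Q1) (c1 ^ 2 + c2 ^ 2).

(* zeta = (Q' + i theta' Q) e^(- i theta) has derivative (O(r^-2) Q) e^(- i theta),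
   because theta'^2 and the potential agree up to O(r^-2). *)
Lemma far_amplitude_exists : exists c1 c2, far_amplitude c1 c2.
Proof.
  (* Any admissible value serves: the existence of the limits is at stake, not uniformity in g. *)
  set (kap := 27 + g).
  assert (Hk : 27 <= kap) by (unfold kap; lra).
  assert (Hgk : g ^ 2 + g <= kap ^ 2 + kap) by (unfold kap; nra).
  assert (HW := regular_wave).
  set (E0 := wave_energy nu g Q Q1 (2 * kap)).
  assert (HB : forall r, 2 * kap <= r -> Q r ^ 2 <= 2 * (exp 1 * E0)).
  { intros r Hr.
    destruct (wave_energy_compare nu g kap Hnu Hg Hk Hgk Q Q1 (2 * kap) r HW ltac:(lra)) as [_ H].
    fold E0 in H. assert (A := coulomb_potential_far nu g kap Hnu Hg Hk Hgk r Hr).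
    unfold wave_energy in H. nra. }
  set (B := 2 * (exp 1 * E0) + 1).
  assert (HB1 : 1 <= B).
  { specialize (HB (2 * kap) ltac:(lra)). pose proof (pow2_ge_0 (Q (2 * kap))). unfold B. lra. }
  assert (HQ : forall r, 2 * kap <= r -> Rabs (Q r) <= B).
  { intros r Hr. specialize (HB r Hr). apply Rabs_le. unfold B in *.
    nra. }
  (* (1 + nu/r)^2 minus the potential equals [lam] / r^2. *)
  set (lam := nu ^ 2 + g ^ 2 + g).
  assert (Hlam : 0 <= lam) by (unfold lam; nra).
  set (C := (lam + 1) * B).
  assert (HG : forall r, 0 < r -> is_derive (fun r => - C / r) r (C / r ^ 2)).
  { intros r Hr. auto_derive; [lra|field; lra]. }
  assert (LG : limoo (fun r => - C / r) 0).
  { apply (limoo_dominated _ (Rabs C) 0). intros t Ht. unfold Rdiv.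
    rewrite Rabs_mult, Rabs_Ropp, Rabs_inv, (Rabs_pos_eq t) by lra. lra. }
  assert (trig : forall c r, 0 < r -> -1 <= c <= 1 -> 2 * kap <= r -> forall s, -1 <= s <= 1 ->
     Rabs (lam / r ^ 2 * Q r * c + s * (nu / r ^ 2) * Q r) <= C / r ^ 2).
  { intros c r Hr Hc Hr2 s Hs. specialize (HQ r Hr2).
    assert (I2 : 0 < / r ^ 2) by (apply Rinv_0_lt_compat, pow_lt; lra).
    replace (_ + _) with ((lam * c + s * nu) * Q r * / r ^ 2) by (field; lra).
    unfold Rdiv. rewrite Rabs_mult, (Rabs_pos_eq (/ r ^ 2)) by lra.
    apply Rmult_le_compat_r; [lra|]. rewrite Rabs_mult. unfold C.
    apply Rmult_le_compat; auto; try apply Rabs_pos.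
    apply Rabs_le. nra. }
  assert (lim : forall c s : R -> R, (forall x, is_derive c x (- s x)) -> (forall x, is_derive s x (c x)) ->
    (forall x, -1 <= c x <= 1) -> (forall x, -1 <= s x <= 1) ->
    exists l, limoo (fun r => Q1 r * c (th r) + (1 + nu / r) * Q r * s (th r)) l).
  { intros c s Dc Ds Hc Hs. apply (limoo_dominated_derive _
      (fun r => lam / r ^ 2 * Q r * c (th r) + - s (th r) * (nu / r ^ 2) * Q r)
      (fun r => - C / r) (fun r => C / r ^ 2) (2 * kap) 0); auto.
    - intros r Hr. assert (D1 := wave_dQ _ _ _ _ HW r ltac:(lra)).
      assert (D2 := wave_dQ1 _ _ _ _ HW r ltac:(lra)).
      assert (D3 := Dc (th r)). assert (D4 := Ds (th r)). unfold th in *. auto_derive.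
      + repeat split; try (eexists; eassumption); lra.
      + rewrite_derives. unfold coulomb_potential, lam. field. lra.
    - intros r Hr. apply HG. lra.
    - intros r Hr. pose proof (Hc (th r)). pose proof (Hs (th r)). apply trig; lra. }
  destruct (lim cos sin) as [c1 L1]; [| |apply COS_bound|apply SIN_bound|].
  1, 2: intros; auto_derive; [auto|ring].
  destruct (lim (fun x => - sin x) cos) as [c2 L2]; [| | |apply COS_bound|].
  1, 2: intros; auto_derive; [auto|ring].
  { intros x. pose proof (SIN_bound x). lra. }
  exists c1, c2.
  (* As P = Q' + (g/r) Q and theta' = 1 + nu/r, passing from zeta to the rotated pair (P, Q) costs
     only terms of size Q/r. *)
  assert (small : forall c s, (forall r, -1 <= c r <= 1) -> (forall r, -1 <= s r <= 1) ->
    limoo (fun r => (g * c r - nu * s r) * Q r / r) 0).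
  { intros c s Hc Hs. apply (limoo_dominated _ ((g + 1) * B) (2 * kap)). intros r Hr.
    specialize (HQ r ltac:(lra)). specialize (Hc r). specialize (Hs r). unfold Rdiv.
    rewrite Rabs_mult, (Rabs_pos_eq (/ r)) by (left; apply Rinv_0_lt_compat; lra).
    apply Rmult_le_compat_r; [left; apply Rinv_0_lt_compat; lra|].
    rewrite Rabs_mult. apply Rmult_le_compat; auto; try apply Rabs_pos.
    apply Rabs_le. nra. }
  split; [|split].
  - unfold limoo. rewrite <- (Rplus_0_r c1).
    eapply filterlim_ext_loc; [|apply filterlim_Rplus;
      [exact L1|apply (small (fun r => cos (th r)) (fun r => sin (th r)));
        intros; [apply COS_bound|apply SIN_bound]]].
    exists 0. intros r Hr. simpl. unfold regular_Q1, th. field. lra.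
  - unfold limoo. rewrite <- (Rplus_0_r c2).
    eapply filterlim_ext_loc; [|apply filterlim_Rplus;
      [exact L2|apply (small (fun r => - sin (th r)) (fun r => cos (th r)));
        intros r; [pose proof (SIN_bound (th r)); lra|apply COS_bound]]].
    exists 0. intros r Hr. simpl. unfold regular_Q1, th. field. lra.
  (* |zeta|^2 = Q'^2 + (1 + nu/r)^2 Q^2 exceeds the energy by [lam] Q^2 / r^2. *)
  - assert (L3 : limoo (fun r => - lam * Q r ^ 2 / r ^ 2) 0).
    { apply (limoo_dominated _ (lam * B ^ 2) (2 * kap)). intros r Hr.
      specialize (HQ r ltac:(lra)).
      assert (HQ2 : Q r ^ 2 <= B ^ 2).
      { rewrite <- (pow2_abs (Q r)). apply pow_incr. split; [apply Rabs_pos|auto]. }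
      pose proof (pow2_ge_0 (Q r)).
      replace (- lam * Q r ^ 2 / r ^ 2) with (- (lam * Q r ^ 2 * / r * / r)) by (field; lra).
      assert (I : 0 < / r <= 1).
      { split; [apply Rinv_0_lt_compat; lra|]. rewrite <- Rinv_1. apply Rinv_le_contravar; lra. }
      assert (A0 : 0 <= lam * Q r ^ 2 <= lam * B ^ 2).
      { split; [apply Rmult_le_pos; lra|apply Rmult_le_compat_l; lra]. }
      assert (0 <= lam * Q r ^ 2 * / r) by (apply Rmult_le_pos; lra).
      rewrite Rabs_Ropp, Rabs_pos_eq by (apply Rmult_le_pos; lra).
      apply Rmult_le_compat_r; [lra|]. nra. }
    assert (L4 := filterlim_Rplus _ _ _ _ (filterlim_Rplus _ _ _ _
      (filterlim_Rmult _ _ _ _ L1 L1) (filterlim_Rmult _ _ _ _ L2 L2)) L3).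
    unfold limoo. replace (c1 ^ 2 + c2 ^ 2) with (c1 * c1 + c2 * c2 + 0) by ring.
    eapply filterlim_ext_loc; [|exact L4].
    exists 0. intros r Hr. cbv beta.
    set (c := cos (th r)). set (s := sin (th r)).
    assert (cs : s ^ 2 = 1 - c ^ 2).
    { assert (A := sin2_cos2 (th r)). unfold Rsqr in A. fold c s in A. nra. }
    transitivity ((Q1 r ^ 2 + (1 + nu / r) ^ 2 * Q r ^ 2) * (c ^ 2 + s ^ 2) - lam * Q r ^ 2 / r ^ 2).
    { field. lra. }
    rewrite cs. unfold wave_energy, coulomb_potential, lam. field. lra.
Qed.
End Pair.

(** * Normalization at infinity *)

(* ring rejects equalities stated in the carrier of R_NormedModule. *)
Ltac as_R_eq := match goal with |- ?a = ?b => change (@eq R a b) end.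

Lemma Rpower_le_1 (r g : R) : 0 < r <= 1 -> 0 <= g -> 0 < Rpower r g <= 1.
Proof.
  intros Hr Hg. split; [apply exp_pos|].
  unfold Rpower. rewrite <- exp_0. apply exp_le_exp.
  assert (L := ln_le_sub1 r ltac:(lra)). nra.
Qed.

Lemma rotation_bound (x y c s : R) :
  c ^ 2 + s ^ 2 = 1 -> Rabs (x * c + y * s) <= Rabs x + Rabs y.
Proof.
  intros H. assert (Rabs c <= 1) by (apply Rabs_le; nra).
  assert (Rabs s <= 1) by (apply Rabs_le; nra).
  eapply Rle_trans; [apply Rabs_triang|]. rewrite !Rabs_mult.
  pose proof (Rabs_pos x). pose proof (Rabs_pos y). nra.
Qed.

Lemma cos2_sin2 (t : R) : cos t ^ 2 + sin t ^ 2 = 1.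
Proof. pose proof (sin2_cos2 t). unfold Rsqr in *. lra. Qed.

Lemma is_derive_id_mul (f : R -> R) (r l : R) :
  is_derive f r l -> is_derive (fun r => r * f r) r (f r + r * l).
Proof.
  intros D. auto_derive; [eexists; exact D|].
  rewrite_derives. ring.
Qed.

Lemma subexponential_Rpower_cos (p nu : R) : 0 <= p ->
  subexponential (fun t => Rpower t p * cos (nu * ln t)).
Proof.
  intros Hp. apply (subexponential_pow_mul p 1 (fun t => cos (nu * ln t))); auto.
  - intros t Ht. auto_derive. auto.
  - intros t _. apply Rabs_le, COS_bound.
Qed.

Lemma subexponential_Rpower_sin (p nu : R) : 0 <= p ->
  subexponential (fun t => Rpower t p * sin (nu * ln t)).
Proof.
  intros Hp. apply (subexponential_pow_mul p 1 (fun t => sin (nu * ln t))); auto.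
  - intros t Ht. auto_derive. auto.
  - intros t _. apply Rabs_le, SIN_bound.
Qed.

(* Gamma(p + 1), and the real and imaginary part of Gamma(p + 1 + i nu). *)
Definition gamma_int (p : R) : R := laplace (fun t => Rpower t p) 1.
Definition gamma_cos (p nu : R) : R := laplace (fun t => Rpower t p * cos (nu * ln t)) 1.
Definition gamma_sin (p nu : R) : R := laplace (fun t => Rpower t p * sin (nu * ln t)) 1.

Lemma laplace_rescale (f : R -> R) (s : R) : 0 < s -> subexponential f ->
  halfline_int (fun t => exp (- (s * t)) * f (s * t)) (laplace f 1 / s).
Proof.
  intros Hs Hf.
  assert (I := halfline_int_rescale _ s _ Hs (laplace_correct f 1 Rlt_0_1 Hf)).
  eapply halfline_int_ext; [|exact I]. intros t Ht. simpl. rewrite Rmult_1_l. reflexivity.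
Qed.

Lemma laplace_Rpower (p s : R) : 0 <= p -> 0 < s ->
  laplace (fun t => Rpower t p) s = gamma_int p * Rpower s (- (p + 1)).
Proof.
  intros Hp Hs. apply laplace_eq; auto. { apply subexponential_Rpower; auto. }
  assert (I := halfline_int_scal _ (Rpower s (- p)) _
    (laplace_rescale _ s Hs (subexponential_Rpower p Hp))).
  replace (gamma_int p * Rpower s (- (p + 1))) with (Rpower s (- p) * (gamma_int p / s)).
  - eapply halfline_int_ext; [|exact I]. intros t Ht. cbv beta.
    rewrite <- Rpower_mult_distr by auto.
    transitivity (Rpower s (- p) * Rpower s p * (exp (- (s * t)) * Rpower t p)); [ring|].
    rewrite <- Rpower_plus, Rplus_opp_l, Rpower_0_exp. ring.
  - replace (- (p + 1)) with (- p + - (1)) by ring.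
    rewrite Rpower_plus, (Rpower_Ropp s 1), Rpower_1 by auto. field. lra.
Qed.

(** By scaling, t^(p + i nu) has transform Gamma(p + 1 + i nu) s^(-(p + 1 + i nu)); the phase s^(-i
    nu) is a rotation by nu ln s, which the modulus does not see. *)
Lemma laplace_Rpower_modulus (p nu s : R) : 0 <= p -> 0 < s ->
  Rpower s (p + 1) ^ 2 * (laplace (fun t => Rpower t p * cos (nu * ln t)) s ^ 2
     + laplace (fun t => Rpower t p * sin (nu * ln t)) s ^ 2)
  = gamma_cos p nu ^ 2 + gamma_sin p nu ^ 2.
Proof.
  intros Hp Hs.
  set (K1 := laplace (fun t => Rpower t p * cos (nu * ln t)) s).
  set (K2 := laplace (fun t => Rpower t p * sin (nu * ln t)) s).
  assert (C1 := laplace_correct _ s Hs (subexponential_Rpower_cos p nu Hp)).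
  assert (C2 := laplace_correct _ s Hs (subexponential_Rpower_sin p nu Hp)).
  fold K1 in C1. fold K2 in C2.
  set (al := nu * ln s). set (w := Rpower s p).
  assert (E1 : w * cos al * K1 + - (w * sin al) * K2 = gamma_cos p nu / s).
  { eapply halfline_int_unique; [apply halfline_int_lin; eassumption|].
    eapply halfline_int_ext; [|apply (laplace_rescale _ s Hs (subexponential_Rpower_cos p nu Hp))].
    intros t Ht. cbv beta. rewrite <- Rpower_mult_distr, ln_mult, Rmult_plus_distr_l, cos_plus by auto.
    fold al w. ring. }
  assert (E2 : w * sin al * K1 + w * cos al * K2 = gamma_sin p nu / s).
  { eapply halfline_int_unique; [apply halfline_int_lin; eassumption|].
    eapply halfline_int_ext; [|apply (laplace_rescale _ s Hs (subexponential_Rpower_sin p nu Hp))].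
    intros t Ht. cbv beta. rewrite <- Rpower_mult_distr, ln_mult, Rmult_plus_distr_l, sin_plus by auto.
    fold al w. ring. }
  assert (F1 : gamma_cos p nu = s * (w * cos al * K1 + - (w * sin al) * K2))
    by (rewrite E1; field; lra).
  assert (F2 : gamma_sin p nu = s * (w * sin al * K1 + w * cos al * K2))
    by (rewrite E2; field; lra).
  rewrite F1, F2, Rpower_plus, Rpower_1 by auto. fold w.
  transitivity ((s * w) ^ 2 * (K1 ^ 2 + K2 ^ 2) * (cos al ^ 2 + sin al ^ 2)); [|ring].
  rewrite cos2_sin2. ring.
Qed.

Lemma gamma_int_nonneg (p : R) : 0 <= p -> 0 <= gamma_int p.
Proof.
  intros Hp. replace 0 with (0 / 1) by field.
  eapply halfline_int_le; [|apply (halfline_int_exp 0 1); lra|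
    apply (laplace_correct _ 1 Rlt_0_1 (subexponential_Rpower p Hp))].
  intros t Ht. simpl. rewrite Rmult_0_l. apply Rmult_le_pos; left; apply exp_pos.
Qed.

Lemma le_of_le_add_small (a b c : R) : (forall e, 0 < e <= 1 -> a <= b + c * e) -> a <= b.
Proof.
  intros H. destruct (Rle_dec a b) as [|N]; auto. exfalso.
  pose proof (Rabs_pos c). pose proof (Rle_abs c).
  set (e := Rmin 1 ((a - b) / (2 * (Rabs c + 1)))).
  assert (0 < (a - b) / (2 * (Rabs c + 1))) by (apply Rdiv_lt_0_compat; lra).
  assert (He : 0 < e <= 1) by (unfold e; split; [apply Rmin_glb_lt; lra|apply Rmin_l]).
  specialize (H e He).
  assert (e * (2 * (Rabs c + 1)) <= a - b).
  { replace (a - b) with ((a - b) / (2 * (Rabs c + 1)) * (2 * (Rabs c + 1))) by (field; lra).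
    apply Rmult_le_compat_r; [lra|apply Rmin_r]. }
  nra.
Qed.

(** * The Laplace transform of the regular solution *)

Section Laplace.
Variables nu g : R.
Variables X Y : R -> R.
Hypothesis Hpair : coulomb_pair nu g X Y.
Hypothesis Hnu : -1 <= nu <= 1.
Hypothesis Hg : 0 <= g.
Variables c1 c2 : R.
Hypothesis Hfar : far_amplitude nu g X Y c1 c2.

Notation P := (regular_P g X).
Notation Q := (regular_Q g Y).

Let y1 r := P r * cos (r + nu * ln r) + Q r * sin (r + nu * ln r).
Let y2 r := Q r * cos (r + nu * ln r) - P r * sin (r + nu * ln r).

(** Up to some M the power series bounds apply; beyond it the rotated components are within 1 of
    their limits. *)
Lemma regular_bounded : exists B, 0 < B /\ forall r, 0 < r -> Rabs (P r) <= B /\ Rabs (Q r) <= B.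
Proof.
  destruct Hfar as [L1 [L2 _]].
  destruct (proj1 (limoo_spec y1 c1) L1 1 Rlt_0_1) as [M1 [HM1 HM1']].
  destruct (proj1 (limoo_spec y2 c2) L2 1 Rlt_0_1) as [M2 [HM2 HM2']].
  set (M := M1 + M2).
  destruct (Rpower_le_exp g 1 Hg Rlt_0_1) as [K [HK HK']].
  set (B1 := K * exp (1 * M) * (1 + 5 * M * exp (2 * M))).
  set (B2 := Rabs c1 + 1 + (Rabs c2 + 1)).
  assert (0 < B1).
  { unfold B1. pose proof (exp_pos (2 * M)).
    assert (0 < M) by (unfold M; lra).
    assert (0 < 5 * M * exp (2 * M)) by (apply Rmult_lt_0_compat; lra).
    apply Rmult_lt_0_compat; [apply Rmult_lt_0_compat; [lra|apply exp_pos]|lra]. }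
  assert (0 < B2).
  { unfold B2. pose proof (Rabs_pos c1). pose proof (Rabs_pos c2). lra. }
  exists (B1 + B2). split; [lra|].
  intros r Hr. destruct (Rle_dec r M) as [HrM|HrM].
  - assert (HX := coulomb_bX _ _ _ _ Hpair r Hr). assert (HY := coulomb_bY _ _ _ _ Hpair r Hr).
    assert (He : 5 * r * exp (2 * r) <= 5 * M * exp (2 * M)).
    { pose proof (exp_pos (2 * r)).
      apply Rmult_le_compat; [lra|lra|lra|apply exp_le_exp; lra]. }
    assert (Hx : Rabs (X r) <= 1 + 5 * M * exp (2 * M)).
    { apply Rabs_le_between in HX. apply Rabs_le. lra. }
    assert (HR : Rpower r g <= K * exp (1 * M)).
    { eapply Rle_trans; [apply HK'; auto|]. apply Rmult_le_compat_l; [lra|]. apply exp_le_exp; lra. }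
    unfold regular_P, regular_Q.
    rewrite !Rabs_mult, (Rabs_pos_eq (Rpower r g)) by (left; apply exp_pos).
    assert (0 < Rpower r g) by apply exp_pos.
    split; (apply Rle_trans with B1; [|lra]; unfold B1; apply Rmult_le_compat; auto; try lra; apply Rabs_pos).
  - assert (A1 := HM1' r ltac:(unfold M in *; lra)).
    assert (A2 := HM2' r ltac:(unfold M in *; lra)).
    assert (A1' : Rabs (y1 r) <= Rabs c1 + 1).
    { replace (y1 r) with (c1 + (y1 r - c1)) by ring. eapply Rle_trans; [apply Rabs_triang|lra]. }
    assert (A2' : Rabs (y2 r) <= Rabs c2 + 1).
    { replace (y2 r) with (c2 + (y2 r - c2)) by ring. eapply Rle_trans; [apply Rabs_triang|lra]. }
    assert (cs := cos2_sin2 (r + nu * ln r)).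
    assert (E1 : P r = y1 r * cos (r + nu * ln r) + y2 r * - sin (r + nu * ln r)).
    { unfold y1, y2. transitivity (P r * (cos (r + nu * ln r) ^ 2 + sin (r + nu * ln r) ^ 2)).
      - rewrite cs; ring. - ring. }
    assert (E2 : Q r = y1 r * sin (r + nu * ln r) + y2 r * cos (r + nu * ln r)).
    { unfold y1, y2. transitivity (Q r * (cos (r + nu * ln r) ^ 2 + sin (r + nu * ln r) ^ 2)).
      - rewrite cs; ring. - ring. }
    split.
    + rewrite E1. eapply Rle_trans; [apply rotation_bound|unfold B2; lra].
      rewrite <- cs. ring.
    + rewrite E2. eapply Rle_trans; [apply rotation_bound|unfold B2; lra].
      rewrite <- cs. ring.
Qed.

Let rot (c s : R -> R) (r : R) : R := Rpower r g * (P r * c r + Q r * s r).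

(* G1 + i G2 = r^(2g) e^(-ir) M and H1 + i H2 = r^(2g) e^(-ir) conj M. *)
Let G1 := rot cos sin.
Let G2 := rot (fun r => - sin r) cos.
Let H1 := rot cos (fun r => - sin r).
Let H2 := rot (fun r => - sin r) (fun r => - cos r).

Let rot_subexponential c s : (forall r, ex_derive c r) -> (forall r, ex_derive s r) ->
  (forall r, c r ^ 2 + s r ^ 2 = 1) -> subexponential (rot c s).
Proof.
  intros Hc Hs cs. destruct regular_bounded as [B [HB HB']].
  apply (subexponential_pow_mul g (B + B) (fun r => P r * c r + Q r * s r)); auto.
  - intros t Ht. specialize (Hc t). specialize (Hs t).
    assert (DP := regular_P_derive nu g X Y Hpair t Ht).
    assert (DQ := regular_Q_derive nu g X Y Hpair t Ht).
    auto_derive. repeat split; auto; eexists; eassumption.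
  - intros t Ht. destruct (HB' t Ht). eapply Rle_trans; [apply rotation_bound, cs|lra].
Qed.

Let gG1 : subexponential G1.
Proof. apply rot_subexponential; intros r; [auto_derive; auto..|apply cos2_sin2]. Qed.
Let gG2 : subexponential G2.
Proof. apply rot_subexponential; intros r; [auto_derive; auto..|rewrite <- (cos2_sin2 r); ring]. Qed.
Let gH1 : subexponential H1.
Proof. apply rot_subexponential; intros r; [auto_derive; auto..|rewrite <- (cos2_sin2 r); ring]. Qed.
Let gH2 : subexponential H2.
Proof. apply rot_subexponential; intros r; [auto_derive; auto..|rewrite <- (cos2_sin2 r); ring]. Qed.

Let rot_derive c s c' s' r : 0 < r -> is_derive c r c' -> is_derive s r s' ->
  is_derive (rot c s) r (Rpower r g *
    ((2 * g / r * P r - (1 + 2 * nu / r) * Q r) * c r + P r * c' + P r * s r + Q r * s')).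
Proof.
  intros Hr Dc Ds. assert (DP := regular_P_derive nu g X Y Hpair r Hr).
  assert (DQ := regular_Q_derive nu g X Y Hpair r Hr). unfold rot, Rpower. auto_derive.
  - repeat split; try (eexists; eassumption). auto.
  - rewrite_derives. unfold regular_Q1. field. lra.
Qed.

(** Real part of (r G)' = G + conj(a) G + a H, which follows from r M' = i r M + a (conj(M) - M).
    The coefficients 1 keep the shape that [laplace_lin] consumes. *)
Let dG1 r : 0 < r -> is_derive (fun r => r * G1 r) r
  (1 * G1 r + 1 * (1 * (g * G1 r + - nu * G2 r) + 1 * (g * H1 r + nu * H2 r))).
Proof.
  intros Hr. evar_last.
  - apply is_derive_id_mul, rot_derive; [exact Hr|apply is_derive_cos|apply is_derive_sin].
  - unfold G1, G2, H1, H2, rot. as_R_eq. field. lra.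
Qed.

Let dG2 r : 0 < r -> is_derive (fun r => r * G2 r) r
  (1 * G2 r + 1 * (1 * (nu * G1 r + g * G2 r) + 1 * (- nu * H1 r + g * H2 r))).
Proof.
  intros Hr. evar_last.
  - apply is_derive_id_mul, rot_derive; [exact Hr|apply @is_derive_opp, is_derive_sin|apply is_derive_cos].
  - unfold G1, G2, H1, H2, rot, opp. simpl. as_R_eq. field. lra.
Qed.

(** G - H = 2i r^(2g) e^(-ir) Y, and the equation for Y gives (G - H)' = 2i H. A quarter turn of the
    pair (c, s) yields the imaginary part from the same computation. *)
Let dGH r c s : 0 < r -> is_derive c r (- s r) -> is_derive s r (c r) ->
  is_derive (fun r => 1 * rot c s r + -1 * rot c (fun r => - s r) r) r
    (-2 * rot (fun r => - s r) (fun r => - c r) r).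
Proof.
  intros Hr Dc Ds. evar_last.
  - apply @is_derive_plus; apply is_derive_scal, rot_derive; [exact Hr|exact Dc|exact Ds|
      exact Hr|exact Dc|apply @is_derive_opp, Ds].
  - unfold rot, plus, opp, scal. simpl. unfold mult. simpl. field. lra.
Qed.

Let L1 := laplace G1.
Let L2 := laplace G2.

Let lim0_mul_id f : subexponential f -> lim0 (fun r => r * f r) 0.
Proof.
  intros [_ B]. destruct (B 1 Rlt_0_1) as [K HK]. apply (lim0_dominated _ (Rabs K * exp 1)). intros t Ht.
  specialize (HK t ltac:(lra)). rewrite Rabs_mult, (Rabs_pos_eq t), Rmult_comm by lra.
  apply Rmult_le_compat_r; [lra|]. eapply Rle_trans; [exact HK|].
  pose proof (Rle_abs K). pose proof (exp_pos (1 * t)).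
  apply Rmult_le_compat; try lra; [|apply exp_le_exp; lra].
  pose proof (Rabs_pos (f t)). nra.
Qed.

Let Q_small : exists A, forall r, 0 < r < 1 -> Rabs (Q r) <= A * r.
Proof.
  exists (5 * exp 2). intros r Hr. assert (HY := coulomb_bY _ _ _ _ Hpair r ltac:(lra)).
  assert (HR := Rpower_le_1 r g ltac:(lra) Hg).
  unfold regular_Q. rewrite Rabs_mult, (Rabs_pos_eq (Rpower r g)) by lra.
  assert (exp (2 * r) <= exp 2) by (apply exp_le_exp; lra).
  pose proof (Rabs_pos (Y r)).
  apply Rle_trans with (1 * Rabs (Y r)); [apply Rmult_le_compat_r; lra|].
  rewrite Rmult_1_l. eapply Rle_trans; [exact HY|]. nra.
Qed.

(** For g = 0 both G and H tend to 1 at 0 and would leave boundary terms; G - H contains only Q,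
    which is O(r). *)
Let lim0_GH c s : (forall r, -1 <= s r <= 1) ->
  lim0 (fun r => 1 * rot c s r + -1 * rot c (fun r => - s r) r) 0.
Proof.
  intros Hs. destruct Q_small as [A HA].
  apply (lim0_dominated _ (2 * Rabs A)). intros t Ht. specialize (Hs t).
  replace (1 * rot c s t + -1 * rot c (fun r => - s r) t) with (2 * (Rpower t g * Q t * s t))
    by (unfold rot; ring).
  specialize (HA t Ht). assert (HR := Rpower_le_1 t g ltac:(lra) Hg).
  rewrite !Rabs_mult, (Rabs_pos_eq 2), (Rabs_pos_eq (Rpower t g)) by lra.
  assert (Rabs (s t) <= 1) by (apply Rabs_le; lra).
  pose proof (Rabs_pos (s t)). pose proof (Rabs_pos (Q t)).
  assert (Rabs (Q t) <= Rabs A * t) by (pose proof (Rle_abs A); nra).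
  enough (Rpower t g * Rabs (Q t) * Rabs (s t) <= 1 * Rabs (Q t) * 1) by lra.
  apply Rmult_le_compat; try lra; [apply Rmult_le_pos; lra|].
  apply Rmult_le_compat_r; lra.
Qed.

(** Transform of (G - H)' = 2i H. It gives the transform of H as s L/(s + 2i), so that the equation
    for L closes. *)
Let laplace_GH s : 0 < s ->
  s * (L1 s - laplace H1 s) = -2 * laplace H2 s /\ s * (L2 s - laplace H2 s) = 2 * laplace H1 s.
Proof.
  intros Hs.
  assert (E : forall t, 0 < t -> 2 * H1 t = -2 * rot (fun r => - cos r) (fun r => - - sin r) t)
    by (intros; unfold H1, rot; ring).
  assert (S1 := laplace_of_derive _ _ s Hs (subexponential_lin 1 (-1) G1 H1 gG1 gH1)
    (subexponential_scal (-2) H2 gH2)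
    (fun r Hr => dGH r cos sin Hr (is_derive_cos r) (is_derive_sin r)) (lim0_GH cos sin SIN_bound)).
  assert (S2 := laplace_of_derive (fun t => 1 * G2 t + -1 * H2 t) (fun t => 2 * H1 t) s Hs
    (subexponential_lin 1 (-1) G2 H2 gG2 gH2) (subexponential_scal 2 H1 gH1)).
  change (laplace (fun t => -2 * H2 t) s = s * laplace (fun t => 1 * G1 t + -1 * H1 t) s) in S1.
  rewrite laplace_lin, laplace_scal in S1 by auto.
  rewrite laplace_lin, laplace_scal in S2 by auto. fold L1 in S1. fold L2 in S2.
  split; [lra|]. rewrite S2; [lra| |].
  - intros t Ht. rewrite E by auto.
    apply (dGH t (fun r => - sin r) cos Ht); [apply @is_derive_opp, is_derive_sin|apply is_derive_cos].
  - apply (lim0_GH (fun r => - sin r) cos COS_bound).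
Qed.

(** Transform of (t f)', where the factor t removes the boundary term at 0. As L' is minus the
    transform of t G, eliminating H leaves s L' = -(1 + conj(a)) L - a s L/(s + 2i). *)
Let laplace_tG f a1 a2 a3 a4 s : 0 < s -> subexponential f ->
  (forall t, 0 < t -> is_derive (fun r => r * f r) t
    (1 * f t + 1 * (1 * (a1 * G1 t + a2 * G2 t) + 1 * (a3 * H1 t + a4 * H2 t)))) ->
  s * laplace (fun t => t * f t) s =
   laplace f s + (a1 * L1 s + a2 * L2 s + a3 * laplace H1 s + a4 * laplace H2 s).
Proof.
  intros Hs gf Df.
  assert (g2 : subexponential (fun t => 1 * (a1 * G1 t + a2 * G2 t) + 1 * (a3 * H1 t + a4 * H2 t))).
  { repeat apply subexponential_lin; auto. }
  rewrite <- (laplace_of_derive (fun t => t * f t) _ s Hs (subexponential_mul_id f gf)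
    (subexponential_lin 1 1 f _ gf g2) Df (lim0_mul_id f gf)).
  rewrite laplace_lin by auto.
  rewrite (laplace_lin (fun t => a1 * G1 t + a2 * G2 t)) by (auto; apply subexponential_lin; auto).
  rewrite !laplace_lin by auto. unfold L1, L2. ring.
Qed.

(* |L|^2 solves a scalar linear equation, which gives it in closed form up to a
   constant. *)
Lemma laplace_invariant (s S : R) : 0 < s -> 0 < S ->
  (L1 s ^ 2 + L2 s ^ 2) * exp ((2 * g + 2) * ln s + g * ln (s ^ 2 + 4) - 2 * nu * atan (s / 2)) =
  (L1 S ^ 2 + L2 S ^ 2) * exp ((2 * g + 2) * ln S + g * ln (S ^ 2 + 4) - 2 * nu * atan (S / 2)).
Proof.
  set (N := fun s => (L1 s ^ 2 + L2 s ^ 2) *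
    exp ((2 * g + 2) * ln s + g * ln (s ^ 2 + 4) - 2 * nu * atan (s / 2))).
  assert (HN : forall t, 0 < t -> is_derive N t 0).
  { intros t Ht.
    assert (D1 := laplace_derive G1 t Ht gG1). assert (D2 := laplace_derive G2 t Ht gG2).
    fold L1 in D1. fold L2 in D2.
    destruct (laplace_GH t Ht) as [R1 R2].
    assert (T1 := laplace_tG G1 g (- nu) g nu t Ht gG1 dG1).
    assert (T2 := laplace_tG G2 nu g (- nu) g t Ht gG2 dG2).
    fold L1 in T1. fold L2 in T2.
    set (M1 := laplace H1 t) in *. set (M2 := laplace H2 t) in *.
    set (a := L1 t) in *. set (b := L2 t) in *.
    set (da := laplace (fun r => r * G1 r) t) in *.
    set (db := laplace (fun r => r * G2 r) t) in *.
    unfold N. auto_derive.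
    - repeat split; try (eexists; eassumption); auto. nra.
    - rewrite_derives.
      fold a b.
      assert (Hs4 : t ^ 2 + 4 <> 0) by nra.
      assert (EM1 : M1 = t * (t * a + 2 * b) / (t ^ 2 + 4)).
      { apply (Rmult_eq_reg_r (t ^ 2 + 4)); auto. unfold Rdiv.
        rewrite Rmult_assoc, Rinv_l, Rmult_1_r by auto.
        assert (X1 := f_equal (fun z => z * t) R1). assert (X2 := f_equal (fun z => z * 2) R2).
        simpl in X1, X2. nra. }
      assert (EM2 : M2 = t * (t * b - 2 * a) / (t ^ 2 + 4)).
      { apply (Rmult_eq_reg_r (t ^ 2 + 4)); auto. unfold Rdiv.
        rewrite Rmult_assoc, Rinv_l, Rmult_1_r by auto.
        assert (X1 := f_equal (fun z => z * 2) R1). assert (X2 := f_equal (fun z => z * t) R2).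
        simpl in X1, X2. nra. }
      assert (Eda : da = (a + (g * a + - nu * b + g * M1 + nu * M2)) / t)
        by (rewrite <- T1; field; lra).
      assert (Edb : db = (b + (nu * a + g * b + - nu * M1 + g * M2)) / t)
        by (rewrite <- T2; field; lra).
      rewrite Eda, Edb, EM1, EM2. unfold Rsqr. field. repeat split; nra. }
  assert (key : forall x y, 0 < x <= y -> N x = N y).
  { intros x y Hxy. apply Rle_antisym.
    - apply (derive_nonneg_le N (fun _ => 0)); [lra| |intros; lra].
      intros z Hz. apply HN. lra.
    - enough (- N x <= - N y) by lra.
      apply (derive_nonneg_le (fun x => - N x) (fun _ => 0)); [lra| |intros; lra].
      intros z Hz. assert (D := HN z ltac:(lra)). auto_derive; [eexists; exact D|].
      rewrite_derives. ring. }
  intros Hs HS. change (N s = N S).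
  destruct (Rle_dec s S); [apply key; lra|symmetry; apply key; lra].
Qed.

(** * The transform near 0 and near infinity *)

Let K1 := laplace (fun t => Rpower t g * cos (nu * ln t)).
Let K2 := laplace (fun t => Rpower t g * sin (nu * ln t)).

(** Since r^g M = e^(i theta) (y1 + i y2), the factor e^(-ir) leaves G = r^(g + i nu) (y1 + i
    y2). *)
Let G1_y r : G1 r = Rpower r g * (cos (nu * ln r) * y1 r - sin (nu * ln r) * y2 r).
Proof.
  unfold G1, rot, y1, y2. rewrite cos_plus, sin_plus.
  set (b := nu * ln r). assert (cs := cos2_sin2 b).
  transitivity (Rpower r g * (P r * cos r + Q r * sin r) * (cos b ^ 2 + sin b ^ 2)); [|ring].
  rewrite cs. ring.
Qed.

Let G2_y r : G2 r = Rpower r g * (sin (nu * ln r) * y1 r + cos (nu * ln r) * y2 r).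
Proof.
  unfold G2, rot, y1, y2. rewrite cos_plus, sin_plus.
  set (b := nu * ln r). assert (cs := cos2_sin2 b).
  transitivity (Rpower r g * (P r * - sin r + Q r * cos r) * (cos b ^ 2 + sin b ^ 2)); [|ring].
  rewrite cs. ring.
Qed.

(** e covers the tail and b e^(-t) the bounded beginning. An exponential is preferred to an
    indicator because its effect on the transform is a shift from s to s + 1. *)
Let y_near_c e : 0 < e -> exists b, 0 <= b /\ forall t, 0 < t ->
  Rabs (y1 t - c1) + Rabs (y2 t - c2) <= e + b * exp (- t).
Proof.
  intros He. destruct Hfar as [A1 [A2 _]].
  destruct (proj1 (limoo_spec y1 c1) A1 (e / 2) ltac:(lra)) as [M1 [HM1 HM1']].
  destruct (proj1 (limoo_spec y2 c2) A2 (e / 2) ltac:(lra)) as [M2 [HM2 HM2']].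
  destruct regular_bounded as [B [HB HB']].
  set (D := 2 * (B + B) + Rabs c1 + Rabs c2). set (M := M1 + M2).
  assert (HD : 0 < D) by (unfold D; pose proof (Rabs_pos c1); pose proof (Rabs_pos c2); lra).
  exists (D * exp M). pose proof (exp_pos M).
  split; [apply Rmult_le_pos; lra|]. intros t Ht.
  destruct (Rle_dec t M) as [HtM|HtM].
  - assert (1 <= exp M * exp (- t)).
    { rewrite <- exp_plus, <- exp_0. apply exp_le_exp. lra. }
    destruct (HB' t Ht) as [P1 P2].
    assert (B1 : Rabs (y1 t) <= B + B).
    { eapply Rle_trans; [apply rotation_bound, cos2_sin2|lra]. }
    assert (B2 : Rabs (y2 t) <= B + B).
    { unfold y2. replace (_ - _) with (Q t * cos (t + nu * ln t) + P t * - sin (t + nu * ln t)) by ring.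
      eapply Rle_trans; [apply rotation_bound|lra]. rewrite <- (cos2_sin2 (t + nu * ln t)). ring. }
    assert (T1 := Rabs_triang (y1 t) (- c1)). assert (T2 := Rabs_triang (y2 t) (- c2)).
    rewrite Rabs_Ropp in T1, T2. unfold Rminus.
    apply Rle_trans with D; [unfold D; lra|]. nra.
  - assert (X1 := HM1' t ltac:(unfold M in *; lra)).
    assert (X2 := HM2' t ltac:(unfold M in *; lra)).
    pose proof (exp_pos (- t)).
    assert (0 <= D * exp M * exp (- t)) by (repeat apply Rmult_le_pos; lra). lra.
Qed.

(** Weighted by s^(g+1), the part t^g e^(-t) contributes Gamma(g + 1) (s/(s + 1))^(g+1) <= Gamma(g +
    1) s. *)
Let abelian_error f h s a b : 0 < s -> subexponential f -> subexponential h -> 0 <= a -> 0 <= b ->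
  (forall t, 0 < t -> Rabs (f t - h t) <= Rpower t g * (a + b * exp (- t))) ->
  s <= 1 ->
  Rpower s (g + 1) * Rabs (laplace f s - laplace h s) <= gamma_int g * (a + b * s).
Proof.
  intros Hs Hf Hh Ha Hb H Hs1.
  assert (J := halfline_int_lin _ _ a b _ _
    (laplace_correct _ s Hs (subexponential_Rpower g Hg))
    (laplace_correct _ (s + 1) ltac:(lra) (subexponential_Rpower g Hg))).
  assert (Hle : Rabs (laplace (fun t => 1 * f t + -1 * h t) s) <=
    a * laplace (fun t => Rpower t g) s + b * laplace (fun t => Rpower t g) (s + 1)).
  { apply (laplace_dominated_gen _ (fun t => Rpower t g * (a + b * exp (- t)))); auto.
    - apply subexponential_lin; auto.
    - intros t Ht. replace (1 * f t + -1 * h t) with (f t - h t) by ring. auto.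
    - eapply halfline_int_ext; [|exact J]. intros t Ht. cbv beta.
      replace (exp (- ((s + 1) * t))) with (exp (- (s * t)) * exp (- t))
        by (rewrite <- exp_plus; f_equal; ring).
      ring. }
  rewrite laplace_lin in Hle by auto.
  replace (1 * laplace f s + -1 * laplace h s) with (laplace f s - laplace h s) in Hle by ring.
  assert (Hw : 0 < Rpower s (g + 1)) by apply exp_pos.
  apply Rle_trans with (Rpower s (g + 1) * (a * laplace (fun t => Rpower t g) s
    + b * laplace (fun t => Rpower t g) (s + 1))).
  { apply Rmult_le_compat_l; [lra|auto]. }
  rewrite !laplace_Rpower by lra.
  assert (E1 : Rpower s (g + 1) * Rpower s (- (g + 1)) = 1).
  { rewrite <- Rpower_plus, Rplus_opp_r. apply Rpower_0_exp. }
  assert (E2 : Rpower s (g + 1) * Rpower (s + 1) (- (g + 1)) <= s).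
  { unfold Rpower. rewrite <- exp_plus. rewrite <- (exp_ln s Hs) at 3. apply exp_le_exp.
    assert (L1' := ln_le_sub1 s Hs).
    assert (L2' : 0 <= ln (s + 1)) by (rewrite <- ln_1; apply ln_le; lra). nra. }
  assert (Gp := gamma_int_nonneg g Hg).
  replace (_ * (_ + _)) with (gamma_int g * (a * (Rpower s (g + 1) * Rpower s (- (g + 1)))
    + b * (Rpower s (g + 1) * Rpower (s + 1) (- (g + 1))))) by ring.
  rewrite E1. apply Rmult_le_compat_l; auto.
  assert (b * (Rpower s (g + 1) * Rpower (s + 1) (- (g + 1))) <= b * s)
    by (apply Rmult_le_compat_l; auto). lra.
Qed.

Let gK a b :
  subexponential (fun t => a * (Rpower t g * cos (nu * ln t)) + b * (Rpower t g * sin (nu * ln t))).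
Proof.
  apply subexponential_lin; [apply subexponential_Rpower_cos|apply subexponential_Rpower_sin]; auto.
Qed.

(** An Abelian theorem: as G is asymptotic to c r^(g + i nu), near s = 0 its transform is close to c
    times that of t^(g + i nu). *)
Lemma laplace_near_0 (e : R) : 0 < e -> exists s, 0 < s /\
  Rpower s (g + 1) * Rabs (L1 s - (c1 * K1 s + - c2 * K2 s)) <= e /\
  Rpower s (g + 1) * Rabs (L2 s - (c2 * K1 s + c1 * K2 s)) <= e.
Proof.
  intros He. assert (Gp := gamma_int_nonneg g Hg). set (G := gamma_int g) in *.
  set (a := e / (2 * (G + 1))).
  assert (Ha : 0 < a) by (apply Rdiv_lt_0_compat; lra).
  destruct (y_near_c a Ha) as [b [Hb Hy]].
  assert (Hb0 : 0 < e / (2 * (G + 1) * (b + 1))).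
  { apply Rdiv_lt_0_compat; [lra|apply Rmult_lt_0_compat; lra]. }
  set (s := Rmin 1 (e / (2 * (G + 1) * (b + 1)))).
  assert (Hs : 0 < s) by (apply Rmin_glb_lt; lra).
  assert (Hs1 : s <= 1) by apply Rmin_l.
  assert (Hfin : G * (a + b * s) <= e).
  { assert (E1 : a * (2 * (G + 1)) = e) by (unfold a; field; lra).
    assert (E2 : s * (2 * (G + 1) * (b + 1)) <= e).
    { apply Rle_trans with (e / (2 * (G + 1) * (b + 1)) * (2 * (G + 1) * (b + 1)));
        [|right; field; lra].
      apply Rmult_le_compat_r; [|apply Rmin_r]. apply Rmult_le_pos; lra. }
      nra. }
  assert (Hrot : forall b, cos b ^ 2 + (- sin b) ^ 2 = 1).
  { intros x. rewrite <- (cos2_sin2 x). ring. }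
  exists s. split; [auto|]. split; (eapply Rle_trans; [|exact Hfin]).
  - assert (E : laplace (fun t => c1 * (Rpower t g * cos (nu * ln t)) + - c2 * (Rpower t g * sin (nu * ln t))) s
      = c1 * K1 s + - c2 * K2 s).
    { apply laplace_lin; auto; [apply subexponential_Rpower_cos|apply subexponential_Rpower_sin]; auto. }
    rewrite <- E. apply abelian_error; auto; try lra.
    intros t Ht. rewrite G1_y.
    replace (_ - _) with (Rpower t g * ((y1 t - c1) * cos (nu * ln t) + (y2 t - c2) * - sin (nu * ln t))) by ring.
    rewrite Rabs_mult, (Rabs_pos_eq (Rpower t g)) by (left; apply exp_pos).
    apply Rmult_le_compat_l; [left; apply exp_pos|].
    eapply Rle_trans; [apply rotation_bound, Hrot|auto].
  - assert (E : laplace (fun t => c2 * (Rpower t g * cos (nu * ln t)) + c1 * (Rpower t g * sin (nu * ln t))) s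
      = c2 * K1 s + c1 * K2 s).
    { apply laplace_lin; auto; [apply subexponential_Rpower_cos|apply subexponential_Rpower_sin]; auto. }
    rewrite <- E. apply abelian_error; auto; try lra.
    intros t Ht. rewrite G2_y.
    replace (_ - _) with (Rpower t g * ((y2 t - c2) * cos (nu * ln t) + (y1 t - c1) * sin (nu * ln t))) by ring.
    rewrite Rabs_mult, (Rabs_pos_eq (Rpower t g)) by (left; apply exp_pos).
    apply Rmult_le_compat_l; [left; apply exp_pos|].
    eapply Rle_trans; [apply rotation_bound, cos2_sin2|]. specialize (Hy t Ht). lra.
Qed.

(** The factor e^(2t) in the error shifts the transform to S - 2 >= S/2, so the error is O(1/S)
    after weighting. In 11, 10 is for the rotated X - 1 and Y, and 1 for cos t - 1 or sin t. *)
Let origin_error f d S : 4 <= S -> subexponential f ->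
  (forall t, 0 < t -> Rabs (f t - d * Rpower t (2 * g)) <= 11 * (Rpower t (2 * g + 1) * exp (2 * t))) ->
  Rpower S (2 * g + 1) * Rabs (laplace f S - d * (gamma_int (2 * g) * Rpower S (- (2 * g + 1))))
   <= 11 * gamma_int (2 * g + 1) * Rpower 2 (2 * g + 2) / S.
Proof.
  intros HS Hf H.
  assert (Hp := subexponential_Rpower (2 * g) ltac:(lra)).
  assert (J := halfline_int_scal _ 11 _
    (laplace_correct _ (S - 2) ltac:(lra) (subexponential_Rpower (2 * g + 1) ltac:(lra)))).
  assert (Hle : Rabs (laplace (fun t => 1 * f t + - d * Rpower t (2 * g)) S) <=
    11 * laplace (fun t => Rpower t (2 * g + 1)) (S - 2)).
  { apply (laplace_dominated_gen _ (fun t => 11 * (Rpower t (2 * g + 1) * exp (2 * t)))).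
    - lra.
    - apply subexponential_lin; auto.
    - intros t Ht. replace (1 * f t + _) with (f t - d * Rpower t (2 * g)) by ring. auto.
    - eapply halfline_int_ext; [|exact J]. intros t Ht. cbv beta.
      replace (exp (- ((S - 2) * t))) with (exp (- (S * t)) * exp (2 * t))
        by (rewrite <- exp_plus; f_equal; ring).
      ring. }
  rewrite laplace_lin in Hle by (auto; lra). rewrite !laplace_Rpower in Hle by lra.
  replace (1 * laplace f S + _) with
    (laplace f S - d * (gamma_int (2 * g) * Rpower S (- (2 * g + 1)))) in Hle by ring.
  assert (Hw : 0 < Rpower S (2 * g + 1)) by apply exp_pos.
  assert (Gp := gamma_int_nonneg (2 * g + 1) ltac:(lra)).
  apply Rle_trans with (Rpower S (2 * g + 1) * (11 * (gamma_int (2 * g + 1) * Rpower (S - 2) (- (2 * g + 1 + 1))))).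
  { apply Rmult_le_compat_l; [lra|auto]. }
  assert (E2 : Rpower S (2 * g + 1) * Rpower (S - 2) (- (2 * g + 1 + 1)) <= Rpower 2 (2 * g + 2) / S).
  { replace (Rpower 2 (2 * g + 2) / S) with (exp ((2 * g + 2) * ln 2 + - ln S)).
    2:{ rewrite exp_plus, exp_Ropp, exp_ln by lra. reflexivity. }
    unfold Rpower. rewrite <- exp_plus. apply exp_le_exp.
    assert (L : ln S - ln 2 <= ln (S - 2)).
    { rewrite <- ln_div by lra. apply ln_le; lra. }
    nra. }
  replace (_ * (11 * _)) with (11 * gamma_int (2 * g + 1) * (Rpower S (2 * g + 1) * Rpower (S - 2) (- (2 * g + 1 + 1)))) by ring.
  replace (11 * gamma_int (2 * g + 1) * Rpower 2 (2 * g + 2) / S) with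
    (11 * gamma_int (2 * g + 1) * (Rpower 2 (2 * g + 2) / S)) by (field; lra).
  apply Rmult_le_compat_l; [lra|exact E2].
Qed.

(** For large s the transform sees only G near 0, where G = r^(2g) (1 + O(r)); hence the leading
    constant Gamma(2g + 1). *)
Lemma laplace_near_infinity (e M : R) : 0 < e -> exists S, M < S /\ 1 <= S /\
  Rpower S (2 * g + 1) * Rabs (L1 S) <= gamma_int (2 * g) + e /\
  Rpower S (2 * g + 1) * Rabs (L2 S) <= e.
Proof.
  intros He. set (Z := 11 * gamma_int (2 * g + 1) * Rpower 2 (2 * g + 2)).
  assert (Gp := gamma_int_nonneg (2 * g + 1) ltac:(lra)).
  assert (Gp' := gamma_int_nonneg (2 * g) ltac:(lra)).
  assert (HZ : 0 <= Z) by (unfold Z; apply Rmult_le_pos; [lra|left; apply exp_pos]).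
  assert (HZe : 0 <= Z / e) by (apply Rdiv_le_0_compat; lra).
  set (S := 4 + Rabs M + Z / e). pose proof (Rle_abs M). pose proof (Rabs_pos M).
  assert (HS : 4 <= S) by (unfold S; lra).
  assert (Hfin : Z / S <= e).
  { apply Rle_div_l; [lra|]. replace Z with (e * (Z / e)) by (field; lra).
    apply Rmult_le_compat_l; unfold S; lra. }
  exists S. split; [unfold S; lra|]. split; [lra|].
  assert (GG : forall t, Rpower t g * Rpower t g = Rpower t (2 * g)).
  { intros t. rewrite <- Rpower_plus. f_equal. ring. }
  assert (small : forall t, 0 < t -> Rpower t (2 * g) * (10 * t * exp (2 * t) + t)
     <= 11 * (Rpower t (2 * g + 1) * exp (2 * t))).
  { intros t Ht. rewrite (Rpower_plus (2 * g) 1 t), Rpower_1 by auto.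
    assert (1 <= exp (2 * t)) by (rewrite <- exp_0; apply exp_le_exp; lra).
    assert (0 < Rpower t (2 * g)) by apply exp_pos.
    replace (11 * _) with (Rpower t (2 * g) * (11 * t * exp (2 * t))) by ring.
    apply Rmult_le_compat_l; [lra|]. nra. }
  assert (tr : forall x y c s t, 0 < t -> c ^ 2 + s ^ 2 = 1 -> Rabs (x - 1) <= 5 * t * exp (2 * t) ->
     Rabs y <= 5 * t * exp (2 * t) -> Rabs ((x - 1) * c + y * s) <= 10 * t * exp (2 * t)).
  { intros x y c s t Ht cs Hx Hy. eapply Rle_trans; [apply rotation_bound, cs|lra]. }
  split.
  - assert (A := origin_error G1 1 S HS gG1).
    assert (W : Rpower S (2 * g + 1) * Rpower S (- (2 * g + 1)) = 1).
    { rewrite <- Rpower_plus, Rplus_opp_r. apply Rpower_0_exp. }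
    assert (Hw : 0 < Rpower S (2 * g + 1)) by apply exp_pos.
    assert (T := Rabs_triang (laplace G1 S - 1 * (gamma_int (2 * g) * Rpower S (- (2 * g + 1))))
      (1 * (gamma_int (2 * g) * Rpower S (- (2 * g + 1))))).
    replace (_ - _ + _) with (L1 S) in T by (unfold L1; ring).
    rewrite (Rabs_pos_eq (1 * _)) in T.
    2:{ rewrite Rmult_1_l. apply Rmult_le_pos; [auto|left; apply exp_pos]. }
    apply (Rmult_le_compat_l (Rpower S (2 * g + 1))) in T; [|lra].
    eapply Rle_trans; [exact T|]. rewrite Rmult_plus_distr_l.
    replace (Rpower S (2 * g + 1) * (1 * (gamma_int (2 * g) * Rpower S (- (2 * g + 1))))) with
      (gamma_int (2 * g) * (Rpower S (2 * g + 1) * Rpower S (- (2 * g + 1)))) by ring.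
    rewrite W.
    fold Z in A. lapply A; [lra|].
    intros t Ht. eapply Rle_trans; [|apply small; auto].
    assert (HX := coulomb_bX _ _ _ _ Hpair t Ht). assert (HY := coulomb_bY _ _ _ _ Hpair t Ht).
    unfold G1, rot, regular_P, regular_Q.
    replace (_ - _) with (Rpower t (2 * g) * (((X t - 1) * cos t + Y t * sin t) + (cos t - 1)))
      by (rewrite <- GG; ring).
    rewrite Rabs_mult, (Rabs_pos_eq (Rpower t _)) by (left; apply exp_pos).
    apply Rmult_le_compat_l; [left; apply exp_pos|].
    eapply Rle_trans; [apply Rabs_triang|]. apply Rplus_le_compat.
    + apply tr; auto. apply cos2_sin2.
    + apply abs_cos_sub1_le. lra.
  - assert (A := origin_error G2 0 S HS gG2).
    replace (laplace G2 S - 0 * _) with (L2 S) in A by (unfold L2; ring).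
    fold Z in A. lapply A; [lra|].
    intros t Ht. eapply Rle_trans; [|apply small; auto].
    assert (HX := coulomb_bX _ _ _ _ Hpair t Ht). assert (HY := coulomb_bY _ _ _ _ Hpair t Ht).
    unfold G2, rot, regular_P, regular_Q.
    replace (_ - _) with (Rpower t (2 * g) * (((X t - 1) * - sin t + Y t * cos t) + - sin t))
      by (rewrite <- GG; ring).
    rewrite Rabs_mult, (Rabs_pos_eq (Rpower t _)) by (left; apply exp_pos).
    apply Rmult_le_compat_l; [left; apply exp_pos|].
    eapply Rle_trans; [apply Rabs_triang|]. apply Rplus_le_compat.
    + apply tr; auto. rewrite <- (cos2_sin2 t). ring.
    + rewrite Rabs_Ropp. apply abs_sin_le. lra.
Qed.

(** The invariant is evaluated near both ends. Bounding |2 nu atan| by 4 costs e^4 at each end, and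
    (1 + 4/S^2)^g <= e one more factor e; the 2 comes from |L - d|^2 <= 2|L|^2 + 2|d|^2. *)
Lemma far_amplitude_bound :
  Rpower 4 g * (c1 ^ 2 + c2 ^ 2) * (gamma_cos g nu ^ 2 + gamma_sin g nu ^ 2)
  <= 2 * exp 9 * gamma_int (2 * g) ^ 2.
Proof.
  set (v := c1 ^ 2 + c2 ^ 2). set (w := gamma_cos g nu ^ 2 + gamma_sin g nu ^ 2).
  set (G := gamma_int (2 * g)). set (F := Rpower 4 g).
  assert (HF : 0 < F) by apply exp_pos.
  apply (le_of_le_add_small _ _ (2 * exp 9 * (2 * G + 2) + 4 * F)). intros e [He He1].
  destruct (laplace_near_0 e He) as [s [Hs [S1 S2]]].
  (* S > 4g + 1 makes g ln(1 + 4/S^2) at most 1. *)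
  destruct (laplace_near_infinity e (4 * g + 1) He) as [S [HS [HS1 [T1 T2]]]].
  assert (Inv := laplace_invariant s S Hs ltac:(lra)).
  assert (Kw := laplace_Rpower_modulus g nu s Hg Hs). fold w in Kw. fold (K1 s) (K2 s) in Kw.
  set (a1 := L1 s) in *. set (a2 := L2 s) in *. set (b1 := L1 S) in *. set (b2 := L2 S) in *.
  set (k1 := K1 s) in *. set (k2 := K2 s) in *.
  set (z := Rpower s (g + 1)) in *. assert (Hz : 0 < z) by apply exp_pos.
  set (Z := Rpower S (2 * g + 1)) in *. assert (HZ : 0 < Z) by apply exp_pos.
  assert (Hpi := PI_4).
  assert (at1 : forall x, -4 <= - (2 * nu * atan x) <= 4).
  { intros x. assert (B := atan_bound x). nra. }
  assert (LB : z ^ 2 * (a1 ^ 2 + a2 ^ 2) * F <= exp 4 * ((a1 ^ 2 + a2 ^ 2) *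
     exp ((2 * g + 2) * ln s + g * ln (s ^ 2 + 4) - 2 * nu * atan (s / 2)))).
  { replace (z ^ 2 * (a1 ^ 2 + a2 ^ 2) * F) with ((a1 ^ 2 + a2 ^ 2) *
      exp ((2 * g + 2) * ln s + g * ln 4)).
    2:{ unfold z, F, Rpower. rewrite exp_plus.
        replace ((2 * g + 2) * ln s) with ((g + 1) * ln s + (g + 1) * ln s) by ring.
        rewrite exp_plus. ring. }
    rewrite <- Rmult_assoc, (Rmult_comm (exp 4)), Rmult_assoc, <- exp_plus.
    apply Rmult_le_compat_l; [nra|]. apply exp_le_exp.
    assert (ln 4 <= ln (s ^ 2 + 4)) by (apply ln_le; nra).
    specialize (at1 (s / 2)). nra. }
  assert (UB : (b1 ^ 2 + b2 ^ 2) *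
     exp ((2 * g + 2) * ln S + g * ln (S ^ 2 + 4) - 2 * nu * atan (S / 2))
     <= exp 5 * (Z ^ 2 * (b1 ^ 2 + b2 ^ 2))).
  { replace (exp 5 * (Z ^ 2 * (b1 ^ 2 + b2 ^ 2))) with ((b1 ^ 2 + b2 ^ 2) *
      exp ((4 * g + 2) * ln S + 5)).
    2:{ unfold Z, Rpower.
        replace ((4 * g + 2) * ln S + 5) with ((2 * g + 1) * ln S + (2 * g + 1) * ln S + 5) by ring.
        rewrite !exp_plus. ring. }
    apply Rmult_le_compat_l; [nra|]. apply exp_le_exp.
    assert (L : ln (S ^ 2 + 4) <= 2 * ln S + 4 / S ^ 2).
    { replace (S ^ 2 + 4) with (S * S * (1 + 4 / S ^ 2)) by (field; lra).
      assert (0 < 4 / S ^ 2) by (apply Rdiv_lt_0_compat; nra).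
      rewrite !ln_mult by nra. assert (L := ln_le_sub1 (1 + 4 / S ^ 2) ltac:(lra)). lra. }
    assert (g * (4 / S ^ 2) <= 1).
    { replace (g * (4 / S ^ 2)) with (4 * g / S ^ 2) by (field; lra).
      apply Rle_div_l; nra. }
    specialize (at1 (S / 2)). nra. }
  assert (U2 : Z ^ 2 * (b1 ^ 2 + b2 ^ 2) <= (G + e) ^ 2 + e ^ 2).
  { rewrite <- (pow2_abs b1), <- (pow2_abs b2).
    replace (_ * _) with ((Z * Rabs b1) ^ 2 + (Z * Rabs b2) ^ 2) by ring.
    pose proof (Rabs_pos b1). pose proof (Rabs_pos b2).
    apply Rplus_le_compat; apply pow_incr; (split; [apply Rmult_le_pos; lra|auto]). }
  set (d1 := a1 - (c1 * k1 + - c2 * k2)) in *. set (d2 := a2 - (c2 * k1 + c1 * k2)) in *.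
  assert (D1 : z ^ 2 * d1 ^ 2 <= e ^ 2).
  { rewrite <- (pow2_abs d1). replace (_ * _) with ((z * Rabs d1) ^ 2) by ring.
    pose proof (Rabs_pos d1). apply pow_incr. split; [apply Rmult_le_pos; lra|auto]. }
  assert (D2 : z ^ 2 * d2 ^ 2 <= e ^ 2).
  { rewrite <- (pow2_abs d2). replace (_ * _) with ((z * Rabs d2) ^ 2) by ring.
    pose proof (Rabs_pos d2). apply pow_incr. split; [apply Rmult_le_pos; lra|auto]. }
  assert (V : v * w <= 2 * (z ^ 2 * (a1 ^ 2 + a2 ^ 2)) + 4 * e ^ 2).
  { rewrite <- Kw.
    replace (v * _) with (z ^ 2 * ((a1 - d1) ^ 2 + (a2 - d2) ^ 2)) by (unfold d1, d2, v; ring).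
    assert (Hz2 : 0 <= z ^ 2) by apply pow2_ge_0.
    assert (z ^ 2 * ((a1 - d1) ^ 2 + (a2 - d2) ^ 2) <=
      z ^ 2 * (2 * a1 ^ 2 + 2 * d1 ^ 2 + 2 * a2 ^ 2 + 2 * d2 ^ 2)).
    { apply Rmult_le_compat_l; auto.
      pose proof (pow2_ge_0 (a1 + d1)). pose proof (pow2_ge_0 (a2 + d2)). lra. }
    lra. }
  assert (e ^ 2 <= e) by nra.
  assert (E45 : exp 4 * exp 5 = exp 9) by (rewrite <- exp_plus; f_equal; ring).
  assert (M1 : z ^ 2 * (a1 ^ 2 + a2 ^ 2) * F <= exp 9 * (G ^ 2 + (2 * G + 2) * e)).
  { eapply Rle_trans; [exact LB|]. rewrite Inv.
    replace (exp 9 * (G ^ 2 + (2 * G + 2) * e)) with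
      (exp 4 * (exp 5 * (G ^ 2 + (2 * G + 2) * e))) by (rewrite <- E45; ring).
    apply Rmult_le_compat_l; [left; apply exp_pos|].
    eapply Rle_trans; [exact UB|]. apply Rmult_le_compat_l; [left; apply exp_pos|].
    eapply Rle_trans; [exact U2|]. nra. }
  replace (F * v * w) with (F * (v * w)) by ring.
  apply Rle_trans with (F * (2 * (z ^ 2 * (a1 ^ 2 + a2 ^ 2)) + 4 * e ^ 2)).
  { apply Rmult_le_compat_l; lra. }
  nra.
Qed.
End Laplace.

(** * Uniform bounds for large k *)

(* m = k^(1/3) is the width of the turning point region |r - k| <= 9 m. *)
Section Uniform.
Variables nu g k m : R.
Hypothesis Hnu : -1 <= nu <= 1.
Hypothesis Hg : 0 <= g.
Hypothesis Hk : g ^ 2 + nu ^ 2 = k ^ 2.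
Hypothesis Hm : 6 <= m.
Hypothesis Hmk : k = m ^ 3.
Variables Q Q1 : R -> R.
Hypothesis HQ : coulomb_wave nu g Q Q1.
Variable E : R.
Hypothesis HE : wave_energy nu g Q Q1 (2 * k) <= E.
Variable B : R.
Hypothesis HB1 : forall r, 0 < r < 1 -> Rabs (Q1 r) <= B * r.
Hypothesis HB0 : forall r, 0 < r < 1 -> Rabs (Q r) <= B * r ^ 2.

Notation q := (coulomb_potential nu g).

(** * Shape of the potential around its turning point *)

Let Hk216 : 216 <= k.
Proof. rewrite Hmk. simpl. nra. Qed.

Let Hk36 : 36 * m <= k.
Proof. rewrite Hmk. simpl. nra. Qed.

Let Hgk : g <= k.
Proof. nra. Qed.

Let Hgg : g ^ 2 + g <= k ^ 2 + k.
Proof. nra. Qed.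

(** Completing the square with g^2 + nu^2 = k^2; the positive zero is sqrt(k^2 + g) - nu. *)
Lemma coulomb_potential_turning (r : R) : 0 < r ->
  q r = ((r + nu) ^ 2 - k ^ 2 - g) / r ^ 2.
Proof. intros Hr. rewrite <- Hk. unfold coulomb_potential. field. lra. Qed.

Let q1 r := - (2 * nu / r ^ 2) + 2 * (g ^ 2 + g) / r ^ 3.
Let q2 r := 4 * nu / r ^ 3 - 6 * (g ^ 2 + g) / r ^ 4.

Let dq r : 0 < r -> is_derive q r (q1 r).
Proof. intros; apply coulomb_potential_derive; auto. Qed.

Let dq1 r : 0 < r -> is_derive q1 r (q2 r).
Proof.
  intros Hr. unfold q1, q2. auto_derive.
  - split; [|split; [|auto]]; repeat apply Rmult_integral_contrapositive_currified; lra.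
  - field. lra.
Qed.

Let q1_nonneg r : 0 < r <= 2 * k -> 0 <= q1 r.
Proof.
  intros Hr. unfold q1.
  replace (_ + _) with (2 * (g ^ 2 + g - nu * r) * / r ^ 3) by (field; lra).
  apply Rmult_le_pos; [|left; apply Rinv_0_lt_compat, pow_lt; lra].
  nra.
Qed.

Let q1_upper r : k <= r -> q1 r <= 6 / k.
Proof.
  intros Hr. unfold q1.
  assert (A1 : - (2 * nu / r ^ 2) <= 2 / k).
  { replace (- (2 * nu / r ^ 2)) with ((-2 * nu) / r ^ 2) by (field; lra).
    apply Rle_div_l; [nra|]. replace (2 / k * r ^ 2) with (2 * (r ^ 2 / k)) by (field; lra).
    assert (1 <= r ^ 2 / k) by (apply Rle_div_r; nra). nra. }
  assert (A2 : 2 * (g ^ 2 + g) / r ^ 3 <= 4 / k).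
  { apply Rle_div_l; [apply pow_lt; lra|].
    assert (k ^ 3 <= r ^ 3) by (apply pow_incr; lra).
    apply Rle_trans with (4 / k * k ^ 3).
    - replace (4 / k * k ^ 3) with (4 * k ^ 2) by (field; lra). nra.
    - apply Rmult_le_compat_l; [|auto]. apply Rdiv_le_0_compat; lra. }
  replace (6 / k) with (2 / k + 4 / k) by (field; lra). lra.
Qed.

(** Concavity of the potential; together with q' >= 0 it makes beta decrease. *)
Let q2_nonpos r : 0 < r <= 2 * k -> q2 r <= 0.
Proof.
  intros Hr. unfold q2.
  replace (_ - _) with (- ((6 * (g ^ 2 + g) - 4 * nu * r) * / r ^ 4)) by (field; lra).
  enough (0 <= (6 * (g ^ 2 + g) - 4 * nu * r) * / r ^ 4) by lra.
  apply Rmult_le_pos; [|left; apply Rinv_0_lt_compat, pow_lt; lra].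
  nra.
Qed.

Let q_2k : 1 / 2 <= q (2 * k) <= 2.
Proof. apply (coulomb_potential_far nu g k); try lra; auto. Qed.

Lemma wave_at_2k : Q (2 * k) ^ 2 <= 2 * E /\ Q1 (2 * k) ^ 2 <= E /\ 0 <= E.
Proof.
  unfold wave_energy in HE.
  nra.
Qed.

Let q_oscillating r : k + 9 * m <= r <= 2 * k -> (r - k) / (4 * k) <= q r <= 2.
Proof.
  intros Hr. rewrite coulomb_potential_turning by lra.
  assert (0 < r ^ 2) by (apply pow_lt; lra).
  split.
  - apply (Rle_div_r _ _ (r ^ 2)); [auto|].
    apply Rle_trans with ((r - k) / (4 * k) * (2 * k) ^ 2).
    + apply Rmult_le_compat_l; [apply Rdiv_le_0_compat; lra|nra].
    + replace ((r - k) / (4 * k) * (2 * k) ^ 2) with (k * (r - k)) by (field; lra). nra.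
  - apply Rle_div_l; [auto|]. nra.
Qed.

(** * The oscillating region, k + 9m <= r <= 2k *)

Let p r := sqrt (q r).

Let p_pos r : k + 9 * m <= r <= 2 * k -> 0 < p r /\ p r * p r = q r.
Proof.
  intros Hr. destruct (q_oscillating r Hr) as [A _].
  assert (0 < (r - k) / (4 * k)) by (apply Rdiv_lt_0_compat; lra).
  unfold p. split; [apply sqrt_lt_R0; lra|apply sqrt_sqrt; lra].
Qed.

Let p_lower r : k + 9 * m <= r <= 2 * k -> 3 / 2 / m <= p r.
Proof.
  intros Hr. destruct (p_pos r Hr) as [A1 A2]. destruct (q_oscillating r Hr) as [A3 _].
  assert (A4 : 9 / 4 / m ^ 2 <= q r).
  { eapply Rle_trans; [|exact A3].
    apply (Rle_div_r (9 / 4 / m ^ 2) (r - k) (4 * k)); [lra|]. rewrite Hmk at 1.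
    replace (9 / 4 / m ^ 2 * (4 * m ^ 3)) with (9 * m) by (field; lra). lra. }
  replace (9 / 4 / m ^ 2) with ((3 / 2 / m) * (3 / 2 / m)) in A4 by (field; lra).
  nra.
Qed.

Let dp r : k + 9 * m <= r <= 2 * k -> is_derive p r (q1 r / (2 * p r)).
Proof.
  intros Hr. destruct (p_pos r Hr) as [A1 A2]. assert (D := dq r ltac:(lra)).
  assert (Hq : 0 < q r) by nra.
  unfold p. auto_derive; [split; [eexists; exact D|auto]|].
  rewrite_derives.
  fold (p r). field. lra.
Qed.

Let be r := q1 r / (2 * p r ^ 3).
Let be1 r := q2 r / (2 * p r ^ 3) - 3 * q1 r ^ 2 / (4 * p r ^ 5).

Let dbe r : k + 9 * m <= r <= 2 * k -> is_derive be r (be1 r).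
Proof.
  intros Hr. destruct (p_pos r Hr) as [A1 A2]. assert (D := dp r Hr).
  assert (D1 := dq1 r ltac:(lra)).
  unfold be. auto_derive.
  - split; [eexists; exact D1|]. split; [eexists; exact D|]. split; [|auto].
    assert (0 < p r ^ 3) by (apply pow_lt; auto). simpl in *; lra.
  - rewrite_derives.
    unfold be1. field. lra.
Qed.

Let be1_nonpos r : k + 9 * m <= r <= 2 * k -> be1 r <= 0.
Proof.
  intros Hr. destruct (p_pos r Hr) as [A1 A2]. assert (A3 := q2_nonpos r ltac:(lra)).
  unfold be1.
  assert (0 <= - q2 r / (2 * p r ^ 3)).
  { apply Rdiv_le_0_compat; [lra|]. assert (0 < p r ^ 3) by (apply pow_lt; auto). lra. }
  assert (0 <= 3 * q1 r ^ 2 / (4 * p r ^ 5)).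
  { apply Rdiv_le_0_compat; [pose proof (pow2_ge_0 (q1 r)); lra|].
    assert (0 < p r ^ 5) by (apply pow_lt; auto). lra. }
  replace (- q2 r / (2 * p r ^ 3)) with (- (q2 r / (2 * p r ^ 3))) in H by (field; lra).
  lra.
Qed.

(** The width 9m is tuned for this: q >= 9/(4 m^2) gives p^3 >= 27/(8k), and q' <= 6/k, so beta <=
    8/9. *)
Let be_range r : k + 9 * m <= r <= 2 * k -> 0 <= be r <= 1.
Proof.
  intros Hr. destruct (p_pos r Hr) as [A1 A2]. assert (A3 := q1_nonneg r ltac:(lra)).
  assert (A4 := q1_upper r ltac:(lra)).
  assert (H3 : (3 / 2 / m) ^ 3 <= p r ^ 3).
  { apply pow_incr. split; [apply Rdiv_le_0_compat; lra|auto]. }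
  assert (H0 : 0 < p r ^ 3) by (apply pow_lt; auto).
  unfold be. split.
  - apply Rdiv_le_0_compat; lra.
  - apply Rle_div_l; [lra|].
    replace ((3 / 2 / m) ^ 3) with (27 / 8 * (1 / k)) in H3 by (rewrite Hmk; field; lra).
    replace (6 / k) with (6 * (1 / k)) in A4 by (field; lra).
    lra.
Qed.

(* R = sqrt q Q^2 + Q'^2 / sqrt q + beta Q Q' with beta = q'/(2 q^(3/2)) satisfies
   R' = beta' Q Q'; as beta decreases and 0 <= beta <= 1, R e^(-beta) increases. *)
Lemma wkb_bound (r : R) : k + 9 * m <= r <= 2 * k ->
  p r * Q r ^ 2 + Q1 r ^ 2 / p r <= 54 * E.
Proof.
  intros Hr.
  set (S := fun r => p r * Q r ^ 2 + Q1 r ^ 2 / p r).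
  set (W := fun r => S r + be r * (Q r * Q1 r)).
  assert (SQ : forall t, k + 9 * m <= t <= 2 * k -> 2 * Rabs (Q t * Q1 t) <= S t).
  { intros t Ht. destruct (p_pos t Ht) as [A1 A2]. unfold S.
    replace (p t * Q t ^ 2 + Q1 t ^ 2 / p t) with ((p t * Q t) ^ 2 / p t + Q1 t ^ 2 / p t) by (field; lra).
    replace (_ / _ + _ / _) with (((p t * Q t) ^ 2 + Q1 t ^ 2) / p t) by (field; lra).
    apply (Rle_div_r _ _ (p t)); auto.
    replace (2 * Rabs (Q t * Q1 t) * p t) with (2 * Rabs (p t * Q t * Q1 t)).
    2:{ rewrite !Rabs_mult, (Rabs_pos_eq (p t)) by lra. ring. }
    pose proof (pow2_ge_0 (p t * Q t - Q1 t)). pose proof (pow2_ge_0 (p t * Q t + Q1 t)).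
    assert (Rabs (p t * Q t * Q1 t) <= ((p t * Q t) ^ 2 + Q1 t ^ 2) / 2) by (apply Rabs_le; lra).
    lra. }
  assert (SW : forall t, k + 9 * m <= t <= 2 * k -> S t / 2 <= W t <= 3 / 2 * S t).
  { intros t Ht. specialize (SQ t Ht). destruct (be_range t Ht) as [B1 B2].
    assert (Rabs (be t * (Q t * Q1 t)) <= S t / 2).
    { rewrite Rabs_mult, (Rabs_pos_eq (be t)) by auto. pose proof (Rabs_pos (Q t * Q1 t)). nra. }
    apply Rabs_le_between in H. unfold W. lra. }
  (* The derivative is -beta' (W - Q Q') e^(-beta), nonnegative because W >= S/2 >= |Q Q'|. *)
  assert (Hmono : W r * exp (- be r) <= W (2 * k) * exp (- be (2 * k))).
  { apply (derive_nonneg_le (fun t => W t * exp (- be t))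
      (fun t => - be1 t * (W t - Q t * Q1 t) * exp (- be t))); [lra| |].
    - intros t Ht. destruct (p_pos t ltac:(lra)) as [A1 A2].
      assert (D1 := wave_dQ _ _ _ _ HQ t ltac:(lra)). assert (D2 := wave_dQ1 _ _ _ _ HQ t ltac:(lra)).
      assert (D3 := dp t ltac:(lra)). assert (D4 := dbe t ltac:(lra)).
      unfold W, S. auto_derive.
      + repeat split; try (eexists; eassumption). lra.
      + rewrite_derives.
        rewrite <- A2. unfold be at 1 2 3. fold (be t). set (b := exp (- be t)).
        clearbody b. field_simplify; [|lra|lra]. unfold be. field. lra.
    - intros t Ht. assert (A := SQ t ltac:(lra)). assert (A' := SW t ltac:(lra)).
      assert (A'' := be1_nonpos t ltac:(lra)). pose proof (Rle_abs (Q t * Q1 t)).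
      apply Rmult_le_pos; [|left; apply exp_pos]. apply Rmult_le_pos; lra. }
  assert (A := SW r Hr). assert (A' := SW (2 * k) ltac:(lra)).
  assert (B1 := be_range r Hr). assert (B2 := be_range (2 * k) ltac:(lra)).
  destruct wave_at_2k as [E1 [E2 E3]].
  destruct (p_pos (2 * k) ltac:(lra)) as [P1 P2].
  assert (S2k : S (2 * k) <= 6 * E).
  { unfold S.
    assert (Q1 (2 * k) ^ 2 / p (2 * k) <= 2 * E) by (apply Rle_div_l; nra).
    nra. }
  assert (X1 : exp (- be (2 * k)) <= 1) by (rewrite <- exp_0; apply exp_le_exp; lra).
  assert (X2 : exp (- (1)) <= exp (- be r)) by (apply exp_le_exp; lra).
  assert (X3 : exp 1 * exp (- (1)) = 1) by (rewrite <- exp_plus, Rplus_opp_r; apply exp_0).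
  assert (X4 := exp_le_3). pose proof (exp_pos (- (1))).
  assert (1 <= 3 * exp (- (1))) by nra.
  (* W(r) <= e W(2k) with e <= 3, W(2k) <= (3/2) S(2k) and S(2k) <= 6E; finally S <= 2W. *)
  assert (W r <= 27 * E) by nra.
  fold (S r). lra.
Qed.

(** Squaring the previous bound, q Q^4 and Q'^4 / q are at most (54 E)^2, and (r - k)/(4k) <= q <=
    2. *)
Lemma oscillating_bound (r : R) : k + 9 * m <= r <= 2 * k ->
  Q r ^ 4 * (r - k) <= 4 * 54 ^ 2 * k * E ^ 2 /\ Q1 r ^ 4 <= 2 * 54 ^ 2 * E ^ 2.
Proof.
  intros Hr. assert (W := wkb_bound r Hr). destruct (p_pos r Hr) as [P1 P2].
  destruct (q_oscillating r Hr) as [A1 A2].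
  pose proof (pow2_ge_0 (Q r)) as S1. pose proof (pow2_ge_0 (Q1 r)) as S2.
  destruct wave_at_2k as [_ [_ E3]].
  assert (I1 : 0 <= Q1 r ^ 2 / p r) by (apply Rdiv_le_0_compat; auto).
  assert (I2 : 0 <= p r * Q r ^ 2) by (apply Rmult_le_pos; lra).
  split.
  - assert (A3 : (p r * Q r ^ 2) ^ 2 <= (54 * E) ^ 2) by (apply pow_incr; lra).
    replace ((p r * Q r ^ 2) ^ 2) with (p r * p r * Q r ^ 4) in A3 by ring.
    rewrite P2 in A3.
    assert (0 <= Q r ^ 4) by (replace (Q r ^ 4) with ((Q r ^ 2) ^ 2) by ring; apply pow2_ge_0).
    assert (A4 : (r - k) / (4 * k) * Q r ^ 4 <= (54 * E) ^ 2) by nra.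
    replace (Q r ^ 4 * (r - k)) with ((r - k) / (4 * k) * Q r ^ 4 * (4 * k)) by (field; lra).
    replace (4 * 54 ^ 2 * k * E ^ 2) with ((54 * E) ^ 2 * (4 * k)) by ring.
    apply Rmult_le_compat_r; lra.
  - assert (A3 : Q1 r ^ 2 <= 54 * E * p r) by (apply Rle_div_l; lra).
    assert (A4 : (Q1 r ^ 2) ^ 2 <= (54 * E * p r) ^ 2) by (apply pow_incr; lra).
    replace ((Q1 r ^ 2) ^ 2) with (Q1 r ^ 4) in A4 by ring.
    replace ((54 * E * p r) ^ 2) with ((54 * E) ^ 2 * (p r * p r)) in A4 by ring.
    rewrite P2 in A4. nra.
Qed.

(** * The turning point region, |r - k| <= 9m *)

Let q_transition r : k - 9 * m <= r <= k + 9 * m -> Rabs (q r) <= 56 / m ^ 2.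
Proof.
  intros Hr. rewrite coulomb_potential_turning by lra.
  set (y := r + nu - k). replace (r + nu) with (k + y) by (unfold y; ring).
  assert (Hy : - (10 * m) <= y <= 10 * m) by (unfold y; lra).
  (* The product contributes at most 10m times 3k and g at most k. With r >= 3k/4 and k = m^3, 31 m
     k / r^2 stays below 56/m^2. *)
  assert (N : Rabs ((k + y) ^ 2 - k ^ 2 - g) <= 31 * m * k).
  { replace ((k + y) ^ 2 - k ^ 2 - g) with (y * (2 * k + y) - g) by ring.
    assert (Rabs y <= 10 * m) by (apply Rabs_le; lra).
    assert (0 <= 2 * k + y <= 3 * k) by lra.
    assert (Rabs (y * (2 * k + y)) <= 10 * m * (3 * k)).
    { rewrite Rabs_mult, (Rabs_pos_eq (2 * k + y)) by lra.
      apply Rmult_le_compat; try lra. apply Rabs_pos. }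
    apply Rabs_le_between in H1. apply Rabs_le. nra. }
  unfold Rdiv. rewrite Rabs_mult, (Rabs_pos_eq (/ r ^ 2)).
  2:{ left; apply Rinv_0_lt_compat, pow_lt; lra. }
  fold (Rdiv (Rabs ((k + y) ^ 2 - k ^ 2 - g)) (r ^ 2)).
  apply Rle_div_l; [apply pow_lt; lra|].
  eapply Rle_trans; [exact N|].
  assert ((3 / 4 * k) ^ 2 <= r ^ 2) by (apply pow_incr; lra).
  apply Rle_trans with (56 * / m ^ 2 * (3 / 4 * k) ^ 2).
  - rewrite Hmk. replace (56 * / m ^ 2 * (3 / 4 * m ^ 3) ^ 2) with (63 / 2 * m * m ^ 3) by (field; lra).
    nra.
  - apply Rmult_le_compat_l; [|auto]. apply Rmult_le_pos; [lra|].
    left; apply Rinv_0_lt_compat, pow_lt; lra.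
Qed.

(** 360 bounds the scaled energy at the outer edge in units of E; 1026 is the Gronwall rate 57/m
    times the length 18m. *)
Definition transition_const : R := 360 * exp 1026.

(** Gronwall's inequality for Q^2/m + m Q'^2: at length scale m both terms have equal weight, and
    |q| <= 56/m^2 makes the rate at most (1 + 56)/m. *)
Lemma transition_bound (r : R) : k - 9 * m <= r <= k + 9 * m ->
  Q r ^ 2 <= transition_const * m * E /\ Q1 r ^ 2 <= transition_const * E / m.
Proof.
  intros Hr. set (T := fun r => Q r ^ 2 / m + m * Q1 r ^ 2).
  destruct wave_at_2k as [_ [_ E3]].
  set (r1 := k + 9 * m).
  assert (T1 : T r1 <= 360 * E).
  { assert (W := wkb_bound r1 ltac:(unfold r1; lra)).
    destruct (p_pos r1 ltac:(unfold r1; lra)) as [P1 P2].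
    assert (P3 := p_lower r1 ltac:(unfold r1; lra)).
    pose proof (pow2_ge_0 (Q r1)) as S1. pose proof (pow2_ge_0 (Q1 r1)) as S2.
    assert (M1 : 3 / 2 <= p r1 * m) by (apply Rle_div_l in P3; lra).
    unfold T.
    set (a := p r1 * Q r1 ^ 2) in *. set (b := Q1 r1 ^ 2 / p r1) in *.
    assert (0 <= a) by (apply Rmult_le_pos; lra).
    assert (0 <= b) by (apply Rdiv_le_0_compat; lra).
    replace (Q r1 ^ 2 / m) with (a * / (p r1 * m)) by (unfold a; field; lra).
    replace (m * Q1 r1 ^ 2) with (b * (p r1 * m)) by (unfold b; field; lra).
    assert (/ (p r1 * m) <= 2 / 3).
    { replace (2 / 3) with (/ (3 / 2)) by field. apply Rinv_le_contravar; lra. }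
    assert (a * / (p r1 * m) <= a * (2 / 3)) by (apply Rmult_le_compat_l; lra).
    (* At the edge 3/2 <= p m <= 6, so the scaled energy is at most 6 (a + b), and a + b <= 54 E. *)
    enough (b * (p r1 * m) <= b * 6) by lra.
    apply Rmult_le_compat_l; [auto|].
    assert (A : q r1 <= 36 / m ^ 2).
    { rewrite coulomb_potential_turning by (unfold r1; lra).
      apply Rle_div_l; [unfold r1; nra|].
      apply Rle_trans with (36 / m ^ 2 * k ^ 2).
      - replace (36 / m ^ 2 * k ^ 2) with (36 * m * k) by (rewrite Hmk; field; lra).
        unfold r1.
        assert ((9 * m + nu) * (2 * k + (9 * m + nu)) <= 55 / 6 * m * (3 * k))
          by (apply Rmult_le_compat; lra).
        assert (0 < m * k) by nra. lra.
      - apply Rmult_le_compat_l; [apply Rdiv_le_0_compat; nra|]. apply pow_incr. unfold r1; lra. }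
    rewrite <- P2 in A.
    assert (A' : (p r1 * m) ^ 2 <= 36).
    { apply Rle_div_r in A; [|nra]. nra. }
    nra. }
  assert (Hmono : T r * exp (57 / m * r) <= T r1 * exp (57 / m * r1)).
  { apply (derive_nonneg_le (fun t => T t * exp (57 / m * t))
      (fun t => (2 * Q t * Q1 t / m + 2 * m * Q1 t * (- q t * Q t) + 57 / m * T t) * exp (57 / m * t)));
      [unfold r1; lra| |].
    - intros t Ht.
      assert (D1 := wave_dQ _ _ _ _ HQ t ltac:(lra)). assert (D2 := wave_dQ1 _ _ _ _ HQ t ltac:(lra)).
      unfold T. auto_derive.
      + repeat split; eexists; eassumption.
      + rewrite_derives.
        field. lra.
    - intros t Ht. apply Rmult_le_pos; [|left; apply exp_pos].
      assert (A := q_transition t ltac:(unfold r1 in *; lra)).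
      assert (TT : 2 * Rabs (Q t * Q1 t) <= T t).
      { unfold T. replace (Q t ^ 2 / m + m * Q1 t ^ 2) with ((Q t ^ 2 + (m * Q1 t) ^ 2) / m) by (field; lra).
        apply (Rle_div_r _ _ m); [lra|].
        replace (2 * Rabs (Q t * Q1 t) * m) with (2 * Rabs (Q t * (m * Q1 t))).
        2:{ rewrite !Rabs_mult, (Rabs_pos_eq m) by lra. ring. }
        pose proof (pow2_ge_0 (Q t - m * Q1 t)). pose proof (pow2_ge_0 (Q t + m * Q1 t)).
        assert (Rabs (Q t * (m * Q1 t)) <= (Q t ^ 2 + (m * Q1 t) ^ 2) / 2) by (apply Rabs_le; lra).
        lra. }
      set (x := Q t * Q1 t) in *.
      replace (2 * Q t * Q1 t / m + 2 * m * Q1 t * (- q t * Q t) + 57 / m * T t) with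
        ((2 * x * (1 - m ^ 2 * q t) + 57 * T t) / m) by (unfold x; field; lra).
      apply Rdiv_le_0_compat; [|lra].
      assert (A' : Rabs (1 - m ^ 2 * q t) <= 57).
      { apply Rabs_le_between in A. destruct A as [A1 A2].
        assert (m ^ 2 * q t <= 56).
        { apply (Rmult_le_compat_l (m ^ 2)) in A2; [|nra].
          replace (m ^ 2 * (56 / m ^ 2)) with 56 in A2 by (field; lra). lra. }
        assert (-56 <= m ^ 2 * q t).
        { apply (Rmult_le_compat_l (m ^ 2)) in A1; [|nra].
          replace (m ^ 2 * - (56 / m ^ 2)) with (-56) in A1 by (field; lra). lra. }
        apply Rabs_le. lra. }
      assert (Rabs (2 * x * (1 - m ^ 2 * q t)) <= 57 * T t).
      { rewrite !Rabs_mult, (Rabs_pos_eq 2) by lra.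
        pose proof (Rabs_pos x). pose proof (Rabs_pos (1 - m ^ 2 * q t)).
        rewrite (Rmult_comm 57). apply Rmult_le_compat; lra. }
      apply Rabs_le_between in H. lra. }
  assert (Hexp : exp (57 / m * r1) <= exp 1026 * exp (57 / m * r)).
  { rewrite <- exp_plus. apply exp_le_exp.
    replace 1026 with (57 / m * (18 * m)) by (field; lra). rewrite <- Rmult_plus_distr_l.
    apply Rmult_le_compat_l; [apply Rdiv_le_0_compat; lra|unfold r1; lra]. }
  assert (T0 : forall t, 0 <= T t).
  { intros t. unfold T. pose proof (pow2_ge_0 (Q t)).
    assert (0 <= Q t ^ 2 / m) by (apply Rdiv_le_0_compat; lra). nra. }
  assert (HT : T r <= transition_const * E).
  { pose proof (exp_pos (57 / m * r)) as Hp.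
    apply (Rmult_le_reg_r (exp (57 / m * r))); auto.
    eapply Rle_trans; [exact Hmono|]. unfold transition_const.
    apply Rle_trans with (360 * E * (exp 1026 * exp (57 / m * r))).
    - apply Rmult_le_compat; auto. left; apply exp_pos.
    - right. ring. }
  unfold T in HT. pose proof (pow2_ge_0 (Q r)). pose proof (pow2_ge_0 (Q1 r)).
  assert (0 <= Q r ^ 2 / m) by (apply Rdiv_le_0_compat; lra).
  assert (0 <= m * Q1 r ^ 2) by (apply Rmult_le_pos; lra).
  split.
  - replace (transition_const * m * E) with (transition_const * E * m) by ring.
    apply Rle_div_l; lra.
  - apply (Rle_div_r _ _ m); lra.
Qed.

(** * The forbidden region below the turning point *)

Let energy_nonneg r : 0 < r <= 2 * k -> 0 <= wave_energy nu g Q Q1 r.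
Proof.
  intros Hr.
  apply (filterlim_Rle (F:=at_right 0) (wave_energy nu g Q Q1) (fun _ => wave_energy nu g Q Q1 r));
    [| |apply filterlim_const].
  - apply (at_right0_pos _ r); [lra|]. intros t Ht.
    apply (derive_nonneg_le _ (fun x => q1 x * Q x ^ 2)); [lra| |].
    + intros x Hx. apply wave_energy_derive; auto. lra.
    + intros x Hx. apply Rmult_le_pos; [apply q1_nonneg; lra|apply pow2_ge_0].
  (* The potential blows up like r^-2, but Q = O(r^2) and Q' = O(r), so the energy is O(r^2). *)
  - apply (lim0_dominated _ (B ^ 2 * (4 + k ^ 2 + k))). intros t Ht.
    assert (S1 : Q1 t ^ 2 <= (B * t) ^ 2).
    { rewrite <- (pow2_abs (Q1 t)). apply pow_incr. split; [apply Rabs_pos|auto]. }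
    assert (S0 : Q t ^ 2 <= (B * t ^ 2) ^ 2).
    { rewrite <- (pow2_abs (Q t)). apply pow_incr. split; [apply Rabs_pos|auto]. }
    pose proof (pow2_ge_0 (Q1 t)). pose proof (pow2_ge_0 (Q t)).
    unfold wave_energy, coulomb_potential.
    set (z := Q t ^ 2 / t ^ 2).
    assert (Ht2 : 0 < t ^ 2) by (apply pow_lt; lra).
    assert (Z0 : 0 <= z) by (apply Rdiv_le_0_compat; auto).
    assert (Z1 : z <= B ^ 2 * t ^ 2) by (apply Rle_div_l; [auto|]; nra).
    replace (Q1 t ^ 2 + (1 + 2 * nu / t - (g ^ 2 + g) / t ^ 2) * Q t ^ 2) with
      (Q1 t ^ 2 + (t ^ 2 + 2 * nu * t - (g ^ 2 + g)) * z) by (unfold z; field; lra).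
    assert (W : Rabs (t ^ 2 + 2 * nu * t - (g ^ 2 + g)) <= 3 + k ^ 2 + k).
    { apply Rabs_le. nra. }
    assert (W' : Rabs ((t ^ 2 + 2 * nu * t - (g ^ 2 + g)) * z) <= (3 + k ^ 2 + k) * (B ^ 2 * t ^ 2)).
    { rewrite Rabs_mult, (Rabs_pos_eq z) by auto. apply Rmult_le_compat; auto. apply Rabs_pos. }
    eapply Rle_trans; [apply Rabs_triang|]. rewrite (Rabs_pos_eq (Q1 t ^ 2)) by auto.
    apply Rle_trans with ((B * t) ^ 2 + (3 + k ^ 2 + k) * (B ^ 2 * t ^ 2)); [lra|].
    replace ((B * t) ^ 2 + (3 + k ^ 2 + k) * (B ^ 2 * t ^ 2)) with
      (B ^ 2 * (4 + k ^ 2 + k) * (t * t)) by ring.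
    apply Rmult_le_compat_l; [|nra]. apply Rmult_le_pos; [apply pow2_ge_0|nra].
Qed.

Let q_forbidden r : 0 < r <= k - 1 -> q r <= 0.
Proof.
  intros Hr. rewrite coulomb_potential_turning by lra.
  apply Rle_div_l; [apply pow_lt; lra|]. nra.
Qed.

Let dQQ1 r : 0 < r -> is_derive (fun r => Q r * Q1 r) r (Q1 r ^ 2 - q r * Q r ^ 2).
Proof.
  intros Hr. assert (D1 := wave_dQ _ _ _ _ HQ r Hr). assert (D2 := wave_dQ1 _ _ _ _ HQ r Hr).
  auto_derive; [repeat split; eexists; eassumption|].
  rewrite_derives.
  ring.
Qed.

Let dQ2 r : 0 < r -> is_derive (fun r => Q r ^ 2) r (2 * (Q r * Q1 r)).
Proof.
  intros Hr. assert (D1 := wave_dQ _ _ _ _ HQ r Hr).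
  auto_derive; [repeat split; eexists; eassumption|].
  rewrite_derives.
  ring.
Qed.

(** (Q Q')' = Q'^2 - q Q^2 >= 0 where q <= 0, and Q Q' vanishes at 0. Hence Q^2 and Q'^2 both grow
    with r. *)
Let QQ1_nonneg r : 0 < r <= k - 1 -> 0 <= Q r * Q1 r.
Proof.
  intros Hr.
  apply (filterlim_Rle (F:=at_right 0) (fun r => Q r * Q1 r) (fun _ => Q r * Q1 r));
    [| |apply filterlim_const].
  - apply (at_right0_pos _ r); [lra|]. intros t Ht.
    apply (derive_nonneg_le (fun r => Q r * Q1 r) (fun x => Q1 x ^ 2 - q x * Q x ^ 2)); [lra| |].
    + intros x Hx. apply dQQ1. lra.
    + intros x Hx. assert (A := q_forbidden x ltac:(lra)).
      nra.
  - apply (lim0_dominated _ (B ^ 2)). intros t Ht.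
    rewrite Rabs_mult. apply Rle_trans with (B * t ^ 2 * (B * t)).
    + apply Rmult_le_compat; auto; apply Rabs_pos.
    + replace (B * t ^ 2 * (B * t)) with (B ^ 2 * (t ^ 3)) by ring.
      apply Rmult_le_compat_l; [apply pow2_ge_0|]. simpl. nra.
Qed.

Lemma forbidden_derivative_sq_monotone (r s : R) : 0 < r <= s -> s <= k - 1 -> Q1 r ^ 2 <= Q1 s ^ 2.
Proof.
  intros Hr Hs.
  apply (derive_nonneg_le (fun r => Q1 r ^ 2) (fun x => 2 * Q1 x * (- q x * Q x))); [lra| |].
  - intros x Hx. assert (D2 := wave_dQ1 _ _ _ _ HQ x ltac:(lra)).
    auto_derive; [repeat split; eexists; eassumption|].
    rewrite_derives.
    ring.
  - intros x Hx. assert (A := q_forbidden x ltac:(lra)). assert (A' := QQ1_nonneg x ltac:(lra)). nra.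
Qed.

Lemma forbidden_sq_monotone (r s : R) : 0 < r <= s -> s <= k - 1 -> Q r ^ 2 <= Q s ^ 2.
Proof.
  intros Hr Hs.
  apply (derive_nonneg_le (fun r => Q r ^ 2) (fun x => 2 * (Q x * Q1 x))); [lra| |].
  - intros x Hx. apply dQ2. lra.
  - intros x Hx. assert (A' := QQ1_nonneg x ltac:(lra)). lra.
Qed.

Let q_lower r : k / 2 <= r <= k - 9 * m -> (k - r) / k <= - q r.
Proof.
  intros Hr. rewrite coulomb_potential_turning by lra.
  assert (Hr2 : 0 < r ^ 2) by (apply pow_lt; lra).
  replace (- (((r + nu) ^ 2 - k ^ 2 - g) / r ^ 2)) with ((k ^ 2 + g - (r + nu) ^ 2) / r ^ 2) by (field; lra).
  apply (Rle_div_r _ _ (r ^ 2)); [auto|].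
  apply Rle_trans with ((k - r) / k * k ^ 2).
  - apply Rmult_le_compat_l; [apply Rdiv_le_0_compat; lra|nra].
  - replace ((k - r) / k * k ^ 2) with (k * (k - r)) by (field; lra). nra.
Qed.

Let growth r : k / 2 <= r <= k - 9 * m -> (k - r) / k * Q r ^ 2 <= Q1 r ^ 2.
Proof.
  intros Hr. assert (A := energy_nonneg r ltac:(lra)). assert (A' := q_lower r Hr).
  unfold wave_energy in A. nra.
Qed.

(** [growth] gives |Q| <= c |Q'|, and Q, Q' have the same sign; the logarithmic derivative of Q is
    then at least 1/c. *)
Let QQ1_lower r c : k / 2 <= r <= k - 9 * m -> 0 < c -> k <= c ^ 2 * (k - r) ->
  Q r ^ 2 <= c * (Q r * Q1 r).
Proof.
  intros Hr Hc Hcr. assert (A' := QQ1_nonneg r ltac:(lra)).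
  pose proof (pow2_ge_0 (Q r)).
  assert (A2 : Q r ^ 2 <= c ^ 2 * Q1 r ^ 2).
  { apply Rle_trans with (c ^ 2 * ((k - r) / k * Q r ^ 2)).
    - replace (c ^ 2 * ((k - r) / k * Q r ^ 2)) with (c ^ 2 * (k - r) / k * Q r ^ 2) by (field; lra).
      rewrite <- (Rmult_1_l (Q r ^ 2)) at 1. apply Rmult_le_compat_r; auto.
      apply (Rle_div_r 1 _ k); lra.
    - apply Rmult_le_compat_l; [apply pow2_ge_0|auto]. }
  apply Rsqr_incr_0; unfold Rsqr; nra.
Qed.

(** Q^4 (k - r) increases, because Q^2 <= 4 (k - r) Q Q' as soon as 16 (k - r)^3 >= k. Its value at
    k - 9m is known from the turning point region. *)
Lemma forbidden_bound (r : R) : k / 2 <= r <= k - 9 * m ->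
  Q r ^ 4 * (k - r) <= 9 * transition_const ^ 2 * k * E ^ 2 /\
  Q1 r ^ 2 <= transition_const * E.
Proof.
  intros Hr. set (r2 := k - 9 * m).
  destruct (transition_bound r2 ltac:(unfold r2; lra)) as [T1 T2].
  destruct wave_at_2k as [_ [_ E3]].
  assert (HC : 0 < transition_const) by (unfold transition_const; pose proof (exp_pos 1026); lra).
  split.
  - assert (M : Q r ^ 4 * (k - r) <= Q r2 ^ 4 * (k - r2)).
    { apply (derive_nonneg_le (fun r => Q r ^ 4 * (k - r))
        (fun x => Q x ^ 2 * (4 * (k - x) * (Q x * Q1 x) - Q x ^ 2))); [unfold r2; lra| |].
      - intros x Hx. assert (D1 := wave_dQ _ _ _ _ HQ x ltac:(lra)).
        auto_derive; [repeat split; eexists; eassumption|].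
        rewrite_derives.
        ring.
      - intros x Hx. apply Rmult_le_pos; [apply pow2_ge_0|].
        unfold r2 in Hx.
        assert (Q x ^ 2 <= 4 * (k - x) * (Q x * Q1 x)); [|lra].
        apply QQ1_lower; [lra|lra|].
        rewrite Hmk at 1.
        assert (Hy : 9 * m <= k - x) by lra. set (y := k - x) in *.
        replace ((4 * y) ^ 2 * y) with (16 * y ^ 3) by ring.
        assert ((9 * m) ^ 3 <= y ^ 3) by (apply pow_incr; lra).
        replace ((9 * m) ^ 3) with (729 * m ^ 3) in H by ring.
        lra. }
    eapply Rle_trans; [exact M|].
    replace (Q r2 ^ 4) with ((Q r2 ^ 2) ^ 2) by ring. replace (k - r2) with (9 * m) by (unfold r2; ring).
    assert ((Q r2 ^ 2) ^ 2 <= (transition_const * m * E) ^ 2).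
    { apply pow_incr. split; [apply pow2_ge_0|auto]. }
    rewrite Hmk.
    replace (9 * transition_const ^ 2 * m ^ 3 * E ^ 2) with ((transition_const * m * E) ^ 2 * (9 * m)) by ring.
    apply Rmult_le_compat_r; lra.
  - eapply Rle_trans; [apply (forbidden_derivative_sq_monotone r r2); unfold r2; lra|].
    eapply Rle_trans; [exact T2|].
    apply (Rle_div_l _ _ m); [lra|]. nra.
Qed.

(** Q is bounded at 3k/4; going down to 5k/8 gains e^(-k/8), since Q^2 e^(-r) increases; Q' at k/2
    is recovered from Q at 5k/8, and monotonicity extends both bounds to smaller r. The last bound
    is again the positivity of the energy and saves g Q/r from the division by r. *)
Lemma forbidden_decay (r : R) : 0 < r <= k / 2 ->
  Q r ^ 2 <= 6 * transition_const * E * exp (- (k / 8)) /\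
  Q1 r ^ 2 <= 6 * transition_const * E * exp (- (k / 8)) /\
  (g * Q r / r) ^ 2 <= 2 * Q1 r ^ 2.
Proof.
  intros Hr. destruct wave_at_2k as [_ [_ E3]].
  assert (HC : 0 < transition_const) by (unfold transition_const; pose proof (exp_pos 1026); lra).
  assert (HCE : 0 <= transition_const * E) by (apply Rmult_le_pos; lra).
  assert (F0 : Q (3 / 4 * k) ^ 2 <= 6 * transition_const * E).
  { destruct (forbidden_bound (3 / 4 * k) ltac:(lra)) as [A _].
    replace (k - 3 / 4 * k) with (k / 4) in A by field.
    apply Rsqr_incr_0; [|apply pow2_ge_0|lra]. unfold Rsqr.
    apply (Rmult_le_reg_r (k / 4)); [lra|].
    replace (Q (3 / 4 * k) ^ 2 * Q (3 / 4 * k) ^ 2 * (k / 4)) with (Q (3 / 4 * k) ^ 4 * (k / 4)) by ring.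
    eapply Rle_trans; [exact A|]. right. field. }
  assert (F1 : Q (5 / 8 * k) ^ 2 <= 6 * transition_const * E * exp (- (k / 8))).
  { assert (M : Q (5 / 8 * k) ^ 2 * exp (- (5 / 8 * k)) <= Q (3 / 4 * k) ^ 2 * exp (- (3 / 4 * k))).
    { apply (derive_nonneg_le (fun x => Q x ^ 2 * exp (- x))
        (fun x => (2 * (Q x * Q1 x) - Q x ^ 2) * exp (- x))); [lra| |].
      - intros x Hx. assert (D1 := wave_dQ _ _ _ _ HQ x ltac:(lra)).
        auto_derive; [repeat split; eexists; eassumption|].
        rewrite_derives.
        ring.
      - intros x Hx. apply Rmult_le_pos; [|left; apply exp_pos].
        (* For r <= 3k/4, k <= c^2 (k - r) holds with c = 2. *)
        enough (Q x ^ 2 <= 2 * (Q x * Q1 x)) by lra. apply QQ1_lower; lra. }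
    replace (- (3 / 4 * k)) with (- (k / 8) + - (5 / 8 * k)) in M by field.
    rewrite exp_plus in M. pose proof (exp_pos (- (5 / 8 * k))). pose proof (exp_pos (- (k / 8))).
    rewrite <- Rmult_assoc in M. apply Rmult_le_reg_r in M; auto.
    eapply Rle_trans; [exact M|]. apply Rmult_le_compat_r; lra. }
  (* Q'^2 does not decrease after k/2, so integrating twice gives Q^2 >= Q'(k/2)^2 (r - k/2)^2; at
     5k/8 the last factor is (k/8)^2 >= 1. *)
  assert (F2 : Q1 (k / 2) ^ 2 <= Q (5 / 8 * k) ^ 2).
  { set (c := Q1 (k / 2) ^ 2).
    assert (G : forall x, k / 2 <= x <= 5 / 8 * k -> c * (x - k / 2) <= Q x * Q1 x).
    { intros x Hx. assert (A := QQ1_nonneg (k / 2) ltac:(lra)).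
      enough (Q (k / 2) * Q1 (k / 2) - c * (k / 2) <= Q x * Q1 x - c * x) by lra.
      apply (derive_nonneg_le (fun x => Q x * Q1 x - c * x) (fun x => Q1 x ^ 2 - q x * Q x ^ 2 - c)); [lra| |].
      - intros t Ht. apply @is_derive_minus; [apply dQQ1; lra|].
        auto_derive; [auto|ring].
      - intros t Ht. assert (A1 := q_forbidden t ltac:(lra)).
        assert (A2 := forbidden_derivative_sq_monotone (k / 2) t ltac:(lra) ltac:(lra)). fold c in A2.
        nra. }
    assert (M : Q (k / 2) ^ 2 - c * (k / 2 - k / 2) ^ 2 <= Q (5 / 8 * k) ^ 2 - c * (5 / 8 * k - k / 2) ^ 2).
    { apply (derive_nonneg_le (fun x => Q x ^ 2 - c * (x - k / 2) ^ 2)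
        (fun x => 2 * (Q x * Q1 x) - 2 * c * (x - k / 2))); [lra| |].
      - intros t Ht. apply @is_derive_minus; [apply dQ2; lra|].
        auto_derive; [auto|field].
      - intros t Ht. specialize (G t Ht). lra. }
    replace (5 / 8 * k - k / 2) with (k / 8) in M by field.
    assert (1 <= (k / 8) ^ 2) by nra. nra. }
  split; [|split].
  - eapply Rle_trans; [apply (forbidden_sq_monotone r (5 / 8 * k)); lra|exact F1].
  - eapply Rle_trans; [apply (forbidden_derivative_sq_monotone r (k / 2)); lra|]. lra.
  - assert (A := energy_nonneg r ltac:(lra)). unfold wave_energy in A.
    rewrite coulomb_potential_turning in A by lra.
    assert (Hr2 : 0 < r ^ 2) by (apply pow_lt; lra).
    set (z := Q r ^ 2 / r ^ 2).
    assert (Hz : 0 <= z) by (apply Rdiv_le_0_compat; [apply pow2_ge_0|auto]).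
    replace ((g * Q r / r) ^ 2) with (g ^ 2 * z) by (unfold z; field; lra).
    replace (((r + nu) ^ 2 - k ^ 2 - g) / r ^ 2 * Q r ^ 2) with
      (- ((k ^ 2 + g - (r + nu) ^ 2) * z)) in A by (unfold z; field; lra).
    assert (W : g ^ 2 <= 2 * (k ^ 2 + g - (r + nu) ^ 2)) by nra.
    assert (g ^ 2 * z <= 2 * (k ^ 2 + g - (r + nu) ^ 2) * z) by (apply Rmult_le_compat_r; auto). lra.
Qed.

(** Outside the middle region m <= |k - r|. 40 is 4 (9 + 1) in the forbidden region and 4 times 10
    in the middle one; 100000 covers 24 times 54^2 in the oscillating one. *)
Lemma wave_transition_region (r : R) : k / 2 <= r <= 2 * k ->
  (Q r ^ 2 + Q1 r ^ 2) ^ 2 * (Rabs (k - r) + m) <=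
    (100000 + 40 * transition_const ^ 2) * k * E ^ 2.
Proof.
  intros Hr. destruct wave_at_2k as [_ [_ E3]].
  assert (HC : 0 < transition_const) by (unfold transition_const; pose proof (exp_pos 1026); lra).
  pose proof (pow2_ge_0 (Q r)) as S0. pose proof (pow2_ge_0 (Q1 r)) as S1.
  pose proof (pow2_ge_0 E) as SE.
  assert (HkE : 0 <= k * E ^ 2) by (apply Rmult_le_pos; lra).
  set (C := transition_const) in *.
  assert (HCE : 0 <= C ^ 2 * (k * E ^ 2)) by (apply Rmult_le_pos; [apply pow2_ge_0|auto]).
  assert (Hsq : (Q r ^ 2 + Q1 r ^ 2) ^ 2 <= 2 * Q r ^ 4 + 2 * Q1 r ^ 4).
  { pose proof (pow2_ge_0 (Q r ^ 2 - Q1 r ^ 2)).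
    replace (Q r ^ 4) with ((Q r ^ 2) ^ 2) by ring. replace (Q1 r ^ 4) with ((Q1 r ^ 2) ^ 2) by ring. lra. }
  assert (P1 : 0 <= Q1 r ^ 4) by (replace (Q1 r ^ 4) with ((Q1 r ^ 2) ^ 2) by ring; apply pow2_ge_0).
  destruct (Rle_dec (k + 9 * m) r) as [H1|H1]; [|destruct (Rle_dec r (k - 9 * m)) as [H2|H2]].
  - destruct (oscillating_bound r ltac:(lra)) as [A1 A2].
    rewrite Rabs_minus_sym, Rabs_pos_eq by lra.
    apply Rle_trans with ((2 * Q r ^ 4 + 2 * Q1 r ^ 4) * (2 * (r - k))).
    { apply Rmult_le_compat; try lra. apply pow2_ge_0. }
    assert (Q1 r ^ 4 * (r - k) <= 2 * 54 ^ 2 * E ^ 2 * k) by (apply Rmult_le_compat; lra).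
    lra.
  - destruct (forbidden_bound r ltac:(lra)) as [A1 A2]. fold C in A1, A2.
    rewrite Rabs_pos_eq by lra.
    apply Rle_trans with ((2 * Q r ^ 4 + 2 * Q1 r ^ 4) * (2 * (k - r))).
    { apply Rmult_le_compat; try lra. apply pow2_ge_0. }
    assert (A3 : Q1 r ^ 4 <= (C * E) ^ 2).
    { replace (Q1 r ^ 4) with ((Q1 r ^ 2) ^ 2) by ring. apply pow_incr. lra. }
    assert (Q1 r ^ 4 * (k - r) <= (C * E) ^ 2 * k) by (apply Rmult_le_compat; lra).
    lra.
  - destruct (transition_bound r ltac:(lra)) as [A1 A2]. fold C in A1, A2.
    assert (A3 : Rabs (k - r) + m <= 10 * m).
    { assert (Rabs (k - r) <= 9 * m) by (apply Rabs_le; lra). lra. }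
    assert (A4 : C * E / m <= C * m * E).
    { apply Rle_div_l; [lra|]. nra. }
    assert (A5 : (Q r ^ 2 + Q1 r ^ 2) ^ 2 <= (2 * (C * m * E)) ^ 2) by (apply pow_incr; lra).
    apply Rle_trans with ((2 * (C * m * E)) ^ 2 * (10 * m)).
    { apply Rmult_le_compat; auto; [apply pow2_ge_0|]. pose proof (Rabs_pos (k - r)). lra. }
    replace ((2 * (C * m * E)) ^ 2 * (10 * m)) with (40 * C ^ 2 * (m ^ 3 * E ^ 2)) by ring.
    rewrite <- Hmk. lra.
Qed.
End Uniform.

(** * Size of the normalized solution *)

Lemma abs_le_of_sq (x y : R) : 0 <= y -> x ^ 2 <= y ^ 2 -> Rabs x <= y.
Proof.
  intros Hy H. rewrite <- (Rabs_pos_eq y) by auto. apply Rsqr_le_abs_0. unfold Rsqr. lra.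
Qed.

Lemma sqrt_sum_le (x y : R) : sqrt (x ^ 2 + y ^ 2) <= Rabs x + Rabs y.
Proof.
  pose proof (Rabs_pos x). pose proof (Rabs_pos y).
  rewrite <- (sqrt_pow2 (Rabs x + Rabs y)) by lra. apply sqrt_le_1_alt.
  rewrite <- (pow2_abs x), <- (pow2_abs y). nra.
Qed.

(** * Bounds for Gamma and for the normalizing amplitude *)

Lemma halfline_int_laplace1 (f : R -> R) : subexponential f ->
  halfline_int (fun t => exp (- t) * f t) (laplace f 1).
Proof.
  intros Hf. eapply halfline_int_ext; [|apply (laplace_correct f 1 Rlt_0_1 Hf)].
  intros t Ht. simpl. rewrite Rmult_1_l. reflexivity.
Qed.

Lemma gamma_int_0 : gamma_int 0 = 1.
Proof.
  unfold gamma_int. apply laplace_eq; [lra|apply subexponential_Rpower; lra|].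
  assert (I := halfline_int_exp 1 1 Rlt_0_1). replace (1 / 1) with 1 in I by field.
  eapply halfline_int_ext; [|exact I].
  intros t Ht. simpl. rewrite Rpower_0_exp. ring.
Qed.

(** The part of the integral over [T, T + 1]. As T is free, Gamma beats any exponential in g at the
    price of a constant. *)
Lemma gamma_int_lower (T g : R) : 1 <= T -> 0 <= g -> Rpower T g * exp (- (T + 1)) <= gamma_int g.
Proof.
  intros HT Hg.
  replace (Rpower T g * exp (- (T + 1))) with (Rpower T g * exp (- (T + 1)) * (T + 1 - T)) by ring.
  eapply (halfline_int_ge_RInt (fun t => exp (- t) * Rpower t g)); [lra| | |].
  - intros t Ht. apply Rmult_le_pos; left; apply exp_pos.
  - intros t Ht. rewrite Rmult_comm. apply Rmult_le_compat; try (left; apply exp_pos).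
    + apply exp_le_exp. lra.
    + unfold Rpower. apply exp_le_exp. apply Rmult_le_compat_l; auto. apply ln_le; lra.
  - apply halfline_int_laplace1, subexponential_Rpower, Hg.
Qed.

(* Integrate (t^g - Gamma(g+1))^2 e^(-t) >= 0. *)
Lemma gamma_int_double (g : R) : 0 <= g -> gamma_int g ^ 2 <= gamma_int (2 * g).
Proof.
  intros Hg. set (a := gamma_int g).
  assert (I := halfline_int_lin _ _ 1 1 _ _
    (halfline_int_laplace1 _ (subexponential_Rpower (2 * g) ltac:(lra)))
    (halfline_int_lin _ _ (-2 * a) (a ^ 2) _ _ (halfline_int_laplace1 _ (subexponential_Rpower g Hg))
      (halfline_int_laplace1 _ (subexponential_Rpower 0 (Rle_refl 0))))).
  fold (gamma_int (2 * g)) (gamma_int g) (gamma_int 0) in I. fold a in I. rewrite gamma_int_0 in I.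
  enough (0 / 1 <= 1 * gamma_int (2 * g) + 1 * (-2 * a * a + a ^ 2 * 1)) by lra.
  eapply halfline_int_le; [|apply (halfline_int_exp 0 1); lra|exact I].
  intros t Ht. cbv beta. rewrite Rmult_0_l, Rpower_0_exp.
  replace (Rpower t (2 * g)) with (Rpower t g * Rpower t g) by (rewrite <- Rpower_plus; f_equal; ring).
  replace (1 * _ + _) with (exp (- t) * (Rpower t g - a) ^ 2) by ring.
  apply Rmult_le_pos; [left; apply exp_pos|apply pow2_ge_0].
Qed.

Lemma gamma_trig_le (g nu : R) : 0 <= g ->
  gamma_cos g nu ^ 2 + gamma_sin g nu ^ 2 <= 2 * gamma_int g ^ 2.
Proof.
  intros Hg.
  assert (H : forall f, (forall t, -1 <= f t <= 1) -> subexponential (fun t => Rpower t g * f t) ->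
    Rabs (laplace (fun t => Rpower t g * f t) 1) <= gamma_int g).
  { intros f Hf Hs. apply (laplace_dominated _ (fun t => Rpower t g) 1); auto; [lra|apply subexponential_Rpower; auto|].
    intros t Ht. specialize (Hf t). assert (0 < Rpower t g) by apply exp_pos.
    rewrite Rabs_mult, (Rabs_pos_eq (Rpower t g)) by lra.
    assert (Rabs (f t) <= 1) by (apply Rabs_le; lra). nra. }
  assert (H1 := H (fun t => cos (nu * ln t)) (fun t => COS_bound _) (subexponential_Rpower_cos g nu Hg)).
  assert (H2 := H (fun t => sin (nu * ln t)) (fun t => SIN_bound _) (subexponential_Rpower_sin g nu Hg)).
  change (Rabs (gamma_cos g nu) <= gamma_int g) in H1.
  change (Rabs (gamma_sin g nu) <= gamma_int g) in H2.
  rewrite <- (pow2_abs (gamma_cos g nu)), <- (pow2_abs (gamma_sin g nu)).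
  pose proof (Rabs_pos (gamma_cos g nu)). pose proof (Rabs_pos (gamma_sin g nu)). nra.
Qed.

Lemma gamma_int_pos (g : R) : 0 <= g -> 0 < gamma_int g.
Proof.
  intros Hg. eapply Rlt_le_trans; [|apply (gamma_int_lower 1 g); auto; lra].
  apply Rmult_lt_0_compat; apply exp_pos.
Qed.

(** Gamma(conj z) = conj Gamma(z); the amplitude is therefore even in nu, as rho < 0 requires. *)
Lemma gamma_trig_sym (g nu : R) : 0 <= g ->
  gamma_cos g (- nu) = gamma_cos g nu /\ gamma_sin g (- nu) = - gamma_sin g nu.
Proof.
  intros Hg. split.
  - unfold gamma_cos. apply laplace_eq; [lra|apply subexponential_Rpower_cos; auto|].
    eapply halfline_int_ext; [|apply (laplace_correct _ 1 Rlt_0_1 (subexponential_Rpower_cos g nu Hg))].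
    intros t Ht. simpl. rewrite <- Ropp_mult_distr_l, cos_neg. reflexivity.
  - unfold gamma_sin. apply laplace_eq; [lra|apply subexponential_Rpower_sin; auto|].
    replace (- laplace _ _) with (-1 * laplace (fun t => Rpower t g * sin (nu * ln t)) 1) by ring.
    eapply halfline_int_ext; [|apply halfline_int_scal;
      apply (laplace_correct _ 1 Rlt_0_1 (subexponential_Rpower_sin g nu Hg))].
    intros t Ht. simpl. rewrite <- Ropp_mult_distr_l, sin_neg. ring.
Qed.

Definition amplitude (nu g : R) : R :=
  sqrt 2 * sqrt (gamma_cos g nu ^ 2 + gamma_sin g nu ^ 2) / gamma_int (2 * g).

Lemma amplitude_sym (nu g : R) : 0 <= g -> amplitude (- nu) g = amplitude nu g.
Proof.
  intros Hg. unfold amplitude. destruct (gamma_trig_sym g nu Hg) as [-> ->].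
  do 3 f_equal. ring.
Qed.

Lemma amplitude_nonneg (nu g : R) : 0 <= g -> 0 <= amplitude nu g.
Proof.
  intros Hg. unfold amplitude. apply Rdiv_le_0_compat; [|apply gamma_int_pos; lra].
  apply Rmult_le_pos; apply sqrt_pos.
Qed.

Lemma amplitude_sq (nu g : R) : 0 <= g ->
  amplitude nu g ^ 2 * gamma_int (2 * g) ^ 2 = 2 * (gamma_cos g nu ^ 2 + gamma_sin g nu ^ 2).
Proof.
  intros Hg. unfold amplitude. assert (HG := gamma_int_pos (2 * g) ltac:(lra)).
  set (w := gamma_cos g nu ^ 2 + gamma_sin g nu ^ 2).
  assert (0 <= w) by (unfold w; pose proof (pow2_ge_0 (gamma_cos g nu)); pose proof (pow2_ge_0 (gamma_sin g nu)); lra).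
  replace (_ ^ 2 * _) with ((sqrt 2 * sqrt 2) * (sqrt w * sqrt w)) by (field; lra).
  rewrite !sqrt_sqrt by lra. reflexivity.
Qed.

(** The amplitude is at most 2/Gamma(g + 1), and T = 16 gives Gamma(g + 1) >= 16^g e^(-17). One
    factor 4^g is kept to pay for (2r)^(g-1) when r <= 2, the other yields e^(-g). *)
Lemma amplitude_decay (nu g : R) : 0 <= g -> amplitude nu g * Rpower 4 g <= 2 * exp 17 * exp (- g).
Proof.
  intros Hg. assert (HG := gamma_int_pos (2 * g) ltac:(lra)).
  assert (HG1 := gamma_int_pos g Hg). assert (HD := gamma_int_double g Hg).
  assert (HT := gamma_trig_le g nu Hg). assert (HL := gamma_int_lower 16 g ltac:(lra) Hg).
  assert (HS := amplitude_sq nu g Hg). assert (HN := amplitude_nonneg nu g Hg).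
  set (A := amplitude nu g) in *. set (G := gamma_int g) in *. set (G2 := gamma_int (2 * g)) in *.
  assert (A1 : A * G <= 2).
  { assert (A * G2 <= 2 * G).
    { apply Rsqr_incr_0; unfold Rsqr; [nra| |lra]. apply Rmult_le_pos; lra. }
    apply (Rmult_le_reg_r G); auto. nra. }
  assert (E16 : Rpower 16 g = Rpower 4 g * Rpower 4 g).
  { rewrite Rpower_mult_distr by lra. f_equal. ring. }
  assert (E4 : exp g <= Rpower 4 g).
  { unfold Rpower. apply exp_le_exp.
    assert (1 <= ln 4). { rewrite <- (ln_exp 1). apply ln_le; [apply exp_pos|]. pose proof exp_le_3. lra. }
    nra. }
  assert (H4 : 0 < Rpower 4 g) by apply exp_pos.
  assert (E17 : exp (- (16 + 1)) * exp 17 = 1) by (rewrite <- exp_plus; replace (- (16 + 1) + 17) with 0 by ring; apply exp_0).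
  assert (Eg : exp (- g) * exp g = 1) by (rewrite <- exp_plus, Rplus_opp_l; apply exp_0).
  pose proof (exp_pos (- g)). pose proof (exp_pos 17).
  assert (B1 : Rpower 16 g <= G * exp 17).
  { replace (Rpower 16 g) with (Rpower 16 g * exp (- (16 + 1)) * exp 17) by (rewrite Rmult_assoc, E17; ring).
    apply Rmult_le_compat_r; lra. }
  apply (Rmult_le_reg_r (Rpower 4 g)); auto.
  replace (A * Rpower 4 g * Rpower 4 g) with (A * Rpower 16 g) by (rewrite E16; ring).
  apply Rle_trans with (A * (G * exp 17)); [apply Rmult_le_compat_l; auto|].
  apply Rle_trans with (2 * exp 17); [nra|].
  replace (2 * exp 17) with (2 * exp 17 * (exp (- g) * exp g)) at 1 by (rewrite Eg; ring).
  rewrite <- Rmult_assoc. apply Rmult_le_compat_l; [|auto].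
  apply Rmult_le_pos; lra.
Qed.

Lemma Rpower_1_base (x : R) : Rpower 1 x = 1.
Proof. unfold Rpower. rewrite ln_1, Rmult_0_r. apply exp_0. Qed.

(** j0 + j1 without the factor e^(pi nu/2): j1 removes the derivative of |2 rho|^(g-1), so it sees
    only M', which the differential system expresses by X and Y. *)
Definition radial_size (nu g r : R) : R :=
  amplitude nu g * Rpower (2 * r) (g - 1) *
  (sqrt (coulomb_X nu g r ^ 2 + coulomb_Y nu g r ^ 2)
   + sqrt ((- (1 + 2 * nu / r) * coulomb_Y nu g r) ^ 2
           + (coulomb_X nu g r - 2 * g / r * coulomb_Y nu g r) ^ 2)).

(** * Bounds in each range of r *)

Section Size.
Variables nu g k : R.
Hypothesis Hnu : -1 <= nu <= 1.
Hypothesis Hg : 0 <= g.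
Hypothesis Hk1 : 1 <= k.
Hypothesis Hk : g ^ 2 + nu ^ 2 = k ^ 2.

Let X := coulomb_X nu g.
Let Y := coulomb_Y nu g.

Let Hpair : coulomb_pair nu g X Y.
Proof. apply coulomb_pair_kummer; auto; nra. Qed.

Notation P := (regular_P g X).
Notation Q := (regular_Q g Y).
Notation Q1 := (regular_Q1 g X Y).

Let A := amplitude nu g * Rpower 2 g.

Let A_nonneg : 0 <= A.
Proof. apply Rmult_le_pos; [apply amplitude_nonneg, Hg|left; apply exp_pos]. Qed.

Let Hgk : g <= k.
Proof. nra. Qed.

Let Hkg : k - 1 <= g.
Proof. nra. Qed.

(** r^g X = Q' + g Q/r and r^g (X - 2g Y/r) = Q' - g Q/r. The term g Q/r stays apart because g/r is
    unbounded below the turning point. *)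
Lemma radial_size_wave (r : R) : 0 < r ->
  radial_size nu g r <= A / (2 * r) *
    (2 * Rabs (Q1 r) + 2 * Rabs (g * Q r / r) + (2 + 2 / r) * Rabs (Q r)).
Proof.
  intros Hr. unfold radial_size. fold X Y.
  assert (E : amplitude nu g * Rpower (2 * r) (g - 1) = A / (2 * r) * Rpower r g).
  { unfold A. replace (g - 1) with (g + - (1)) by ring.
    rewrite Rpower_plus, Rpower_Ropp, Rpower_1 by lra.
    rewrite <- Rpower_mult_distr by lra. field. lra. }
  rewrite E, Rmult_assoc. apply Rmult_le_compat_l.
  { apply Rdiv_le_0_compat; [auto|lra]. }
  assert (Hw : 0 < Rpower r g) by apply exp_pos.
  assert (S1 := sqrt_sum_le (X r) (Y r)).
  assert (S2 := sqrt_sum_le (- (1 + 2 * nu / r) * Y r) (X r - 2 * g / r * Y r)).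
  apply Rle_trans with (Rpower r g * (Rabs (X r) + Rabs (Y r) + (Rabs (- (1 + 2 * nu / r) * Y r)
    + Rabs (X r - 2 * g / r * Y r)))).
  { apply Rmult_le_compat_l; lra. }
  replace (Rpower r g * _) with (Rabs (Rpower r g) * Rabs (X r) + Rabs (Rpower r g) * Rabs (Y r)
    + (Rabs (Rpower r g) * Rabs (- (1 + 2 * nu / r) * Y r)
      + Rabs (Rpower r g) * Rabs (X r - 2 * g / r * Y r)))
    by (rewrite (Rabs_pos_eq (Rpower r g)) by lra; ring).
  rewrite <- !Rabs_mult.
  replace (Rpower r g * X r) with (Q1 r + g * Q r / r)
    by (unfold regular_Q1, regular_P; field; lra).
  change (Rpower r g * Y r) with (Q r).
  replace (Rpower r g * (- (1 + 2 * nu / r) * Y r)) with (- (1 + 2 * nu / r) * Q r)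
    by (unfold regular_Q; field; lra).
  replace (Rpower r g * (X r - 2 * g / r * Y r)) with (Q1 r + - (g * Q r / r))
    by (unfold regular_Q1, regular_P, regular_Q; field; lra).
  assert (T1 := Rabs_triang (Q1 r) (g * Q r / r)).
  assert (T2 := Rabs_triang (Q1 r) (- (g * Q r / r))). rewrite Rabs_Ropp in T2.
  assert (T3 : Rabs (- (1 + 2 * nu / r) * Q r) <= (1 + 2 / r) * Rabs (Q r)).
  { rewrite Rabs_mult. apply Rmult_le_compat_r; [apply Rabs_pos|].
    rewrite Rabs_Ropp. assert (0 < / r) by (apply Rinv_0_lt_compat; auto).
    unfold Rdiv. apply Rabs_le. nra. }
  lra.
Qed.

(** The power series bounds control Y/r as well, so nothing is lost as r -> 0; the factor e^(2r)
    confines the use to bounded r. *)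
Lemma radial_size_crude (r : R) : 0 < r ->
  radial_size nu g r <= amplitude nu g * Rpower (2 * r) (g - 1) *
    ((12 + 20 * r + 10 * g) * exp (2 * r)).
Proof.
  intros Hr. unfold radial_size. fold X Y.
  apply Rmult_le_compat_l.
  { apply Rmult_le_pos; [apply amplitude_nonneg, Hg|left; apply exp_pos]. }
  assert (HX := coulomb_bX _ _ _ _ Hpair r Hr). assert (HY := coulomb_bY _ _ _ _ Hpair r Hr).
  assert (He : 1 <= exp (2 * r)) by (rewrite <- exp_0; apply exp_le_exp; lra).
  set (e := exp (2 * r)) in *.
  assert (S1 := sqrt_sum_le (X r) (Y r)).
  assert (S2 := sqrt_sum_le (- (1 + 2 * nu / r) * Y r) (X r - 2 * g / r * Y r)).
  assert (HX' : Rabs (X r) <= 1 + 5 * r * e).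
  { apply Rabs_le_between in HX. apply Rabs_le. lra. }
  set (y := Y r / r).
  assert (Hy : Rabs y <= 5 * e).
  { unfold y, Rdiv. rewrite Rabs_mult, (Rabs_pos_eq (/ r)) by (left; apply Rinv_0_lt_compat; auto).
    apply (Rle_div_l _ _ r); lra. }
  assert (E1 : - (1 + 2 * nu / r) * Y r = - (r + 2 * nu) * y) by (unfold y; field; lra).
  assert (E2 : X r - 2 * g / r * Y r = X r + - (2 * g * y)) by (unfold y; field; lra).
  rewrite E1, E2 in *.
  assert (T1 : Rabs (- (r + 2 * nu) * y) <= (r + 2) * (5 * e)).
  { rewrite Rabs_mult. apply Rmult_le_compat; try apply Rabs_pos; auto. apply Rabs_le. lra. }
  assert (T2 : Rabs (X r + - (2 * g * y)) <= 1 + 5 * r * e + 2 * g * (5 * e)).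
  { eapply Rle_trans; [apply Rabs_triang|]. rewrite Rabs_Ropp, !Rabs_mult, (Rabs_pos_eq 2), (Rabs_pos_eq g) by lra.
    assert (2 * g * Rabs y <= 2 * g * (5 * e)) by (apply Rmult_le_compat_l; lra). lra. }
  nra.
Qed.

(** [E] is e |c|^2. Multiplied by A^2, both Gamma values cancel between [far_amplitude_bound] and
    [amplitude_sq], and e times 2 e^9 times 2 remains: uniformity in k and nu is obtained here. *)
Lemma energy_at_infinity : exists E, 0 <= E /\ A ^ 2 * E <= 4 * exp 5 ^ 2 /\
  forall kap s, 27 <= kap -> k <= kap -> 2 * kap <= s -> wave_energy nu g Q Q1 s <= E.
Proof.
  destruct (far_amplitude_exists nu g X Y Hpair Hnu Hg) as [c1 [c2 Hc]].
  exists (exp 1 * (c1 ^ 2 + c2 ^ 2)). pose proof (exp_pos 1) as He1. split; [|split].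
  - nra.
  - assert (N := far_amplitude_bound nu g X Y Hpair Hnu Hg c1 c2 Hc).
    assert (HG := gamma_int_pos (2 * g) ltac:(lra)). assert (HS := amplitude_sq nu g Hg).
    apply (Rmult_le_reg_r (gamma_int (2 * g) ^ 2)); [apply pow_lt; auto|].
    assert (E4 : Rpower 2 g ^ 2 = Rpower 4 g).
    { simpl. rewrite Rmult_1_r, Rpower_mult_distr by lra. f_equal; ring. }
    unfold A.
    replace ((amplitude nu g * Rpower 2 g) ^ 2 * (exp 1 * (c1 ^ 2 + c2 ^ 2)) * gamma_int (2 * g) ^ 2) with
      (exp 1 * (Rpower 2 g ^ 2 * (c1 ^ 2 + c2 ^ 2) * (amplitude nu g ^ 2 * gamma_int (2 * g) ^ 2))) by ring.
    rewrite E4, HS.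
    assert (E10 : exp 1 * exp 9 = exp 5 ^ 2) by (simpl; rewrite Rmult_1_r, <- !exp_plus; f_equal; ring).
    rewrite <- E10. nra.
  - intros kap s H27 Hkk Hs. destruct Hc as [_ [_ L]].
    assert (Hgk' : g ^ 2 + g <= kap ^ 2 + kap) by nra.
    apply (filterlim_Rle (F:=Rbar_locally p_infty) (fun _ => wave_energy nu g Q Q1 s)
      (fun t => exp 1 * wave_energy nu g Q Q1 t)).
    + apply (infty_large _ s). intros t Ht.
      apply (wave_energy_compare nu g kap Hnu Hg H27 Hgk' Q Q1 s t); [|lra].
      apply (regular_wave nu g X Y Hpair).
    + apply filterlim_const.
    + apply filterlim_Rscal, L.
Qed.

Let scaled_bound E c M x : A ^ 2 * E <= 4 * exp 5 ^ 2 -> 0 <= c -> 0 <= M ->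
  x ^ 2 <= c * E -> c * (4 * exp 5 ^ 2) <= M ^ 2 -> A * Rabs x <= M.
Proof.
  intros HE Hc HM Hx HcM. rewrite <- (Rabs_pos_eq A) by auto. rewrite <- Rabs_mult.
  apply abs_le_of_sq; auto. eapply Rle_trans; [|exact HcM].
  replace ((A * x) ^ 2) with (A ^ 2 * x ^ 2) by ring.
  apply Rle_trans with (A ^ 2 * (c * E)).
  - apply Rmult_le_compat_l; [apply pow2_ge_0|auto].
  - replace (A ^ 2 * (c * E)) with (c * (A ^ 2 * E)) by ring. apply Rmult_le_compat_l; auto.
Qed.

Lemma radial_size_far (r kap : R) : 216 <= kap -> k <= kap -> 2 * kap <= r ->
  radial_size nu g r <= 10 * exp 5 * / r.
Proof.
  intros H1 H2 Hr. destruct energy_at_infinity as [Einf [E0 [EA HE]]].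
  specialize (HE kap r ltac:(lra) H2 Hr).
  assert (Hpot := coulomb_potential_far nu g kap Hnu Hg ltac:(lra) ltac:(nra) r Hr).
  unfold wave_energy in HE.
  assert (B0 : Q r ^ 2 <= 2 * Einf).
  { nra. }
  assert (B1 : Q1 r ^ 2 <= 1 * Einf).
  { nra. }
  pose proof (exp_pos 5).
  assert (C0 : A * Rabs (Q r) <= 3 * exp 5) by (apply (scaled_bound Einf 2); nra).
  assert (C1 : A * Rabs (Q1 r) <= 2 * exp 5) by (apply (scaled_bound Einf 1); nra).
  eapply Rle_trans; [apply radial_size_wave; lra|].
  assert (D1 : Rabs (g * Q r / r) <= / 2 * Rabs (Q r)).
  { replace (g * Q r / r) with (g / r * Q r) by (field; lra).
    rewrite Rabs_mult. apply Rmult_le_compat_r; [apply Rabs_pos|].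
    rewrite Rabs_pos_eq by (apply Rdiv_le_0_compat; lra). apply (Rle_div_l _ _ r); lra. }
  assert (D2 : 2 / r <= 1) by (apply (Rle_div_l _ _ r); lra).
  replace (A / (2 * r) * (2 * Rabs (Q1 r) + 2 * Rabs (g * Q r / r) + (2 + 2 / r) * Rabs (Q r))) with
   (/ 2 * (A * (2 * Rabs (Q1 r) + 2 * Rabs (g * Q r / r) + (2 + 2 / r) * Rabs (Q r))) * / r) by (field; lra).
  apply Rmult_le_compat_r; [left; apply Rinv_0_lt_compat; lra|].
  pose proof (Rabs_pos (Q r)).
  assert (A * (2 * Rabs (Q1 r) + 2 * Rabs (g * Q r / r) + (2 + 2 / r) * Rabs (Q r)) <=
    A * (2 * Rabs (Q1 r) + 4 * Rabs (Q r))).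
  { apply Rmult_le_compat_l; auto. nra. }
  lra.
Qed.

(** For g >= 1 the weight r^g <= r gains one order over the bounds on X and Y. *)
Let Q_near_0 : 1 <= g -> forall r, 0 < r < 1 ->
  Rabs (Q1 r) <= (1 + 5 * exp 2 + g * (5 * exp 2)) * r /\ Rabs (Q r) <= (1 + 5 * exp 2 + g * (5 * exp 2)) * r ^ 2.
Proof.
  intros Hg1 r Hr.
  assert (HX := coulomb_bX _ _ _ _ Hpair r ltac:(lra)). assert (HY := coulomb_bY _ _ _ _ Hpair r ltac:(lra)).
  assert (Hw : 0 < Rpower r g <= r).
  { split; [apply exp_pos|]. replace g with (1 + (g - 1)) by ring. rewrite Rpower_plus, Rpower_1 by lra.
    assert (W := Rpower_le_1 r (g - 1) ltac:(lra) ltac:(lra)). nra. }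
  assert (He : exp (2 * r) <= exp 2) by (apply exp_le_exp; lra).
  pose proof (exp_pos (2 * r)).
  assert (HY' : Rabs (Y r) <= 5 * exp 2 * r) by nra.
  assert (HX' : Rabs (X r) <= 1 + 5 * exp 2).
  { apply Rabs_le_between in HX. apply Rabs_le. nra. }
  assert (Hgp : 0 <= g * (5 * exp 2)) by (apply Rmult_le_pos; lra).
  split.
  - replace (Q1 r) with (Rpower r g * (X r + - (g * (Y r / r))))
      by (unfold regular_Q1, regular_P, regular_Q; field; lra).
    rewrite Rabs_mult, (Rabs_pos_eq (Rpower r g)), Rmult_comm by lra.
    apply Rmult_le_compat; [apply Rabs_pos|lra| |lra].
    eapply Rle_trans; [apply Rabs_triang|]. rewrite Rabs_Ropp, Rabs_mult, (Rabs_pos_eq g) by lra.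
    apply Rplus_le_compat; [auto|]. apply Rmult_le_compat_l; auto.
    unfold Rdiv. rewrite Rabs_mult, (Rabs_pos_eq (/ r)) by (left; apply Rinv_0_lt_compat; lra).
    apply (Rle_div_l _ _ r); lra.
  - unfold regular_Q. rewrite Rabs_mult, (Rabs_pos_eq (Rpower r g)) by lra.
    apply Rle_trans with (r * (5 * exp 2 * r)).
    + apply Rmult_le_compat; try lra. apply Rabs_pos.
    + nra.
Qed.

Let m := Rpower k (1 / 3).

Let m_cube : k = m ^ 3.
Proof.
  unfold m. simpl. rewrite Rmult_1_r, <- !Rpower_plus.
  replace (1 / 3 + (1 / 3 + 1 / 3)) with 1 by field. rewrite Rpower_1; lra.
Qed.

Let m_large : 216 <= k -> 6 <= m.
Proof.
  intros H. destruct (Rle_dec 6 m) as [|N]; auto. exfalso.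
  assert (m * m < 36) by nra.
  assert (m ^ 3 < 216) by (simpl; nra). rewrite <- m_cube in *. lra.
Qed.

(** The nested roots undo the fourth powers of [wave_transition_region]; 9 counts 2 for Q', 4 for g
    Q/r and 3 for Q. *)
Definition transition_size_const : R :=
  9 * sqrt (sqrt ((100000 + 40 * transition_const ^ 2) * (4 * exp 5 ^ 2) ^ 2)).

Lemma radial_size_transition (r : R) : 216 <= k -> k / 2 <= r <= 2 * k ->
  radial_size nu g r <= transition_size_const *
    (Rpower k (- (3 / 4)) * Rpower (Rabs (k - r) + Rpower k (1 / 3)) (- (1 / 4))).
Proof.
  intros H216 Hr. destruct energy_at_infinity as [Einf [E0 [EA HE]]].
  specialize (HE k (2 * k) ltac:(lra) ltac:(lra) ltac:(lra)).
  set (B := 1 + 5 * exp 2 + g * (5 * exp 2)).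
  assert (HB1 : forall r, 0 < r < 1 -> Rabs (Q1 r) <= B * r) by (intros; apply Q_near_0; auto; lra).
  assert (HB0 : forall r, 0 < r < 1 -> Rabs (Q r) <= B * r ^ 2) by (intros; apply Q_near_0; auto; lra).
  assert (T := wave_transition_region nu g k m Hnu Hg Hk (m_large H216) m_cube Q Q1
    (regular_wave nu g X Y Hpair) _ HE B HB1 HB0 r Hr).
  fold m. set (w := Rabs (k - r) + m) in *.
  assert (Hw : 0 < w) by (unfold w; pose proof (Rabs_pos (k - r)); lra).
  pose proof (exp_pos 5) as He5.
  pose proof (pow2_ge_0 A) as A2.
  set (K := 100000 + 40 * transition_const ^ 2) in *.
  assert (HK : 0 < K) by (unfold K; pose proof (pow2_ge_0 transition_const); lra).
  set (Z := A ^ 2 * (Q r ^ 2 + Q1 r ^ 2)).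
  assert (HZ0 : 0 <= Z).
  { apply Rmult_le_pos; auto. pose proof (pow2_ge_0 (Q r)). pose proof (pow2_ge_0 (Q1 r)). lra. }
  assert (HZ : Z ^ 2 * w <= K * (4 * exp 5 ^ 2) ^ 2 * k).
  { unfold Z. replace ((A ^ 2 * (Q r ^ 2 + Q1 r ^ 2)) ^ 2 * w) with
      ((A ^ 2) ^ 2 * ((Q r ^ 2 + Q1 r ^ 2) ^ 2 * w)) by ring.
    apply Rle_trans with ((A ^ 2) ^ 2 * (K * k * Einf ^ 2)).
    - apply Rmult_le_compat_l; [apply pow2_ge_0|exact T].
    - replace ((A ^ 2) ^ 2 * (K * k * Einf ^ 2)) with (K * k * (A ^ 2 * Einf) ^ 2) by ring.
      replace (K * (4 * exp 5 ^ 2) ^ 2 * k) with (K * k * (4 * exp 5 ^ 2) ^ 2) by ring.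
      apply Rmult_le_compat_l; [apply Rmult_le_pos; lra|]. apply pow_incr. split; [|auto].
      apply Rmult_le_pos; auto. }
  (* u = (k/w)^(1/4), so u^4 w = k, and the fourth-power bound reduces to Z <= sqrt(L) u^2. *)
  set (u := Rpower k (1 / 4) * Rpower w (- (1 / 4))).
  assert (Hu : 0 < u) by (apply Rmult_lt_0_compat; apply exp_pos).
  assert (Hu4 : (u ^ 2) ^ 2 * w = k).
  { unfold u.
    replace ((_ ^ 2) ^ 2) with ((Rpower k (1 / 4) * Rpower k (1 / 4) * Rpower k (1 / 4) * Rpower k (1 / 4)) *
      (Rpower w (- (1 / 4)) * Rpower w (- (1 / 4)) * Rpower w (- (1 / 4)) * Rpower w (- (1 / 4)))) by ring.
    rewrite <- !Rpower_plus.
    replace (1 / 4 + 1 / 4 + 1 / 4 + 1 / 4) with 1 by field.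
    replace (- (1 / 4) + - (1 / 4) + - (1 / 4) + - (1 / 4)) with (- (1)) by field.
    rewrite Rpower_Ropp, !Rpower_1 by lra. field. lra. }
  set (L := K * (4 * exp 5 ^ 2) ^ 2) in *.
  assert (HL : 0 < L) by (unfold L; apply Rmult_lt_0_compat; [lra|]; apply pow_lt, Rmult_lt_0_compat; [lra|apply pow_lt; lra]).
  assert (HZ2 : Z ^ 2 <= (sqrt L * u ^ 2) ^ 2).
  { apply (Rmult_le_reg_r w); auto. eapply Rle_trans; [exact HZ|].
    replace ((sqrt L * u ^ 2) ^ 2 * w) with ((sqrt L * sqrt L) * ((u ^ 2) ^ 2 * w)) by ring.
    rewrite sqrt_sqrt, Hu4; lra. }
  assert (HsL : 0 < sqrt L) by (apply sqrt_lt_R0; auto).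
  assert (HZ3 : Z <= sqrt L * u ^ 2).
  { apply Rsqr_incr_0; auto. - unfold Rsqr. lra.
    - apply Rmult_le_pos; [lra|apply pow2_ge_0]. }
  set (s := sqrt (sqrt L)). assert (Hs : 0 < s) by (apply sqrt_lt_R0; auto).
  assert (Hss : s * s = sqrt L) by (apply sqrt_sqrt; lra).
  assert (bnd : forall x, x ^ 2 <= Q r ^ 2 + Q1 r ^ 2 -> A * Rabs x <= s * u).
  { intros x Hx. rewrite <- (Rabs_pos_eq A) by auto. rewrite <- Rabs_mult.
    apply abs_le_of_sq; [apply Rmult_le_pos; lra|].
    replace ((A * x) ^ 2) with (A ^ 2 * x ^ 2) by ring.
    replace ((s * u) ^ 2) with (sqrt L * u ^ 2) by (rewrite <- Hss; ring).
    eapply Rle_trans; [|exact HZ3]. unfold Z. apply Rmult_le_compat_l; auto. }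
  assert (C0 : A * Rabs (Q r) <= s * u) by (apply bnd; pose proof (pow2_ge_0 (Q1 r)); lra).
  assert (C1 : A * Rabs (Q1 r) <= s * u) by (apply bnd; pose proof (pow2_ge_0 (Q r)); lra).
  eapply Rle_trans; [apply radial_size_wave; lra|].
  assert (D1 : Rabs (g * Q r / r) <= 2 * Rabs (Q r)).
  { replace (g * Q r / r) with (g / r * Q r) by (field; lra).
    rewrite Rabs_mult. apply Rmult_le_compat_r; [apply Rabs_pos|].
    rewrite Rabs_pos_eq by (apply Rdiv_le_0_compat; lra). apply (Rle_div_l _ _ r); lra. }
  assert (D2 : 2 / r <= 1) by (apply (Rle_div_l _ _ r); lra).
  replace (A / (2 * r) * (2 * Rabs (Q1 r) + 2 * Rabs (g * Q r / r) + (2 + 2 / r) * Rabs (Q r))) with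
   (A * (2 * Rabs (Q1 r) + 2 * Rabs (g * Q r / r) + (2 + 2 / r) * Rabs (Q r)) * / (2 * r)) by (field; lra).
  pose proof (Rabs_pos (Q r)).
  assert (F1 : A * (2 * Rabs (Q1 r) + 2 * Rabs (g * Q r / r) + (2 + 2 / r) * Rabs (Q r)) <= 9 * (s * u)).
  { apply Rle_trans with (A * (2 * Rabs (Q1 r) + 7 * Rabs (Q r))); [apply Rmult_le_compat_l; auto; nra|]. lra. }
  (* This factor turns k^(1/4) into k^(-3/4). *)
  assert (F2 : / (2 * r) <= / k) by (apply Rinv_le_contravar; lra).
  replace (Rpower k (- (3 / 4))) with (Rpower k (1 / 4) * / k).
  2:{ replace (- (3 / 4)) with (1 / 4 + - (1)) by field. rewrite Rpower_plus, Rpower_Ropp, Rpower_1 by lra. reflexivity. }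
  unfold transition_size_const. fold K L s.
  replace (9 * s * (Rpower k (1 / 4) * / k * Rpower w (- (1 / 4)))) with (9 * (s * u) * / k) by (unfold u; ring).
  assert (0 < s * u) by (apply Rmult_lt_0_compat; auto).
  apply Rle_trans with (9 * (s * u) * / (2 * r)).
  - apply Rmult_le_compat_r; [left; apply Rinv_0_lt_compat; lra|auto].
  - apply Rmult_le_compat_l; lra.
Qed.

Definition forbidden_size_const : R := 10 * sqrt (6 * transition_const * (4 * exp 5 ^ 2)).

(** The rate k/8 is for squares, hence k/16 here; g Q/r is controlled by Q', because g/r alone may
    be of order k. *)
Lemma radial_size_forbidden (r : R) : 216 <= k -> 2 <= r <= k / 2 ->
  radial_size nu g r <= forbidden_size_const * exp (- (k / 16)).
Proof.
  intros H216 Hr. destruct energy_at_infinity as [Einf [E0 [EA HE]]].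
  specialize (HE k (2 * k) ltac:(lra) ltac:(lra) ltac:(lra)).
  set (B := 1 + 5 * exp 2 + g * (5 * exp 2)).
  assert (HB1 : forall r, 0 < r < 1 -> Rabs (Q1 r) <= B * r) by (intros; apply Q_near_0; auto; lra).
  assert (HB0 : forall r, 0 < r < 1 -> Rabs (Q r) <= B * r ^ 2) by (intros; apply Q_near_0; auto; lra).
  destruct (forbidden_decay nu g k m Hnu Hg Hk (m_large H216) m_cube Q Q1
    (regular_wave nu g X Y Hpair) _ HE B HB1 HB0 r ltac:(lra)) as [T0 [T1 T2]].
  pose proof (exp_pos 5) as He5.
  assert (HC : 0 < transition_const) by (unfold transition_const; pose proof (exp_pos 1026); lra).
  set (L := 6 * transition_const * (4 * exp 5 ^ 2)).
  assert (HL : 0 < L).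
  { unfold L. apply Rmult_lt_0_compat; [lra|]. apply Rmult_lt_0_compat; [lra|apply pow_lt; lra]. }
  set (s := sqrt L). assert (Hs : 0 < s) by (apply sqrt_lt_R0; auto).
  assert (Hss : s * s = L) by (apply sqrt_sqrt; lra).
  set (ek := exp (- (k / 16))). assert (Hek : 0 < ek) by apply exp_pos.
  assert (Hekk : exp (- (k / 8)) = ek * ek) by (unfold ek; rewrite <- exp_plus; f_equal; field).
  rewrite Hekk in *.
  assert (bnd : forall x, x ^ 2 <= 6 * transition_const * Einf * (ek * ek) -> A * Rabs x <= s * ek).
  { intros x Hx. apply (scaled_bound Einf (6 * transition_const * (ek * ek))); auto.
    - apply Rmult_le_pos; [lra|apply Rmult_le_pos; lra].
    - apply Rmult_le_pos; lra.
    - lra.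
    - replace ((s * ek) ^ 2) with (L * (ek * ek)) by (rewrite <- Hss; ring). unfold L. lra. }
  assert (C0 := bnd _ T0). assert (C1 := bnd _ T1).
  eapply Rle_trans; [apply radial_size_wave; lra|].
  assert (D1 : Rabs (g * Q r / r) <= 2 * Rabs (Q1 r)).
  { apply abs_le_of_sq; [pose proof (Rabs_pos (Q1 r)); lra|].
    replace ((2 * Rabs (Q1 r)) ^ 2) with (4 * Rabs (Q1 r) ^ 2) by ring. rewrite pow2_abs.
    pose proof (pow2_ge_0 (Q1 r)). lra. }
  assert (D2 : 2 / r <= 1) by (apply (Rle_div_l _ _ r); lra).
  pose proof (Rabs_pos (Q r)).
  apply Rle_trans with (A * (2 * Rabs (Q1 r) + 2 * Rabs (g * Q r / r) + (2 + 2 / r) * Rabs (Q r))).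
  { apply Rmult_le_compat_r.
    - pose proof (Rabs_pos (g * Q r / r)).
      assert (0 <= 2 / r) by (apply Rdiv_le_0_compat; lra).
      assert (0 <= (2 + 2 / r) * Rabs (Q r)) by (apply Rmult_le_pos; lra). lra.
    - apply (Rle_div_l _ _ (2 * r)); [lra|]. nra. }
  apply Rle_trans with (A * (6 * Rabs (Q1 r) + 3 * Rabs (Q r))).
  { apply Rmult_le_compat_l; auto. nra. }
  unfold forbidden_size_const. fold L s.
  assert (0 < s * ek) by (apply Rmult_lt_0_compat; auto). lra.
Qed.

Let exp_g_le : exp (- g) <= exp 1 * exp (- k).
Proof. rewrite <- exp_plus. apply exp_le_exp. lra. Qed.

(** (2r)^(g-1) = 4^(g-1) (r/2)^(g-1), and [amplitude_decay] absorbs 4^g with a gain e^(-g). The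
    factor g of the crude bound costs half the exponent, by k e^(-k) <= 2 e^(-k/2). *)
Lemma radial_size_origin (r : R) : 0 < r <= 2 ->
  radial_size nu g r <= 1000 * exp 22 * (Rpower (r / 2) (g - 1) * exp (- (k / 2))).
Proof.
  intros Hr. eapply Rle_trans; [apply radial_size_crude; lra|].
  assert (HA := amplitude_decay nu g Hg). assert (HN := amplitude_nonneg nu g Hg).
  set (a := amplitude nu g) in *.
  set (w := Rpower (r / 2) (g - 1)). assert (Hw : 0 < w) by apply exp_pos.
  assert (E : a * Rpower (2 * r) (g - 1) = a * Rpower 4 g * w / 4).
  { unfold w. replace (Rpower 4 g) with (Rpower 4 (g - 1) * 4).
    - replace (2 * r) with (4 * (r / 2)) by field. rewrite <- Rpower_mult_distr by lra. field.
    - rewrite <- (Rpower_1 4) at 2 by lra. rewrite <- Rpower_plus. f_equal. ring. }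
  rewrite E.
  assert (He : exp (2 * r) <= exp 4) by (apply exp_le_exp; lra).
  pose proof (exp_pos (2 * r)). pose proof (exp_pos 17) as H17.
  assert (F1 : (12 + 20 * r + 10 * g) * exp (2 * r) <= (62 * k) * exp 4).
  { apply Rmult_le_compat; lra. }
  assert (F2 : a * Rpower 4 g <= 2 * exp 18 * exp (- k)).
  { eapply Rle_trans; [exact HA|]. replace 18 with (17 + 1) by ring. rewrite exp_plus. nra. }
  assert (F3 : k * exp (- k) <= 2 * exp (- (k / 2))).
  { replace (- k) with (- (k / 2) + - (k / 2)) by field. rewrite exp_plus.
    assert (L := exp_ineq1_le (k / 2)).
    assert (E1 : exp (- (k / 2)) * exp (k / 2) = 1) by (rewrite <- exp_plus, Rplus_opp_l; apply exp_0).
    pose proof (exp_pos (- (k / 2))). nra. }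
  assert (H4 : 0 <= a * Rpower 4 g) by (apply Rmult_le_pos; [auto|left; apply exp_pos]).
  apply Rle_trans with (2 * exp 18 * exp (- k) * w / 4 * (62 * k * exp 4)).
  { apply Rmult_le_compat; auto.
    - apply Rdiv_le_0_compat; [apply Rmult_le_pos; lra|lra].
    - apply Rmult_le_pos; lra.
    - unfold Rdiv. apply Rmult_le_compat_r; [lra|]. apply Rmult_le_compat_r; lra. }
  replace (2 * exp 18 * exp (- k) * w / 4 * (62 * k * exp 4)) with
    (31 * (exp 18 * exp 4) * w * (k * exp (- k))) by field.
  rewrite <- exp_plus. replace (18 + 4) with 22 by ring.
  pose proof (exp_pos 22).
  apply Rle_trans with (31 * exp 22 * w * (2 * exp (- (k / 2)))).
  { apply Rmult_le_compat_l; [repeat apply Rmult_le_pos; lra|auto]. }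
  pose proof (exp_pos (- (k / 2))).
  assert (0 < exp 22 * w * exp (- (k / 2))) by (repeat apply Rmult_lt_0_compat; auto). lra.
Qed.

Definition compact_size_const : R :=
  2 * exp 17 * exp (216 * 864) * (20000 * exp 864).

(** 1/2 is the least value of k/2 for k >= 1, and 432 is twice 216: the range left over by the
    estimates for small k. *)
Lemma radial_size_compact (r : R) : k <= 216 -> 1 / 2 <= r <= 432 ->
  radial_size nu g r <= compact_size_const.
Proof.
  intros Hk216 Hr. eapply Rle_trans; [apply radial_size_crude; lra|].
  assert (HA := amplitude_decay nu g Hg). assert (HN := amplitude_nonneg nu g Hg).
  set (a := amplitude nu g) in *. unfold compact_size_const.
  pose proof (exp_pos 17).
  assert (H1 : a <= 2 * exp 17).
  { assert (1 <= Rpower 4 g).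
    { unfold Rpower. rewrite <- exp_0. apply exp_le_exp.
      assert (0 <= ln 4) by (rewrite <- ln_1; apply ln_le; lra). nra. }
    assert (exp (- g) <= 1) by (rewrite <- exp_0; apply exp_le_exp; lra). nra. }
  assert (H2 : Rpower (2 * r) (g - 1) <= exp (216 * 864)).
  { unfold Rpower. apply exp_le_exp.
    assert (L0 : 0 <= ln (2 * r)) by (rewrite <- ln_1; apply ln_le; lra).
    assert (L1 := ln_le_sub1 (2 * r) ltac:(lra)).
    apply Rle_trans with (216 * ln (2 * r)); [apply Rmult_le_compat_r; lra|].
    apply Rmult_le_compat_l; lra. }
  assert (H3 : (12 + 20 * r + 10 * g) * exp (2 * r) <= 20000 * exp 864).
  { apply Rmult_le_compat; try lra; [left; apply exp_pos|apply exp_le_exp; lra]. }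
  assert (0 < Rpower (2 * r) (g - 1)) by apply exp_pos.
  pose proof (exp_pos (2 * r)).
  apply Rmult_le_compat; auto.
  - apply Rmult_le_pos; lra.
  - apply Rmult_le_pos; lra.
  - apply Rmult_le_compat; lra.
Qed.
End Size.

(** * The radial eigenfunction *)

Lemma is_RInt_gen_pair (f : R -> C) (Fa Fb : (R -> Prop) -> Prop) {FFa : Filter Fa} {FFb : Filter Fb}
  (l1 l2 : R) :
  is_RInt_gen (fun t => Re (f t)) Fa Fb l1 -> is_RInt_gen (fun t => Im (f t)) Fa Fb l2 ->
  @is_RInt_gen C_R_NormedModule f Fa Fb (l1, l2).
Proof.
  intros H1 H2 Pr [e He].
  assert (A1 := H1 (ball l1 e) (ex_intro _ e (fun y Hy => Hy))).
  assert (A2 := H2 (ball l2 e) (ex_intro _ e (fun y Hy => Hy))).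
  unfold filtermapi in *.
  apply (filter_imp (F := filter_prod Fa Fb) _ _) with (2 := filter_and _ _ A1 A2).
  intros [a b] [[y1 [I1 B1]] [y2 [I2 B2]]]. exists (y1, y2). split.
  - exact (is_RInt_fct_extend_pair f a b y1 y2 I1 I2).
  - apply He. split; [exact B1|exact B2].
Qed.

Lemma gamma_integrand (g nu t : R) :
  (Cexp ((RtoC g + 1 + Ci * RtoC nu - 1) * RtoC (ln t)) * RtoC (exp (- t)))%C =
  (exp (- (1 * t)) * (Rpower t g * cos (nu * ln t)), exp (- (1 * t)) * (Rpower t g * sin (nu * ln t))).
Proof.
  replace ((RtoC g + 1 + Ci * RtoC nu - 1) * RtoC (ln t))%C with ((g * ln t, nu * ln t) : C)
    by (apply Ceq; simpl; ring).
  unfold Cexp, Rpower. rewrite Rmult_1_l. apply Ceq; simpl; ring.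
Qed.

Lemma CGamma_halfline (g nu : R) : 0 <= g ->
  CGamma (RtoC g + 1 + Ci * RtoC nu) = (gamma_cos g nu, gamma_sin g nu).
Proof.
  intros Hg. unfold CGamma.
  apply (is_RInt_gen_unique (V:=C_R_CompleteNormedModule)).
  apply is_RInt_gen_pair; try typeclasses eauto.
  - refine (is_RInt_gen_ext _ _ _ _ (halfline_int_RInt_gen _ _
      (fun t Ht => laplace_continuous _ 1 t (proj1 (subexponential_Rpower_cos g nu Hg)) Ht)
      (laplace_correct _ 1 Rlt_0_1 (subexponential_Rpower_cos g nu Hg)))); try typeclasses eauto.
    apply filter_forall. intros ? t _. rewrite gamma_integrand. simpl. ring.
  - refine (is_RInt_gen_ext _ _ _ _ (halfline_int_RInt_gen _ _
      (fun t Ht => laplace_continuous _ 1 t (proj1 (subexponential_Rpower_sin g nu Hg)) Ht)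
      (laplace_correct _ 1 Rlt_0_1 (subexponential_Rpower_sin g nu Hg)))); try typeclasses eauto.
    apply filter_forall. intros ? t _. rewrite gamma_integrand. simpl. ring.
Qed.

Lemma CGamma_real (g : R) : 0 <= g -> CGamma (2 * RtoC g + 1) = RtoC (gamma_int (2 * g)).
Proof.
  intros Hg. replace (2 * RtoC g + 1)%C with (RtoC (2 * g) + 1 + Ci * RtoC 0)%C
    by (apply Ceq; simpl; ring).
  rewrite CGamma_halfline by lra. apply Ceq; simpl.
  - unfold gamma_cos. apply laplace_eq; [lra|apply subexponential_Rpower_cos; lra|].
    eapply halfline_int_ext; [|apply (laplace_correct _ 1 Rlt_0_1 (subexponential_Rpower (2 * g) ltac:(lra)))].
    intros t Ht. cbv beta. rewrite Rmult_0_l, cos_0. ring.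
  - unfold gamma_sin. apply laplace_eq; [lra|apply subexponential_Rpower_sin; lra|].
    assert (I := halfline_int_scal _ 0 _
      (laplace_correct _ 1 Rlt_0_1 (subexponential_Rpower (2 * g) ltac:(lra)))).
    rewrite Rmult_0_l in I. eapply halfline_int_ext; [|exact I].
    intros t Ht. cbv beta. rewrite !Rmult_0_l, sin_0. ring.
Qed.

Lemma hyp1F1_kummer (nu g rho : R) : 0 <= g ->
  hyp1F1 (RtoC g - Ci * RtoC nu) (2 * RtoC g + 1) (- (2 * Ci * RtoC rho))
  = (kummer_re nu g rho, kummer_im nu g rho).
Proof.
  intros Hg. unfold hyp1F1, kummer_re, kummer_im, PSeries.
  replace (RtoC g - Ci * RtoC nu)%C with ((g, (- nu)%R) : C) by (apply Ceq; simpl; ring).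
  f_equal; apply Series_ext; intros n; rewrite hyp1F1_term_coeff by auto; simpl;
    unfold Re, Im; ring.
Qed.

(** The coefficients are (-i)^n times polynomials in a with real coefficients; the sign (-1)^n is
    later compensated by r -> -r. *)
Lemma kummer_coeff_conj (x y g : R) (n : nat) :
  kummer_coeff (x, (- y)%R) g n = (RtoC ((-1) ^ n) * Cconj (kummer_coeff (x, y) g n))%C.
Proof.
  induction n as [|n IH]; cbn [kummer_coeff].
  - apply Ceq; simpl; ring.
  - rewrite IH. destruct (kummer_coeff (x, y) g n) as [p q].
    apply Ceq; simpl; ring.
Qed.

Lemma kummer_neg (nu g r : R) :
  kummer_re nu g (- r) = kummer_re (- nu) g r /\ kummer_im nu g (- r) = - kummer_im (- nu) g r.
Proof.
  assert (E : forall n, (- r) ^ n = (-1) ^ n * r ^ n).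
  { intros n. rewrite <- Rpow_mult_distr. f_equal. ring. }
  unfold kummer_re, kummer_im. split.
  - apply Series_ext. intros n. rewrite E, (kummer_coeff_conj g (- nu) g n).
    destruct (kummer_coeff (g, (- nu)%R) g n) as [p q]. simpl. ring.
  - rewrite <- PSeries_opp. apply Series_ext. intros n. unfold PS_opp.
    rewrite E, (kummer_coeff_conj g (- nu) g n).
    destruct (kummer_coeff (g, (- nu)%R) g n) as [p q]. unfold opp; simpl. ring.
Qed.

Lemma coulomb_neg (nu g r : R) :
  coulomb_X nu g (- r) = coulomb_X (- nu) g r /\ coulomb_Y nu g (- r) = - coulomb_Y (- nu) g r.
Proof.
  unfold coulomb_X, coulomb_Y. destruct (kummer_neg nu g r) as [-> ->].
  rewrite cos_neg, sin_neg. split; ring.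
Qed.

(* For rho < 0, M_nu(rho) is the conjugate of M_(-nu)(-rho). *)
Lemma coulomb_abs (nu g rho : R) : -1 <= nu <= 1 -> 0 <= g -> 1 <= g ^ 2 + nu ^ 2 -> rho <> 0 ->
  exists nu' dX dY, (nu' = nu \/ nu' = - nu) /\
    is_derive (coulomb_X nu g) rho dX /\ is_derive (coulomb_Y nu g) rho dY /\
    coulomb_X nu g rho ^ 2 + coulomb_Y nu g rho ^ 2 =
      coulomb_X nu' g (Rabs rho) ^ 2 + coulomb_Y nu' g (Rabs rho) ^ 2 /\
    dX ^ 2 + dY ^ 2 = (- (1 + 2 * nu' / Rabs rho) * coulomb_Y nu' g (Rabs rho)) ^ 2
           + (coulomb_X nu' g (Rabs rho) - 2 * g / Rabs rho * coulomb_Y nu' g (Rabs rho)) ^ 2.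
Proof.
  intros Hnu Hg Hgn Hrho. destruct (Rlt_le_dec 0 rho) as [H|H].
  - rewrite (Rabs_pos_eq rho) by lra.
    assert (Hp := coulomb_pair_kummer nu g ltac:(nra) Hg Hgn).
    exists nu. eexists; eexists. split; [auto|].
    split; [apply (coulomb_dX _ _ _ _ Hp); auto|].
    split; [apply (coulomb_dY _ _ _ _ Hp); auto|]. split; reflexivity.
  - rewrite (Rabs_left rho) by lra. set (r := - rho).
    assert (Hr : 0 < r) by (unfold r; lra).
    assert (Hp := coulomb_pair_kummer (- nu) g ltac:(nra) Hg ltac:(nra)).
    assert (D1 := coulomb_dX _ _ _ _ Hp r Hr). assert (D2 := coulomb_dY _ _ _ _ Hp r Hr).
    exists (- nu), (- (- (1 + 2 * - nu / r) * coulomb_Y (- nu) g r)),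
      (coulomb_X (- nu) g r - 2 * g / r * coulomb_Y (- nu) g r).
    split; [auto|]. split; [|split; [|split]].
    + apply (is_derive_ext (fun x => coulomb_X (- nu) g (- x))).
      { intros t. destruct (coulomb_neg nu g (- t)) as [E _]. rewrite <- E, Ropp_involutive. reflexivity. }
      auto_derive; [eexists; exact D1|].
      replace (Derive (fun x => coulomb_X (- nu) g x) (- rho)) with
        (- (1 + 2 * - nu / r) * coulomb_Y (- nu) g r) by (symmetry; apply is_derive_unique; exact D1).
      ring.
    + apply (is_derive_ext (fun x => - coulomb_Y (- nu) g (- x))).
      { intros t. destruct (coulomb_neg nu g (- t)) as [_ E]. rewrite <- E, Ropp_involutive. reflexivity. }
      auto_derive; [eexists; exact D2|].
      replace (Derive (fun x => coulomb_Y (- nu) g x) (- rho)) with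
        (coulomb_X (- nu) g r - 2 * g / r * coulomb_Y (- nu) g r) by (symmetry; apply is_derive_unique; exact D2).
      ring.
    + replace rho with (- r) by (unfold r; ring).
      destruct (coulomb_neg nu g r) as [-> ->]. ring.
    + ring.
Qed.

Lemma Rpower_abs_derive (rho p : R) : rho <> 0 ->
  is_derive (fun x => Rpower (Rabs (2 * x)) p) rho (p / rho * Rpower (Rabs (2 * rho)) p).
Proof.
  intros H. unfold Rpower. destruct (Rlt_le_dec 0 rho) as [Hp|Hn].
  - apply (is_derive_ext_loc (fun x => exp (p * ln (2 * x)))).
    + exists (mkposreal rho Hp). intros y Hy. change (Rabs (y - rho) < rho) in Hy.
      apply Rabs_lt_between in Hy. rewrite Rabs_pos_eq; [reflexivity|lra].
    + rewrite (Rabs_pos_eq (2 * rho)) by lra. auto_derive; [lra|]. field. lra.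
  - assert (Hn' : 0 < - rho) by lra.
    apply (is_derive_ext_loc (fun x => exp (p * ln (- (2 * x))))).
    + exists (mkposreal (- rho) Hn'). intros y Hy. change (Rabs (y - rho) < - rho) in Hy.
      apply Rabs_lt_between in Hy. rewrite Rabs_left; [reflexivity|lra].
    + rewrite (Rabs_left (2 * rho)) by lra. auto_derive; [lra|]. field. lra.
Qed.

Lemma enorm_rotate (d x y c s : R) : 0 <= d -> c ^ 2 + s ^ 2 = 1 ->
  enorm (d * (s * x + c * y), d * (c * x - s * y)) = d * sqrt (x ^ 2 + y ^ 2).
Proof.
  intros Hd cs. unfold enorm. cbn [fst snd].
  replace (_ + _) with (d ^ 2 * ((c ^ 2 + s ^ 2) * (x ^ 2 + y ^ 2))) by ring.
  rewrite cs, Rmult_1_l, sqrt_mult_alt by apply pow2_ge_0.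
  rewrite sqrt_pow2 by auto. reflexivity.
Qed.

Section Eigenfunction.
Variables (nu : R) (k : Z) (xi : R).
Hypothesis Hnu : -1 <= nu <= 1.
Hypothesis Hk0 : k <> 0%Z.

Let g := gam nu k.
Let ak := Rabs (IZR k).

Lemma abs_IZR_ge_1 : 1 <= ak.
Proof. unfold ak. rewrite <- abs_IZR. apply IZR_le. lia. Qed.

Lemma gam_nonneg : 0 <= g.
Proof. apply sqrt_pos. Qed.

Lemma gam_sq : g ^ 2 + nu ^ 2 = ak ^ 2.
Proof.
  assert (H := abs_IZR_ge_1). unfold g, gam, ak in *. rewrite pow2_abs.
  assert (1 <= IZR k ^ 2) by (rewrite <- pow2_abs; nra).
  rewrite pow2_sqrt by nra. ring.
Qed.

(** The eigenfunction is the pair (X, Y) rotated by xi and scaled, so xi disappears from Euclidean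
    norms. *)
Lemma GiF_polar (rho : R) :
  let D := amplitude nu g * exp (PI * nu / 2) * Rpower (Rabs (2 * rho)) (g - 1) in
  Gk nu k xi rho = D * (cos xi * coulomb_X nu g rho - sin xi * coulomb_Y nu g rho) /\
  Fk nu k xi rho = D * (sin xi * coulomb_X nu g rho + cos xi * coulomb_Y nu g rho).
Proof.
  intros D. assert (Hg := gam_nonneg). assert (HG := gamma_int_pos (2 * g) ltac:(lra)).
  unfold Gk, Fk, GiF. fold g. cbv zeta.
  rewrite CGamma_halfline, CGamma_real, hyp1F1_kummer by auto.
  unfold Cmod at 1. unfold Cmod at 1. cbn [fst snd].
  replace (RtoC (sqrt 2 * sqrt (gamma_cos g nu ^ 2 + gamma_sin g nu ^ 2)) / RtoC (gamma_int (2 * g)))%C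
    with (RtoC (amplitude nu g)).
  2:{ unfold amplitude. rewrite RtoC_div by lra. reflexivity. }
  replace (Cexp (RtoC (PI * nu / 2) + Ci * RtoC (rho + xi))) with
    (RtoC (exp (PI * nu / 2)) * (cos (rho + xi), sin (rho + xi)))%C.
  2:{ apply Ceq; simpl; unfold Re, Im; simpl;
      replace (PI * nu / 2 + (0 * (rho + xi) - 1 * 0)) with (PI * nu / 2) by ring;
      replace (0 + (0 * 0 + 1 * (rho + xi))) with (rho + xi) by ring; ring. }
  unfold D, coulomb_X, coulomb_Y. rewrite cos_plus, sin_plus.
  split; simpl; unfold Re, Im; simpl; ring.
Qed.

(** The power |2 rho|^(g-1) has logarithmic derivative (g - 1)/rho, exactly what j1 subtracts. For
    rho < 0 the sign of nu changes in the radial factor, but not in e^(pi nu/2). *)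
Lemma eigenfunction_size (rho : R) : rho <> 0 ->
  exists nu', (nu' = nu \/ nu' = - nu) /\
  j0 nu k xi rho + j1 nu k xi rho = exp (PI * nu / 2) * radial_size nu' g (Rabs rho).
Proof.
  intros Hrho. assert (Hg := gam_nonneg). assert (Hak := abs_IZR_ge_1). assert (Hs := gam_sq).
  destruct (coulomb_abs nu g rho Hnu Hg ltac:(nra) Hrho) as [nu' [dX [dY [Hnu' [D1 [D2 [E1 E2]]]]]]].
  exists nu'. split; [auto|].
  set (A := amplitude nu g * exp (PI * nu / 2)).
  assert (HA : 0 <= A).
  { apply Rmult_le_pos; [apply amplitude_nonneg, Hg|left; apply exp_pos]. }
  set (D := A * Rpower (Rabs (2 * rho)) (g - 1)).
  assert (HD : 0 <= D) by (apply Rmult_le_pos; [auto|left; apply exp_pos]).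
  assert (DW := Rpower_abs_derive rho (g - 1) Hrho).
  assert (cs : cos xi ^ 2 + sin xi ^ 2 = 1) by apply cos2_sin2.
  assert (dpolar : forall c s, is_derive (fun x => A * Rpower (Rabs (2 * x)) (g - 1) *
      (c * coulomb_X nu g x + s * coulomb_Y nu g x)) rho
    ((g - 1) * / rho * (D * (c * coulomb_X nu g rho + s * coulomb_Y nu g rho)) + D * (c * dX + s * dY))).
  { intros c s. unfold D.
    set (W := fun x => Rpower (Rabs (2 * x)) (g - 1)) in *.
    change (is_derive (fun x => A * W x * (c * coulomb_X nu g x + s * coulomb_Y nu g x)) rho
      ((g - 1) * / rho * (A * W rho * (c * coulomb_X nu g rho + s * coulomb_Y nu g rho)) +
       A * W rho * (c * dX + s * dY))).
    change (is_derive W rho ((g - 1) / rho * W rho)) in DW. clearbody W.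
    auto_derive; [repeat split; eexists; eassumption|].
    rewrite_derives. field. auto. }
  assert (dG : Derive (Gk nu k xi) rho = (g - 1) * / rho * Gk nu k xi rho + D * (cos xi * dX - sin xi * dY)).
  { rewrite (proj1 (GiF_polar rho)). apply is_derive_unique.
    eapply is_derive_ext; [intros x; symmetry; apply (GiF_polar x)|].
    evar_last; [eapply is_derive_ext; [|exact (dpolar (cos xi) (- sin xi))]|].
    - intros x. cbv beta. unfold A. as_R_eq. ring.
    - unfold D, A. as_R_eq. ring. }
  assert (dF : Derive (Fk nu k xi) rho = (g - 1) * / rho * Fk nu k xi rho + D * (sin xi * dX + cos xi * dY)).
  { rewrite (proj2 (GiF_polar rho)). apply is_derive_unique.
    eapply is_derive_ext; [intros x; symmetry; apply (GiF_polar x)|].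
    exact (dpolar (sin xi) (cos xi)). }
  assert (J0 : j0 nu k xi rho = D * sqrt (coulomb_X nu g rho ^ 2 + coulomb_Y nu g rho ^ 2)).
  { unfold j0, psi. destruct (GiF_polar rho) as [-> ->]. fold A. fold D. apply enorm_rotate; auto. }
  assert (J1 : j1 nu k xi rho = D * sqrt (dX ^ 2 + dY ^ 2)).
  { unfold j1, dpsi, psi. cbn [fst snd]. fold g. rewrite dG, dF.
    rewrite <- (enorm_rotate D dX dY (cos xi) (sin xi)) by auto.
    f_equal. f_equal; ring. }
  rewrite J0, J1, E1, E2. unfold radial_size.
  replace (amplitude nu' g) with (amplitude nu g).
  2:{ destruct Hnu' as [-> | ->]; [reflexivity|symmetry; apply amplitude_sym, Hg]. }
  unfold D, A. rewrite Rabs_mult, (Rabs_pos_eq 2) by lra. ring.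
Qed.

Lemma exp_half_pi_nu_le : 0 < exp (PI * nu / 2) <= exp 2.
Proof.
  split; [apply exp_pos|]. apply exp_le_exp. assert (H := PI_4). assert (H' := PI_RGT_0). nra.
Qed.
End Eigenfunction.

Theorem theorem1p1 :
  (exists C0 D : R, 0 < C0 /\ 0 < D /\
    forall (nu : R) (k : Z) (xi rho : R),
      -1 <= nu <= 1 -> k <> 0%Z -> is_phase_shift nu k xi -> rho <> 0 ->
      let g := gam nu k in
      let ak := Rabs (IZR k) in
      let J := j0 nu k xi rho + j1 nu k xi rho in
      (0 < Rabs rho <= Rmax (ak / 2) 2 ->
         J <= C0 * (Rpower (Rmin (Rabs rho / 2) 1) (g - 1) * exp (- D * ak)))
      /\ (ak / 2 <= Rabs rho <= 2 * ak ->
         J <= C0 * (Rpower ak (- (3 / 4))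
                    * Rpower (Rabs (ak - Rabs rho) + Rpower ak (1 / 3))
                             (- (1 / 4))))
      /\ (2 * ak <= Rabs rho -> J <= C0 * / Rabs rho))%R.
Proof.
  assert (HCc : 0 < compact_size_const).
  { unfold compact_size_const. pose proof (exp_pos 17). pose proof (exp_pos (216 * 864)).
    pose proof (exp_pos 864). repeat apply Rmult_lt_0_compat; lra. }
  assert (HCf : 0 <= forbidden_size_const).
  { unfold forbidden_size_const. apply Rmult_le_pos; [lra|apply sqrt_pos]. }
  assert (HCt : 0 <= transition_size_const).
  { unfold transition_size_const. apply Rmult_le_pos; [lra|apply sqrt_pos]. }
  (* A lower bound for the transition profile when k < 216: there |k - r| + k^(1/3) <= 216 + 216 <=
     438. *)
  set (low := Rpower 216 (- (3 / 4)) * Rpower 438 (- (1 / 4))).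
  assert (Hlow : 0 < low) by (apply Rmult_lt_0_compat; apply exp_pos).
  pose proof (exp_pos 22) as He22. pose proof (exp_pos 5) as He5. pose proof (exp_pos 7) as He7.
  (* e^7 compensates e^(-k/32) for k <= 216, as 216/32 < 7. *)
  set (C1 := 1000 * exp 22 + forbidden_size_const + compact_size_const * exp 7).
  set (C2 := transition_size_const + compact_size_const / low).
  set (C3 := 10 * exp 5 + 432 * compact_size_const).
  assert (0 < compact_size_const * exp 7) by (apply Rmult_lt_0_compat; auto).
  assert (0 < compact_size_const / low) by (apply Rdiv_lt_0_compat; auto).
  set (C := C1 + C2 + C3).
  assert (HC1 : 0 < C1) by (unfold C1; lra).
  assert (HC2 : 0 < C2) by (unfold C2; lra).
  assert (HC3 : 0 < C3) by (unfold C3; lra).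
  (* e^2 bounds e^(pi nu/2); 1/32 lies below both rates obtained, 1/2 near the origin and 1/16 in
     the forbidden region. *)
  exists (exp 2 * C), (/ 32). split; [|split; [lra|]].
  { apply Rmult_lt_0_compat; [apply exp_pos|unfold C; lra]. }
  intros nu k xi rho Hnu Hk _ Hrho g ak J.
  assert (Hak := abs_IZR_ge_1 k Hk). assert (Hg := gam_nonneg nu k).
  assert (Hs := gam_sq nu k Hnu Hk). fold g in Hg, Hs. fold ak in Hak, Hs.
  destruct (eigenfunction_size nu k xi Hnu Hk rho Hrho) as [nu' [Hnu' EJ]].
  fold J g in EJ. rewrite EJ.
  assert (Hnu1 : -1 <= nu' <= 1) by (destruct Hnu'; lra).
  assert (Hs' : g ^ 2 + nu' ^ 2 = ak ^ 2) by (destruct Hnu' as [-> | ->]; lra).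
  assert (Hexp := exp_half_pi_nu_le nu Hnu).
  assert (Hr : 0 < Rabs rho) by (apply Rabs_pos_lt; auto).
  set (r := Rabs rho) in *. clearbody g ak r. clear Hnu Hs Hnu' EJ Hrho J.
  assert (key : forall c b, 0 <= c <= C -> 0 <= b -> radial_size nu' g r <= c * b ->
    exp (PI * nu / 2) * radial_size nu' g r <= exp 2 * C * b).
  { intros c b Hc Hb Hx. assert (0 <= C * b) by (apply Rmult_le_pos; lra).
    assert (radial_size nu' g r <= C * b).
    { eapply Rle_trans; [exact Hx|]. apply Rmult_le_compat_r; lra. }
    rewrite Rmult_assoc. nra. }
  split; [|split].
  - intros Hrange.
    assert (Hb : 0 <= Rpower (Rmin (r / 2) 1) (g - 1) * exp (- / 32 * ak))
      by (apply Rmult_le_pos; left; apply exp_pos).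
    apply (key C1); [unfold C; lra|auto|].
    destruct (Rle_dec r 2) as [H2|H2].
    + rewrite Rmin_left by lra.
      eapply Rle_trans; [apply (radial_size_origin nu' g ak); auto; lra|].
      assert (He : exp (- (ak / 2)) <= exp (- / 32 * ak)) by (apply exp_le_exp; lra).
      assert (Hw : 0 < Rpower (r / 2) (g - 1)) by apply exp_pos.
      pose proof (exp_pos (- (ak / 2))).
      apply Rmult_le_compat; [lra| |unfold C1; lra|].
      * apply Rmult_le_pos; lra.
      * apply Rmult_le_compat_l; lra.
    + rewrite Rmin_right, Rpower_1_base, Rmult_1_l by lra.
      (* As r > 2, the maximum in the range can only be k/2. *)
      assert (Hrk : r <= ak / 2).
      { destruct (Rle_dec r (ak / 2)) as [|N]; auto. exfalso.
        assert (Rmax (ak / 2) 2 < r) by (apply Rmax_lub_lt; lra). lra. }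
      pose proof (exp_pos (- / 32 * ak)).
      destruct (Rle_dec 216 ak) as [Hbig|Hsmall].
      * eapply Rle_trans; [apply (radial_size_forbidden nu' g ak); auto; lra|].
        assert (He : exp (- (ak / 16)) <= exp (- / 32 * ak)) by (apply exp_le_exp; lra).
        pose proof (exp_pos (- (ak / 16))).
        apply Rmult_le_compat; try lra. unfold C1; lra.
      * eapply Rle_trans; [apply (radial_size_compact nu' g ak); auto; lra|].
        assert (He : 1 <= exp 7 * exp (- / 32 * ak)).
        { rewrite <- exp_plus, <- exp_0. apply exp_le_exp. lra. }
        apply Rle_trans with (compact_size_const * exp 7 * exp (- / 32 * ak)).
        -- rewrite Rmult_assoc. nra.
        -- apply Rmult_le_compat_r; [lra|]. unfold C1; lra.
  - intros Hrange.
    set (b := Rpower ak (- (3 / 4)) * Rpower (Rabs (ak - r) + Rpower ak (1 / 3)) (- (1 / 4))).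
    assert (Hb : 0 < b) by (apply Rmult_lt_0_compat; apply exp_pos).
    apply (key C2); [unfold C; lra|lra|].
    destruct (Rle_dec 216 ak) as [Hbig|Hsmall].
    + eapply Rle_trans; [apply (radial_size_transition nu' g ak); auto; lra|].
      apply Rmult_le_compat_r; [fold b; lra|unfold C2; lra].
    + eapply Rle_trans; [apply (radial_size_compact nu' g ak); auto; lra|].
      assert (Hlb : low <= b).
      { assert (T : Rpower ak (1 / 3) <= ak).
        { rewrite <- (Rpower_1 ak) at 2 by lra. apply Rle_Rpower; lra. }
        assert (Tp : 0 < Rpower ak (1 / 3)) by apply exp_pos.
        assert (T2 : Rabs (ak - r) <= 216) by (apply Rabs_le; lra).
        pose proof (Rabs_pos (ak - r)).
        assert (mono : forall x y p, 0 < x <= y -> 0 <= p -> Rpower y (- p) <= Rpower x (- p)).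
        { intros x y p Hxy Hp. unfold Rpower. apply exp_le_exp.
          assert (ln x <= ln y) by (apply ln_le; lra). nra. }
        apply Rmult_le_compat; try (left; apply exp_pos); apply mono; lra. }
      apply Rle_trans with (compact_size_const / low * b).
      * replace compact_size_const with (compact_size_const / low * low) at 1 by (field; lra).
        apply Rmult_le_compat_l; lra.
      * apply Rmult_le_compat_r; [lra|unfold C2; lra].
  - intros Hrange.
    assert (Hb : 0 < / r) by (apply Rinv_0_lt_compat; auto).
    apply (key C3); [unfold C; lra|lra|].
    (* For k < 216 the far estimate with 216 in place of k applies from 432 on; between 2k and 432
       the compact bound is compared with 1/r. *)
    destruct (Rle_dec 216 ak) as [Hbig|Hsmall]; [|destruct (Rle_dec 432 r) as [Hfar|Hnear]].
    + eapply Rle_trans; [apply (radial_size_far nu' g ak) with (kap := ak); auto; lra|].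
      apply Rmult_le_compat_r; [lra|unfold C3; lra].
    + eapply Rle_trans; [apply (radial_size_far nu' g ak) with (kap := 216); auto; lra|].
      apply Rmult_le_compat_r; [lra|unfold C3; lra].
    + eapply Rle_trans; [apply (radial_size_compact nu' g ak); auto; lra|].
      apply Rle_trans with (432 * compact_size_const * / r).
      * apply (Rle_div_r compact_size_const _ r); [lra|]. nra.
      * apply Rmult_le_compat_r; [lra|unfold C3; lra].
Qed.
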